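(* Consider the manifold coordinated by $(\xi^j,\tau,[a_i(t)])$, where $a_i\in\mathcal{C}^0(\mathbb{R})$, $i=1,2,3$, and $(\xi^j,\tau)\in\mathbb{R}^4$ satisfy $1+\vec\xi\cdot\vec a(\tau)>0$. Let $\mathbf{P}_\mu$, $\mathbf{J}_{\alpha\beta}$ and $\mathbf{D}_{i(t)}$ ($\mu,\alpha,\beta=1,\dots,4$; $i=1,2,3$; $t\in\mathbb{R}$) be the generators on this manifold defined in the context, in terms of which the general infinitesimal transformation connecting Fermi-Walker coordinate systems is $$\mathbf{X}=f_0^\mu\,\mathbf{P}_\mu+\tfrac12\,\Omega_0^{\alpha\beta}\,\mathbf{J}_{\alpha\beta}+\int_{\mathbb{R}}dt\,\sum_{i=1}^3A_i(t)\,\mathbf{D}_{i(t)},$$ with constant parameters $f_0^\mu$ and $\Omega_0^{\alpha\beta}=-\Omega_0^{\beta\alpha}$ and three arbitrary functions $A_i(t)$. Then the commutation relations are $$[\mathbf{P}_\mu,\mathbf{P}_\nu]=0,\qquad[\mathbf{J}_{\alpha\beta},\mathbf{P}_\mu]=\eta_{\mu\alpha}\mathbf{P}_\beta-\eta_{\mu\beta}\mathbf{P}_\alpha,$$ $$[\mathbf{J}_{\alpha\beta},\mathbf{J}_{\mu\nu}]=\eta_{\mu\alpha}\mathbf{J}_{\beta\nu}-\eta_{\mu\beta}\mathbf{J}_{\alpha\nu}-\eta_{\nu\alpha}\mathbf{J}_{\beta\mu}+\eta_{\nu\beta}\mathbf{J}_{\alpha\mu},$$ $$[\mathbf{D}_{i(t)},\mathbf{P}_\mu]=0,\qquad[\mathbf{D}_{i(t)},\mathbf{J}_{\alpha\beta}]=0,\qquad[\mathbf{D}_{i(t)},\mathbf{D}_{j(t')}]=0.$$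 Thus the algebra of the infinitesimal transformations connecting Fermi-Walker coordinate systems is an abelian extension of the Poincaré algebra.
   Context: Greek indices run over $1,\dots,4$, Latin indices over $1,2,3$; repeated indices are summed, and indices are raised and lowered with $\eta_{\mu\nu}=\mathrm{diag}(1,1,1,-1)$. $\vec\xi\cdot\vec a=\sum_{i=1}^3\xi^ia_i$. In Fermi-Walker coordinates $(\xi^i,\tau)$ of Minkowski spacetime the invariant interval is $ds^2=d\vec\xi^2-[1+\vec\xi\cdot\vec a(\tau)]^2d\tau^2$, where the $a_i(\tau)$ are the components of the proper acceleration of the origin worldline. The infinitesimal transformations connecting Fermi-Walker coordinate systems are the infinitesimal transformations of the coordinates $(\xi^i,\tau)$ and of the functions $a_i$ (the latter by $a_i\mapsto a_i+\varepsilon A_i$) that preserve, to first order in $\varepsilon$, this form of the interval, possibly with different functions $a_i$. $W^\beta_{\;\;\alpha}(\tau)$ is the $4\times4$ matrix with $W^i_{\;\;4}=W^4_{\;\;i}=a_i(\tau)$ and all other entries zero, and $\Lambda^\mu_{\;\;\nu}(\tau)$ (a Lorentz matrix, depending on the functions $a_i$) is the solution of $\frac{d}{d\tau}\Lambda^\mu_{\;\;\nu}=\Lambda^\mu_{\;\;\beta}W^\beta_{\;\;\nu}$, $\Lambda^\mu_{\;\;\nu}(0)=\delta^\mu_\nu$. Put $G^\mu_{\;\;\rho}(\tau,t)=\Lambda_\nu^{\;\;\mu}(\tau)\,\Lambda^\nu_{\;\;\rho}(t)$. Normalized partial derivatives: $\hat\partial_i=\partial/\partial\xi^i$ and $\hat\partial_4=\frac{1}{1+\vec\xi\cdot\vec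 a(\tau)}\,\partial_\tau$. $\delta/\delta a^i(t)$ denotes the functional derivative. Generators: - $\mathbf{P}_\mu=\Lambda_\mu^{\;\;\nu}(\tau)\,\hat\partial_\nu$. - $\mathbf{J}_{\alpha\beta}=k_\beta\mathbf{P}_\alpha-k_\alpha\mathbf{P}_\beta$, where $k^\beta(\tau,\vec\xi)=\Lambda^\beta_{\;\;j}(\tau)\,\xi^j+\int_0^\tau dt'\,\Lambda^\beta_{\;\;4}(t')$. - $\mathbf{D}_{i(t)}=\frac{\delta}{\delta a^i(t)}+\chi(t,\tau)\left[\Lambda^{\mu4}(t)\,\Delta^i(\tau,t,\vec\xi)-\Lambda^{\mu i}(t)\,\Delta^4(\tau,t,\vec\xi)\right]\mathbf{P}_\mu$, where $\chi(t,\tau)=\theta(t)\theta(\tau-t)-\theta(-t)\theta(t-\tau)$ with $\theta$ the Heaviside step function, and $\Delta^\nu(\tau,t,\vec\xi)=\xi^j\,G_j^{\;\;\nu}(\tau,t)+\int_t^\tau dt'\,G_4^{\;\;\nu}(t',t)$. *)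

(* Defs.v *)
From Stdlib Require Import Reals Lra ProofIrrelevance FunctionalExtensionality.
From Coquelicot Require Import Coquelicot.

Set Implicit Arguments.
Unset Strict Implicit.
Unset Printing Implicit Defensive.

Local Open Scope R_scope.

(* Latin indices 1, 2, 3 are x1, x2, x3; the Greek index 4 is Tm. *)
Inductive Lat : Type := x1 | x2 | x3.
Inductive Greek : Type := Sp (i : Lat) | Tm.

Definition sumL (F : Lat -> R) : R := F x1 + F x2 + F x3.
Definition sumG (F : Greek -> R) : R := sumL (fun i => F (Sp i)) + F Tm.

Definition deltaL (i j : Lat) : R :=
  match i, j with x1, x1 | x2, x2 | x3, x3 => 1 | _, _ => 0 end.
Definition deltaG (mu nu : Greek) : R :=
  match mu, nu with Sp i, Sp j => deltaL i j | Tm, Tm => 1 | _, _ => 0 end.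
Definition eta (mu nu : Greek) : R :=
  match mu, nu with Sp i, Sp j => deltaL i j | Tm, Tm => -1 | _, _ => 0 end.

(* eta is its own inverse, so the same matrix lowers and raises. *)
Definition lower_fst (M : Greek -> Greek -> R) (mu nu : Greek) : R :=
  sumG (fun al => eta mu al * M al nu).
Definition raise_snd (M : Greek -> Greek -> R) (mu nu : Greek) : R :=
  sumG (fun be => M mu be * eta be nu).

Definition path : Type := Lat -> R -> R.

Definition C0path (a : path) : Prop :=
  forall (i : Lat) (t : R), continuous (a i) t.

(* The same record serves for the points (xi, tau, [a]) and for the
   tangent directions (dxi, dtau, [da]). *)
Record point : Type := mkPoint { xi : Lat -> R; tau : R; acc : path }.

Definition lapse (p : point) : R :=
  1 + sumL (fun i => xi p i * acc p i (tau p)).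

Definition inM (p : point) : Prop := C0path (acc p) /\ 0 < lapse p.

Definition move (p v : point) (s : R) : point :=
  mkPoint (fun i => xi p i + s * xi v i) (tau p + s * tau v)
          (fun i t => acc p i t + s * acc v i t).

Definition field : Type := point -> R.
Definition operator : Type := field -> field.

Definition ex_dd (v : point) (F : field) (p : point) : Prop :=
  ex_derive (fun s => F (move p v s)) 0.
Definition dd (v : point) : operator :=
  fun F p => Derive (fun s => F (move p v s)) 0.

(* A distribution in t is represented by its action on continuous functions
   phi(t): (Facc i phi) stands for  int dt phi(t) delta/delta a^i(t). *)
Inductive frame : Type := Fcoord (mu : Greek) | Facc (i : Lat) (phi : R -> R).

Definition frame_ok (E : frame) : Prop :=
  match E with Fcoord _ => True | Facc _ phi => forall t, continuous phi t end.

Definition dir (E : frame) : point :=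
  match E with
  | Fcoord (Sp i) => mkPoint (deltaL i) 0 (fun _ _ => 0)
  | Fcoord Tm => mkPoint (fun _ => 0) 1 (fun _ _ => 0)
  | Facc i phi => mkPoint (fun _ => 0) 0 (fun j t => deltaL i j * phi t)
  end.

Definition hatd (mu : Greek) : operator :=
  match mu with
  | Sp i => dd (dir (Fcoord (Sp i)))
  | Tm => fun F p => / lapse p * dd (dir (Fcoord Tm)) F p
  end.

Definition fundd (i : Lat) (phi : R -> R) : operator := dd (dir (Facc i phi)).

Definition frame_op (E : frame) : operator :=
  match E with Fcoord mu => hatd mu | Facc i phi => fundd i phi end.

(* Functions of class C^n with respect to the normalized frame hatd, fundd,
   continuity being along two-parameter affine families of points.
   Since a is only continuous, 1 / lapse is not differentiable in tau, so that
   hatd, and not the plain tau-derivative, is what can be iterated. *)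
Definition fcont (F : field) : Prop :=
  forall p v w : point, inM p -> C0path (acc v) -> C0path (acc w) ->
    continuity_2d_pt (fun s t => F (move (move p v s) w t)) 0 0.

Fixpoint Ck (n : nat) (F : field) : Prop :=
  match n with
  | O => fcont F
  | S m => fcont F /\
      forall E : frame, frame_ok E ->
        (forall p, inM p -> ex_dd (dir E) F p) /\ Ck m (frame_op E F)
  end.

Definition Wmat (a : path) (t : R) (be al : Greek) : R :=
  match be, al with
  | Sp i, Tm => a i t
  | Tm, Sp i => a i t
  | _, _ => 0
  end.

Definition tetrad : Type := path -> R -> Greek -> Greek -> R.

(* Lam a t mu nu  is  Lambda^mu_nu(t)  for the functions a. *)
Definition is_Lambda (Lam : tetrad) : Prop :=
  forall a : path, C0path a ->
    (forall mu nu, Lam a 0 mu nu = deltaG mu nu) /\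
    (forall t mu nu,
       is_derive (fun s => Lam a s mu nu) t
         (sumG (fun be => Lam a t mu be * Wmat a t be nu))).

Definition Lam_dn_up (Lam : tetrad) (a : path) (t : R) : Greek -> Greek -> R :=
  raise_snd (lower_fst (Lam a t)).
Definition Lam_up_up (Lam : tetrad) (a : path) (t : R) : Greek -> Greek -> R :=
  raise_snd (Lam a t).

Definition Gmat (Lam : tetrad) (a : path) (tau0 t : R) (mu rho : Greek) : R :=
  sumG (fun nu => Lam_dn_up Lam a tau0 nu mu * Lam a t nu rho).
Definition G_dn_up (Lam : tetrad) (a : path) (tau0 t : R)
  : Greek -> Greek -> R :=
  raise_snd (lower_fst (Gmat Lam a tau0 t)).

Definition Pgen (Lam : tetrad) (mu : Greek) : operator :=
  fun F p => sumG (fun nu => Lam_dn_up Lam (acc p) (tau p) mu nu * hatd nu F p).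

Definition kvec (Lam : tetrad) (be : Greek) : field :=
  fun p => sumL (fun j => Lam (acc p) (tau p) be (Sp j) * xi p j)
         + RInt (fun t' => Lam (acc p) t' be Tm) 0 (tau p).
Definition kvec_dn (Lam : tetrad) (be : Greek) : field :=
  fun p => sumG (fun al => eta be al * kvec Lam al p).

Definition Jgen (Lam : tetrad) (al be : Greek) : operator :=
  fun F p => kvec_dn Lam be p * Pgen Lam al F p
           - kvec_dn Lam al p * Pgen Lam be F p.

(* The value of theta at 0 is irrelevant: chi only occurs under integrals. *)
Definition theta (x : R) : R := if Rle_dec 0 x then 1 else 0.
Definition chi (t tau0 : R) : R :=
  theta t * theta (tau0 - t) - theta (- t) * theta (t - tau0).

Definition Delta (Lam : tetrad) (a : path) (nu : Greek) (tau0 t : R)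
    (x : Lat -> R) : R :=
  sumL (fun j => x j * G_dn_up Lam a tau0 t (Sp j) nu)
  + RInt (fun t' => G_dn_up Lam a t' t Tm nu) t tau0.

Definition Dcoef (Lam : tetrad) (i : Lat) (t : R) (mu : Greek) : field :=
  fun p => chi t (tau p) *
    (Lam_up_up Lam (acc p) t mu Tm * Delta Lam (acc p) (Sp i) (tau p) t (xi p)
     - Lam_up_up Lam (acc p) t mu (Sp i) * Delta Lam (acc p) Tm (tau p) t (xi p)).

(* int_R dt phi(t) D_{i(t)} *)
Definition Dgen (Lam : tetrad) (i : Lat) (phi : R -> R) : operator :=
  fun F p => fundd i phi F p
    + sumG (fun mu =>
        RInt_gen (fun t => phi t * Dcoef Lam i t mu p)
                 (Rbar_locally m_infty) (Rbar_locally p_infty)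
        * Pgen Lam mu F p).

Definition comm (X Y : operator) : operator :=
  fun F p => X (Y F) p - Y (X F) p.

(* Class C^2 is what a commutator of first-order operators needs. *)
Definition op_eq (X Y : operator) : Prop :=
  forall F, Ck 2 F -> forall p, inM p -> X F p = Y F p.

Definition op_zero : operator := fun _ _ => 0.

Section FctModule.
Variables (T : Type) (V : ModuleSpace R_Ring).

Definition fctV_plus (f g : T -> V) : T -> V := fun x => plus (f x) (g x).
Definition fctV_zero : T -> V := fun _ => zero.
Definition fctV_opp (f : T -> V) : T -> V := fun x => opp (f x).
Definition fctV_scal (r : R_Ring) (f : T -> V) : T -> V := fun x => scal r (f x).

Definition fctV_AM_mixin : AbelianMonoid.mixin_of (T -> V).
Proof.
apply (@AbelianMonoid.Mixin _ fctV_plus fctV_zero);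
  intros; apply functional_extensionality; intro;
  unfold fctV_plus, fctV_zero.
- apply plus_comm.
- apply plus_assoc.
- apply plus_zero_r.
Defined.
Definition fctV_AM : AbelianMonoid :=
  AbelianMonoid.Pack (T -> V) fctV_AM_mixin (T -> V).

Definition fctV_AG_mixin : AbelianGroup.mixin_of fctV_AM.
Proof.
apply (@AbelianGroup.Mixin fctV_AM fctV_opp).
intro f; apply functional_extensionality; intro x; exact (plus_opp_r (f x)).
Defined.
Definition fctV_AG : AbelianGroup :=
  AbelianGroup.Pack (T -> V) (AbelianGroup.Class _ fctV_AM_mixin fctV_AG_mixin) (T -> V).

Definition fctV_Mod_mixin : ModuleSpace.mixin_of R_Ring fctV_AG.
Proof.
apply (@ModuleSpace.Mixin R_Ring fctV_AG fctV_scal);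
  intros; apply functional_extensionality; intro t.
- exact (scal_assoc x y (u t)).
- exact (scal_one (u t)).
- exact (scal_distr_l x (u t) (v t)).
- exact (scal_distr_r x y (u t)).
Defined.
Definition fctV : ModuleSpace R_Ring :=
  ModuleSpace.Pack R_Ring (T -> V)
    (ModuleSpace.Class R_Ring _ (AbelianGroup.class fctV_AG) fctV_Mod_mixin) (T -> V).
End FctModule.

Section SubModule.
Variables (V : ModuleSpace R_Ring) (S : V -> Prop).
Hypotheses (S0 : S zero) (SD : forall u v, S u -> S v -> S (plus u v))
  (SZ : forall r u, S u -> S (scal r u)).

Lemma subV_N u : S u -> S (opp u).
Proof. intro Hu. rewrite <- scal_opp_one. now apply SZ. Qed.

Lemma subV_eq (u v : {w | S w}) : proj1_sig u = proj1_sig v -> u = v.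
Proof.
destruct u as [u Hu], v as [v Hv]; simpl; intro e; subst v.
now rewrite (proof_irrelevance _ Hu Hv).
Qed.

Definition subV_plus (u v : {w | S w}) : {w | S w} :=
  exist _ _ (SD (proj2_sig u) (proj2_sig v)).
Definition subV_zero : {w | S w} := exist _ _ S0.
Definition subV_opp (u : {w | S w}) : {w | S w} :=
  exist _ _ (subV_N (proj2_sig u)).
Definition subV_scal (r : R_Ring) (u : {w | S w}) : {w | S w} :=
  exist _ _ (SZ r (proj2_sig u)).

Definition subV_AM_mixin : AbelianMonoid.mixin_of {w | S w}.
Proof.
apply (@AbelianMonoid.Mixin _ subV_plus subV_zero);
  intros; apply subV_eq; simpl.
- apply plus_comm.
- apply plus_assoc.
- apply plus_zero_r.
Defined.
Definition subV_AM : AbelianMonoid :=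
  AbelianMonoid.Pack {w | S w} subV_AM_mixin {w | S w}.

Definition subV_AG_mixin : AbelianGroup.mixin_of subV_AM.
Proof.
apply (@AbelianGroup.Mixin subV_AM subV_opp).
intro u; apply subV_eq; exact (plus_opp_r (proj1_sig u)).
Defined.
Definition subV_AG : AbelianGroup :=
  AbelianGroup.Pack {w | S w} (AbelianGroup.Class _ subV_AM_mixin subV_AG_mixin) {w | S w}.

Definition subV_Mod_mixin : ModuleSpace.mixin_of R_Ring subV_AG.
Proof.
apply (@ModuleSpace.Mixin R_Ring subV_AG subV_scal);
  intros; apply subV_eq.
- exact (scal_assoc x y (proj1_sig u)).
- exact (scal_one (proj1_sig u)).
- exact (scal_distr_l x (proj1_sig u) (proj1_sig v)).
- exact (scal_distr_r x y (proj1_sig u)).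
Defined.
Definition subV : ModuleSpace R_Ring :=
  ModuleSpace.Pack R_Ring {w | S w}
    (ModuleSpace.Class R_Ring _ (AbelianGroup.class subV_AG) subV_Mod_mixin) {w | S w}.
End SubModule.

Definition real_line : ModuleSpace R_Ring := Ring_ModuleSpace R_Ring.

Definition vec4 : ModuleSpace R_Ring := fctV Greek real_line.
Definition tens4 : ModuleSpace R_Ring := fctV Greek (fctV Greek real_line).

Definition antisym (Om : Greek -> Greek -> R) : Prop :=
  forall al be, Om al be = - Om be al.

Lemma antisym0 : antisym (zero : tens4).
Proof. intros al be; change (0 = - 0); ring. Qed.
Lemma antisymD (u v : tens4) : antisym u -> antisym v -> antisym (plus u v).
Proof.
intros Hu Hv al be; change (u al be + v al be = - (u be al + v be al)).
rewrite (Hu al), (Hv al); ring.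
Qed.
Lemma antisymZ (r : R_Ring) (u : tens4) : antisym u -> antisym (scal r u).
Proof.
intros Hu al be; change (r * u al be = - (r * u be al)).
rewrite (Hu al); ring.
Qed.

Definition antitens4 : ModuleSpace R_Ring := subV antisym0 antisymD antisymZ.

Definition paths : ModuleSpace R_Ring := fctV Lat (fctV R real_line).

Lemma C0path0 : C0path (zero : paths).
Proof. intros i t; apply (continuous_const (0 : R)). Qed.
Lemma C0pathD (u v : paths) : C0path u -> C0path v -> C0path (plus u v).
Proof.
intros Hu Hv i t.
exact (continuous_plus (u i : R -> R) (v i : R -> R) t (Hu i t) (Hv i t)).
Qed.
Lemma C0pathZ (r : R_Ring) (u : paths) : C0path u -> C0path (scal r u).
Proof.
intros Hu i t.
exact (continuous_scal_r (K := R_AbsRing) (V := R_NormedModule)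
         r (u i : R -> R) t (Hu i t)).
Qed.

Definition C0paths : ModuleSpace R_Ring := subV C0path0 C0pathD C0pathZ.

Definition is_lie_bracket (V : ModuleSpace R_Ring) (br : V -> V -> V) : Prop :=
  (forall u v w, br (plus u v) w = plus (br u w) (br v w)) /\
  (forall r u w, br (scal r u) w = scal r (br u w)) /\
  (forall u v w, br u (plus v w) = plus (br u v) (br u w)) /\
  (forall r u w, br u (scal r w) = scal r (br u w)) /\
  (forall u, br u u = zero) /\
  (forall u v w,
     plus (plus (br u (br v w)) (br v (br w u))) (br w (br u v)) = zero).

Record LieAlgebra : Type := mkLie {
  lie_space :> ModuleSpace R_Ring;
  lie_br : lie_space -> lie_space -> lie_space;
  lie_brP : is_lie_bracket lie_br }.

(* 0 -> ker pi -> g -> p -> 0 is exact, with an abelian kernel. *)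
Definition is_abelian_extension (g p : LieAlgebra) (pi : g -> p) : Prop :=
  (forall u v, pi (plus u v) = plus (pi u) (pi v)) /\
  (forall r u, pi (scal r u) = scal r (pi u)) /\
  (forall u v, pi (lie_br u v) = lie_br (pi u) (pi v)) /\
  (forall w, exists u, pi u = w) /\
  (forall u v, pi u = zero -> pi v = zero -> lie_br u v = zero).

(* The Poincare algebra: pairs (f^mu, Om^{al be}), Om antisymmetric, with the
   commutator of the 5 x 5 matrices ((Om eta, f), (0, 0)). *)
Definition poincare_space : ModuleSpace R_Ring :=
  prod_ModuleSpace R_Ring vec4 antitens4.

Definition par_f (v : poincare_space) : Greek -> R := fst v.
Definition par_Om (v : poincare_space) : Greek -> Greek -> R := proj1_sig (snd v).

Definition tens_act (Om : Greek -> Greek -> R) (f : Greek -> R) (mu : Greek) : R :=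
  sumG (fun al => sumG (fun be => Om mu al * eta al be * f be)).
Definition tens_mul (Om1 Om2 : Greek -> Greek -> R) (mu nu : Greek) : R :=
  tens_act Om1 (fun be => Om2 be nu) mu.

Definition poincare_br_f (u v : poincare_space) (mu : Greek) : R :=
  tens_act (par_Om u) (par_f v) mu - tens_act (par_Om v) (par_f u) mu.
Definition poincare_br_Om (u v : poincare_space) (mu nu : Greek) : R :=
  tens_mul (par_Om u) (par_Om v) mu nu - tens_mul (par_Om v) (par_Om u) mu nu.

Lemma tens_mul_tr (Om1 Om2 : Greek -> Greek -> R) mu nu :
  antisym Om1 -> antisym Om2 ->
  tens_mul Om1 Om2 mu nu = tens_mul Om2 Om1 nu mu.
Proof.
intros H1 H2; unfold tens_mul, tens_act, sumG, sumL; simpl.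
rewrite !(H1 mu), !(fun b => H2 b nu); ring.
Qed.

Lemma poincare_br_antisym (u v : poincare_space) : antisym (poincare_br_Om u v).
Proof.
intros mu nu; unfold poincare_br_Om.
pose proof (proj2_sig (snd u)) as Hu; pose proof (proj2_sig (snd v)) as Hv.
rewrite (@tens_mul_tr (par_Om u) (par_Om v) mu nu Hu Hv).
rewrite (@tens_mul_tr (par_Om v) (par_Om u) mu nu Hv Hu); ring.
Qed.

Definition poincare_br (u v : poincare_space) : poincare_space :=
  (poincare_br_f u v,
   exist antisym (poincare_br_Om u v) (poincare_br_antisym u v)).

Lemma poincare_eq (u v : poincare_space) :
  (forall mu, par_f u mu = par_f v mu) ->
  (forall mu nu, par_Om u mu nu = par_Om v mu nu) -> u = v.
Proof.
destruct u as [f [Om H]], v as [f' [Om' H']];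
  unfold par_f, par_Om; simpl; intros e1 e2.
f_equal.
- now apply functional_extensionality.
- apply (@subV_eq tens4 antisym); simpl.
  apply functional_extensionality; intro; now apply functional_extensionality.
Qed.

Lemma par_f_plus (u v : poincare_space) mu :
  par_f (plus u v) mu = par_f u mu + par_f v mu.
Proof. reflexivity. Qed.
Lemma par_f_scal (r : R_Ring) (v : poincare_space) mu :
  par_f (scal r v) mu = r * par_f v mu.
Proof. reflexivity. Qed.
Lemma par_f_zero mu : par_f zero mu = 0.
Proof. reflexivity. Qed.
Lemma par_f_br (u v : poincare_space) mu :
  par_f (poincare_br u v) mu = poincare_br_f u v mu.
Proof. reflexivity. Qed.
Lemma par_Om_plus (u v : poincare_space) mu nu :
  par_Om (plus u v) mu nu = par_Om u mu nu + par_Om v mu nu.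
Proof. reflexivity. Qed.
Lemma par_Om_scal (r : R_Ring) (v : poincare_space) mu nu :
  par_Om (scal r v) mu nu = r * par_Om v mu nu.
Proof. reflexivity. Qed.
Lemma par_Om_zero mu nu : par_Om zero mu nu = 0.
Proof. reflexivity. Qed.
Lemma par_Om_br (u v : poincare_space) mu nu :
  par_Om (poincare_br u v) mu nu = poincare_br_Om u v mu nu.
Proof. reflexivity. Qed.

Lemma tens_actE Om f mu :
  tens_act Om f mu =
  sumL (fun i => Om mu (Sp i) * f (Sp i)) - Om mu Tm * f Tm.
Proof. unfold tens_act, sumG, sumL; simpl; ring. Qed.

Lemma poincare_is_lie : is_lie_bracket poincare_br.
Proof.
repeat split; intros; apply poincare_eq; intros;
  repeat (repeat rewrite ?par_f_plus, ?par_f_scal, ?par_f_zero, ?par_f_br,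
            ?par_Om_plus, ?par_Om_scal, ?par_Om_zero, ?par_Om_br;
          unfold poincare_br_f, poincare_br_Om, tens_mul; rewrite ?tens_actE;
          unfold sumL);
  ring.
Qed.

Definition poincare : LieAlgebra := mkLie poincare_is_lie.

(* Triples ((f0^mu, Om0^{al be}), A_i) with Om0 antisymmetric, A_i continuous. *)
Definition param : ModuleSpace R_Ring :=
  prod_ModuleSpace R_Ring poincare_space C0paths.

Definition par_A (th : param) : path := proj1_sig (snd th).

Definition Xgen (Lam : tetrad) (th : param) : operator :=
  fun F p =>
    sumG (fun mu => par_f (fst th) mu * Pgen Lam mu F p)
    + / 2 * sumG (fun al => sumG (fun be =>
              par_Om (fst th) al be * Jgen Lam al be F p))
    + sumL (fun i => Dgen Lam i (par_A th i) F p).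

Definition coord_xi (i : Lat) : field := fun p => xi p i.
Definition coord_tau : field := fun p => tau p.
Definition coord_acc (j : Lat) (t : R) : field := fun p => acc p j t.

Definition interval (a : path) (x : Lat -> R) (t : R) (dx : Lat -> R) (dt : R) : R :=
  sumL (fun i => dx i ^ 2) - (1 + sumL (fun i => x i * a i t)) ^ 2 * dt ^ 2.

Definition event : Type := ((Lat -> R) * R)%type.
Definition at_acc (a : path) (q : event) : point := mkPoint (fst q) (snd q) a.
Definition lift (F : event -> R) : field := fun p => F (xi p, tau p).

Definition partial (a : path) (mu : Greek) (F : event -> R) (q : event) : R :=
  dd (dir (Fcoord mu)) (lift F) (at_acc a q).
Definition differential (a : path) (F : event -> R) (q : event)
    (dx : Lat -> R) (dt : R) : R :=
  sumL (fun i => partial a (Sp i) F q * dx i) + partial a Tm F q * dt.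

Definition C1_slice (a : path) (F : event -> R) : Prop :=
  forall q : event, inM (at_acc a q) -> forall mu : Greek,
    ex_dd (dir (Fcoord mu)) (lift F) (at_acc a q) /\
    continuous (partial a mu F) q.

(* Half of the first-order change of ds^2, at q and along (dx, dt), under
     xi^i -> xi^i + eps Z^i,  tau -> tau + eps T,  a_i -> a_i + eps A_i.
   With ds^2 = dxi^2 - (N dtau)^2, N = 1 + xi . a, it is dxi . dZ - N dtau om,
   om being the variation of the one-form N dtau.  Cartan's formula, with
   d(N dtau) = (a . dxi) /\ dtau, gives
     om = d(N T) + (Z . a) dtau - T (a . dxi) + (xi . A) dtau.
   The naive expansion of N dtau would contain T dN/dtau + N dT/dtau, where the
   derivative of a cancels; a being only continuous, it is N T and not T that is
   differentiable.  interval_first_order recovers the literal first-order change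
   of the interval when a is differentiable. *)
Definition interval_variation (a : path) (Z : Lat -> event -> R)
    (T : event -> R) (A : path) (q : event) (dx : Lat -> R) (dt : R) : R :=
  let N q := lapse (at_acc a q) in
  let om :=
    differential a (fun q' => N q' * T q') q dx dt
    + (sumL (fun i => Z i q * a i (snd q)) + sumL (fun i => fst q i * A i (snd q))) * dt
    - T q * sumL (fun i => a i (snd q) * dx i) in
  sumL (fun i => dx i * differential a (Z i) q dx dt) - N q * dt * om.

Definition FW_infinitesimal (a : path) (Z : Lat -> event -> R)
    (T : event -> R) (A : path) : Prop :=
  C0path A /\
  (forall i, C1_slice a (Z i)) /\
  C1_slice a (fun q => lapse (at_acc a q) * T q) /\
  (forall q, inM (at_acc a q) ->
     forall dx dt, interval_variation a Z T A q dx dt = 0).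

Lemma is_derive_id_mult (g : R -> R) :
  continuous g 0 -> is_derive (fun e => e * g e) 0 (g 0).
Proof.
intro Hg; apply is_derive_Reals; intros e He.
apply continuity_pt_filterlim in Hg.
destruct (Hg e He) as [d [Hd Hlim]].
exists (mkposreal d Hd); intros h Hh0 Hh; simpl in Hh.
replace (((0 + h) * g (0 + h) - 0 * g 0) / h - g 0) with (g h - g 0)
  by (rewrite Rplus_0_l; field; exact Hh0).
apply Hlim; split.
- split; [exact I | now apply not_eq_sym].
- simpl; unfold Rdist; now rewrite Rminus_0_r.
Qed.

Lemma interval_first_order (a : path) (Z : Lat -> event -> R)
    (T : event -> R) (A : path) (q : event) (dx : Lat -> R) (dt : R) :
  C0path A ->
  (forall i, ex_derive (a i) (snd q)) ->
  (forall mu, ex_dd (dir (Fcoord mu)) (lift T) (at_acc a q)) ->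
  is_derive (fun eps =>
      interval (fun i t => a i t + eps * A i t)
        (fun i => fst q i + eps * Z i q) (snd q + eps * T q)
        (fun i => dx i + eps * differential a (Z i) q dx dt)
        (dt + eps * differential a T q dx dt)) 0
    (2 * interval_variation a Z T A q dx dt).
Proof.
intros HA Ha HT.
set (t := snd q) in *; set (x := fst q).
assert (HN : forall mu, partial a mu (fun q' => lapse (at_acc a q') * T q') q =
    match mu with
    | Sp i => a i t
    | Tm => sumL (fun i => x i * Derive (a i) t)
    end * T q + lapse (at_acc a q) * partial a mu T q).
{ intro mu; apply is_derive_unique.
  pose proof (Derive_correct _ _ (HT mu)) as HTm.
  set (v := dir (Fcoord mu)) in *.
  set (L s := lapse (at_acc a (xi (move (at_acc a q) v s),
                               tau (move (at_acc a q) v s)))).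
  set (l' := match mu with
    | Sp i => a i t
    | Tm => sumL (fun i => x i * Derive (a i) t)
    end).
  assert (HL : is_derive L 0 l').
  { destruct mu as [i|].
    - apply (is_derive_ext (fun s => 1 + sumL (fun k => (x k + s * deltaL i k) * a k t))).
      + intro s; unfold L, lapse; simpl; fold t x.
        now rewrite Rmult_0_r, Rplus_0_r.
      + unfold l', sumL; auto_derive; [exact I|].
        destruct i; simpl; ring.
    - apply (is_derive_ext (fun s => 1 + sumL (fun k => x k * a k (t + s)))).
      + intro s; unfold L, lapse, sumL; simpl; fold t x.
        now rewrite !Rmult_1_r, !Rmult_0_r, !Rplus_0_r.
      + unfold l', sumL; auto_derive; rewrite ?Rplus_0_r.
        * repeat split; apply Ha.
        * change (x x1 * (1 * Derive (a x1) t) + x x2 * (1 * Derive (a x2) t)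
            + x x3 * (1 * Derive (a x3) t) =
            x x1 * Derive (a x1) t + x x2 * Derive (a x2) t + x x3 * Derive (a x3) t).
          ring. }
  assert (E0 : xi (move (at_acc a q) v 0) = x /\ tau (move (at_acc a q) v 0) = t).
  { split; simpl.
    - apply functional_extensionality; intro k; unfold x; ring.
    - unfold t; ring. }
  destruct E0 as [E1 E2].
  evar_last.
  - apply (is_derive_mult L (fun s => lift T (move (at_acc a q) v s)) 0 l').
    + exact HL.
    + exact HTm.
    + exact Rmult_comm.
  - unfold L, lift, plus, mult; simpl fst; simpl snd.
    rewrite E1, E2; unfold x, t; rewrite <- (surjective_pairing q).
    reflexivity. }
set (b i e := a i (t + e * T q) + e * A i (t + e * T q)).
assert (Hb : forall i, is_derive (b i) 0 (Derive (a i) t * T q + A i t)).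
{ intro i; apply (is_derive_plus (V := R_NormedModule)).
  - assert (H0 : ex_derive (a i) (t + 0 * T q))
      by (rewrite Rmult_0_l, Rplus_0_r; apply Ha).
    auto_derive; [exact H0|]; rewrite Rmult_0_l, Rplus_0_r.
    change (1 * T q * Derive (a i) t = Derive (a i) t * T q); ring.
  - replace (A i t) with (A i (t + 0 * T q)) by (f_equal; ring).
    apply (is_derive_id_mult (g := fun e => A i (t + e * T q))).
    apply (continuous_comp (fun e => t + e * T q) (A i)).
    + apply (ex_derive_continuous (V := R_NormedModule)); auto_derive; exact I.
    + apply HA. }
assert (Hb0 : forall i, b i 0 = a i t).
{ intro i; unfold b; rewrite !Rmult_0_l, !Rplus_0_r; reflexivity. }
unfold interval_variation, differential.
apply (is_derive_ext (fun eps =>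
   sumL (fun i => (dx i + eps * differential a (Z i) q dx dt) ^ 2)
   - (1 + sumL (fun i => (x i + eps * Z i q) * b i eps)) ^ 2
     * (dt + eps * differential a T q dx dt) ^ 2)).
{ intro e; reflexivity. }
unfold differential, sumL; fold t x.
auto_derive.
- repeat split; eexists; apply Hb.
- assert (HD : forall k, Derive (fun e => b k e) 0 = Derive (a k) t * T q + A k t)
    by (intro k; apply is_derive_unique, Hb).
  rewrite !HD, !Hb0, (HN Tm), (HN (Sp x1)), (HN (Sp x2)), (HN (Sp x3)).
  change (lapse (at_acc a q)) with (1 + (x x1 * a x1 t + x x2 * a x2 t + x x3 * a x3 t)).
  unfold sumL; ring.
Qed.

(* Main.v *)
(** Let [k^mu] be the inertial coordinates of the event with Fermi-Walker coordinates
    (xi, tau).  Its derivatives along the normalized frame are the columns of the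
    Lorentz matrix Lambda, so that [P_mu] is the derivative with respect to [k^mu].
    Put S_h = Lambda W_h Lambda^-1 with W_h the matrix W of the path h, and let Y, U, z
    be the primitives of S_h, S_h z and of the column Lambda_4.  Variation of constants
    gives delta_h Lambda = Y Lambda and delta_h k = Y k - U, and Y k - U is exactly minus
    the coefficient of P in the generator D smeared with h.  Hence D is the derivative
    with respect to a at fixed k, and all the brackets follow from P k = delta, D k = 0
    and the commutation of second derivatives.  For the characterization of the
    transformations, the Killing equation at fixed tau makes Z and N T affine in xi, and
    its tau-part says that the coefficients, transported by Lambda, are constant up to
    the contribution of A. *)

(* Two regularity obstacles shape the argument. The lapse has no tau-derivative when [a] is only
   continuous, so second derivatives are exchanged only for pairs of frame directions of which one
   is not the time direction; the lapse is then differentiated along that direction alone. Moreover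
   Z and N T are only C^1 on a slice, so one cannot differentiate the Killing equation again to see
   that its solutions are affine. Convexity of the domain at fixed time replaces this: a
   polarization argument handles Z, and a linear differential equation along rays handles N T. The
   variation of Lambda needs a remainder uniform in time, to survive integration; it comes from a
   Gronwall bound on Lambda uniform in the perturbation. The bracket of two D's rests on the
   symmetry of the second variation of k, that is on the zero-curvature identity delta_h Y_g -
   delta_g Y_h = [Y_h, Y_g] and its analogue for U. *)
Require Import Defs.
From Stdlib Require Import Reals Lra FunctionalExtensionality.
From Coquelicot Require Import Coquelicot.
Local Open Scope R_scope.

Ltac expand_sums := unfold sumG, sumL; simpl.

(** * Sums, derivatives and integrals of real functions *)

Lemma sumL_ext (F G : Lat -> R) : (forall i, F i = G i) -> sumL F = sumL G.
Proof. intro H; unfold sumL; now rewrite !H. Qed.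

Lemma sumG_ext (F G : Greek -> R) : (forall mu, F mu = G mu) -> sumG F = sumG G.
Proof. intro H; unfold sumG, sumL; now rewrite !H. Qed.

Lemma sumG_plus (F G : Greek -> R) :
  sumG (fun mu => F mu + G mu) = sumG F + sumG G.
Proof. unfold sumG, sumL; ring. Qed.

Lemma sumG_mult_l c (F : Greek -> R) : sumG (fun mu => c * F mu) = c * sumG F.
Proof. unfold sumG, sumL; ring. Qed.

Lemma sumG_mult_r c (F : Greek -> R) : sumG (fun mu => F mu * c) = sumG F * c.
Proof. unfold sumG, sumL; ring. Qed.

Lemma sumG_exchange (F : Greek -> Greek -> R) :
  sumG (fun mu => sumG (fun nu => F mu nu)) =
  sumG (fun nu => sumG (fun mu => F mu nu)).
Proof. unfold sumG, sumL; ring. Qed.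

Lemma sumG_delta_l mu (F : Greek -> R) : sumG (fun nu => deltaG mu nu * F nu) = F mu.
Proof. destruct mu as [[]|]; unfold sumG, sumL; simpl; ring. Qed.

Lemma sumG_delta_r mu (F : Greek -> R) : sumG (fun nu => F nu * deltaG nu mu) = F mu.
Proof. destruct mu as [[]|]; unfold sumG, sumL; simpl; ring. Qed.

Lemma is_derive_plus_R (f g : R -> R) (x l m : R) :
  is_derive f x l -> is_derive g x m -> is_derive (fun t => f t + g t) x (l + m).
Proof. intros Hf Hg; exact (is_derive_plus (V := R_NormedModule) f g x l m Hf Hg). Qed.

Lemma is_derive_minus_R (f g : R -> R) (x l m : R) :
  is_derive f x l -> is_derive g x m -> is_derive (fun t => f t - g t) x (l - m).
Proof. intros Hf Hg; exact (is_derive_minus (V := R_NormedModule) f g x l m Hf Hg). Qed.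

Lemma is_derive_mult_R (f g : R -> R) (x l m : R) :
  is_derive f x l -> is_derive g x m ->
  is_derive (fun t => f t * g t) x (l * g x + f x * m).
Proof.
intros Hf Hg; exact (is_derive_mult (K := R_AbsRing) f g x l m Hf Hg Rmult_comm).
Qed.

Lemma is_derive_const_R (c : R) x : is_derive (fun _ => c) x 0.
Proof. exact (is_derive_const (V := R_NormedModule) c x). Qed.

Lemma is_derive_scal_R (f : R -> R) (c x l : R) :
  is_derive f x l -> is_derive (fun t => c * f t) x (c * l).
Proof.
intro Hf; evar_last; [apply is_derive_mult_R; [apply is_derive_const_R|exact Hf]|].
simpl; ring.
Qed.

Lemma is_derive_eq (f : R -> R) (x l m : R) : is_derive f x l -> l = m -> is_derive f x m.
Proof. now intros H <-. Qed.

Lemma is_derive_ext_R (f g : R -> R) (x l : R) :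
  (forall t, f t = g t) -> is_derive f x l -> is_derive g x l.
Proof. exact (is_derive_ext f g x l). Qed.

Lemma is_derive_ext_loc_R (f g : R -> R) (x l : R) :
  locally x (fun t => f t = g t) -> is_derive f x l -> is_derive g x l.
Proof. exact (is_derive_ext_loc f g x l). Qed.
Lemma is_derive_sumL (F : Lat -> R -> R) x (l : Lat -> R) :
  (forall i, is_derive (F i) x (l i)) ->
  is_derive (fun t => sumL (fun i => F i t)) x (sumL l).
Proof. intro H; unfold sumL; repeat apply is_derive_plus_R; apply H. Qed.

Lemma is_derive_sumG (F : Greek -> R -> R) x (l : Greek -> R) :
  (forall mu, is_derive (F mu) x (l mu)) ->
  is_derive (fun t => sumG (fun mu => F mu t)) x (sumG l).
Proof.
intro H; unfold sumG; apply is_derive_plus_R; [|apply H].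
apply (is_derive_sumL (fun i => F (Sp i))); intro; apply H.
Qed.

Lemma is_derive_cont (f : R -> R) x l : is_derive f x l -> continuous f x.
Proof. intro H; apply (ex_derive_continuous (V := R_NormedModule)); now exists l. Qed.

Lemma continuous_plus_R {U : UniformSpace} (f g : U -> R) x :
  continuous f x -> continuous g x -> continuous (fun t => f t + g t) x.
Proof. intros; now apply (continuous_plus (V := R_NormedModule)). Qed.

Lemma continuous_minus_R {U : UniformSpace} (f g : U -> R) x :
  continuous f x -> continuous g x -> continuous (fun t => f t - g t) x.
Proof. intros; now apply (continuous_minus (V := R_NormedModule)). Qed.

Lemma continuous_mult_R {U : UniformSpace} (f g : U -> R) x :
  continuous f x -> continuous g x -> continuous (fun t => f t * g t) x.
Proof. intros; now apply (continuous_mult (K := R_AbsRing)). Qed.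

Lemma continuous_const_R {U : UniformSpace} (c : R) (x : U) : continuous (fun _ => c) x.
Proof. apply continuous_const. Qed.

Lemma continuous_sumL {U : UniformSpace} (F : Lat -> U -> R) x :
  (forall i, continuous (F i) x) -> continuous (fun t => sumL (fun i => F i t)) x.
Proof. intro H; unfold sumL; repeat apply continuous_plus_R; apply H. Qed.

Lemma continuous_sumG {U : UniformSpace} (F : Greek -> U -> R) x :
  (forall mu, continuous (F mu) x) -> continuous (fun t => sumG (fun mu => F mu t)) x.
Proof.
intro H; unfold sumG; apply continuous_plus_R; [|apply H].
apply (continuous_sumL (fun i => F (Sp i))); intro; apply H.
Qed.

Lemma ex_RInt_cont (f : R -> R) a b : (forall t, continuous f t) -> ex_RInt f a b.
Proof. intro H; apply (ex_RInt_continuous (V := R_CompleteNormedModule)); intros; apply H. Qed.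

Lemma is_derive_primitive (f : R -> R) a t :
  (forall t, continuous f t) -> is_derive (fun x => RInt f a x) t (f t).
Proof.
intro H; apply (is_derive_RInt (V := R_NormedModule) f (fun x => RInt f a x) a t); [|apply H].
apply filter_forall; intro x.
now apply (RInt_correct (V := R_CompleteNormedModule)), ex_RInt_cont.
Qed.

Lemma RInt_point_R (f : R -> R) a : RInt f a a = 0.
Proof. exact (RInt_point (V := R_CompleteNormedModule) a f). Qed.

Lemma RInt_minus_R (f g : R -> R) a b :
  (forall t, continuous f t) -> (forall t, continuous g t) ->
  RInt (fun t => f t - g t) a b = RInt f a b - RInt g a b.
Proof.
intros; apply (RInt_minus (V := R_CompleteNormedModule)); now apply ex_RInt_cont.
Qed.

Lemma RInt_scal_R (f : R -> R) c a b :
  (forall t, continuous f t) -> RInt (fun t => c * f t) a b = c * RInt f a b.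
Proof.
intros; apply (RInt_scal (V := R_CompleteNormedModule)); now apply ex_RInt_cont.
Qed.

Lemma RInt_zero_R a b : RInt (fun _ => 0) a b = 0.
Proof.
rewrite (RInt_const (V := R_CompleteNormedModule)); exact (Rmult_0_r (b - a)).
Qed.

Lemma RInt_ext_R (f g : R -> R) (a b : R) :
  (forall t, f t = g t) -> RInt f a b = RInt g a b.
Proof. intro H; apply (RInt_ext f g a b); intros; apply H. Qed.

(** The standard tool below for identities between primitives: compare the values at 0 and
    differentiate, instead of manipulating integrals. *)
Lemma eq_of_is_derive (f g d : R -> R) :
  f 0 = g 0 -> (forall t, is_derive f t (d t)) -> (forall t, is_derive g t (d t)) ->
  forall t, f t = g t.
Proof.
intros H0 Hf Hg t.
assert (Hd : forall s, is_derive (fun x => f x - g x) s 0).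
{ intro s; apply (is_derive_eq _ _ (d s - d s)); [|ring].
  now apply is_derive_minus_R. }
assert (E : f t - g t = f 0 - g 0); [|lra].
destruct (Rtotal_order t 0) as [Ht|[->|Ht]]; [|reflexivity|].
- apply (eq_is_derive (V := R_NormedModule) (fun x => f x - g x)); auto.
- symmetry; apply (eq_is_derive (V := R_NormedModule) (fun x => f x - g x)); auto.
Qed.

Lemma continuous_bounded (f : R -> R) T :
  (forall t, continuous f t) -> exists M, 0 <= M /\ forall t, Rabs t <= T -> Rabs (f t) <= M.
Proof.
intro Hf; destruct (Rle_dec 0 T) as [HT|HT].
- destruct (continuity_ab_maj (fun t => Rabs (f t)) (- T) T) as [m [Hm _]]; [lra| |].
  + intros c _; apply continuity_pt_filterlim.
    apply (continuous_comp f Rabs); [apply Hf|].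
    apply continuity_pt_filterlim, Rcontinuity_abs.
  + exists (Rabs (f m)); split; [apply Rabs_pos|].
    intros t Ht; apply Hm; now apply Rabs_le_between.
- exists 0; split; [lra|]; intros t Ht; pose proof (Rabs_pos t); lra.
Qed.

(** * Gronwall's inequality for functions and for matrices *)

Lemma decreasing_of_is_derive (f df : R -> R) t :
  0 <= t -> (forall x, is_derive f x (df x)) -> (forall x, 0 <= x <= t -> df x <= 0) ->
  f t <= f 0.
Proof.
intros Ht Hf Hd.
destruct (MVT_gen f 0 t df) as [c [Hc E]].
- intros; apply Hf.
- intros; apply continuity_pt_filterlim, (is_derive_cont f x (df x)), Hf.
- rewrite Rmin_left, Rmax_right in Hc by lra.
  specialize (Hd c Hc); nra.
Qed.

(** The function u(x) exp(- M x) has nonpositive derivative on [0, t]. *)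
Lemma gronwall_pos (u du : R -> R) M t : 0 <= t ->
  (forall x, is_derive u x (du x)) -> (forall x, 0 <= x <= t -> du x <= M * u x) ->
  u t <= u 0 * exp (M * t).
Proof.
intros Ht Hu Hd.
assert (H : u t * exp (- M * t) <= u 0 * exp (- M * 0)).
{ apply (decreasing_of_is_derive (fun x => u x * exp (- M * x))
           (fun x => (du x - M * u x) * exp (- M * x))); [exact Ht| |].
  - intro x; eapply is_derive_eq.
    + apply is_derive_mult_R; [apply Hu|].
      auto_derive; [exact I|reflexivity].
    + simpl; ring.
  - intros x Hx; specialize (Hd x Hx); pose proof (exp_pos (- M * x)); nra. }
rewrite Rmult_0_r, exp_0, Rmult_1_r in H.
replace (u t) with (u t * exp (- M * t) * exp (M * t)).
- apply Rmult_le_compat_r; [left; apply exp_pos|exact H].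
- rewrite Rmult_assoc, <- exp_plus.
  replace (- M * t + M * t) with 0 by ring; rewrite exp_0; ring.
Qed.

(** Bounding [Rabs (du x)] makes the hypothesis invariant under time reversal, which reduces
    negative times to [gronwall_pos]. *)
Lemma gronwall (u du : R -> R) M T t :
  (forall x, is_derive u x (du x)) ->
  (forall x, Rabs x <= T -> Rabs (du x) <= M * u x) ->
  Rabs t <= T -> u t <= u 0 * exp (M * Rabs t).
Proof.
intros Hu Hd Ht; destruct (Rle_dec 0 t) as [H0|H0].
- rewrite Rabs_right in * by lra; apply (gronwall_pos u du); auto.
  intros x Hx; eapply Rle_trans; [apply Rle_abs|]; apply Hd.
  rewrite Rabs_right; lra.
- rewrite Rabs_left in * by lra.
  replace (u t) with (u (- - t)) by (f_equal; ring).
  replace (u 0) with (u (- 0)) by (f_equal; ring).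
  apply (gronwall_pos (fun x => u (- x)) (fun x => - du (- x))); [lra| |].
  + intro x; apply (is_derive_eq _ _ (-1 * du (- x))); [|ring].
    apply (is_derive_comp (V := R_NormedModule) u (fun x => - x)); [apply Hu|].
    auto_derive; [exact I|ring].
  + intros x Hx; eapply Rle_trans; [apply Rle_abs|].
    rewrite Rabs_Ropp; apply Hd; rewrite Rabs_Ropp, Rabs_right; lra.
Qed.

(** [norm2] is the squared Frobenius norm: it is differentiable, so Gronwall's inequality is applied
    to it. [norm1] is the norm in which linear expressions in the entries are easily bounded. *)
Definition norm1 (Q : Greek -> Greek -> R) : R :=
  sumG (fun mu => sumG (fun nu => Rabs (Q mu nu))).
Definition norm2 (Q : Greek -> Greek -> R) : R :=
  sumG (fun mu => sumG (fun nu => Q mu nu ^ 2)).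

Lemma sumG_le (F G : Greek -> R) : (forall mu, F mu <= G mu) -> sumG F <= sumG G.
Proof.
intro H; unfold sumG, sumL.
pose proof (H Tm); pose proof (H (Sp x1)); pose proof (H (Sp x2)); pose proof (H (Sp x3)); lra.
Qed.

Lemma sumG_ge_term (F : Greek -> R) mu : (forall mu, 0 <= F mu) -> F mu <= sumG F.
Proof.
intro H; unfold sumG, sumL.
pose proof (H Tm); pose proof (H (Sp x1)); pose proof (H (Sp x2)); pose proof (H (Sp x3)).
destruct mu as [[]|]; lra.
Qed.

Lemma Rabs_sumG (F : Greek -> R) : Rabs (sumG F) <= sumG (fun mu => Rabs (F mu)).
Proof.
unfold sumG, sumL; repeat (eapply Rle_trans; [apply Rabs_triang|apply Rplus_le_compat_r]).
lra.
Qed.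

Lemma sumG_ge0 (F : Greek -> R) : (forall mu, 0 <= F mu) -> 0 <= sumG F.
Proof. intro H; eapply Rle_trans; [apply (H Tm)|]; now apply (sumG_ge_term F). Qed.

(** Cauchy-Schwarz: the difference of the two sides is the sum of the squares of the six pairwise
    differences. *)
Lemma sumG_sqr (F : Greek -> R) : sumG F ^ 2 <= 4 * sumG (fun mu => F mu ^ 2).
Proof.
unfold sumG, sumL.
generalize (F (Sp x1)), (F (Sp x2)), (F (Sp x3)), (F Tm); intros a b c d.
pose proof (pow2_ge_0 (a - b)); pose proof (pow2_ge_0 (a - c)); pose proof (pow2_ge_0 (a - d)).
pose proof (pow2_ge_0 (b - c)); pose proof (pow2_ge_0 (b - d)); pose proof (pow2_ge_0 (c - d)).
nra.
Qed.

(** Cauchy-Schwarz twice, over the rows and inside each row; each time it costs a factor 4. *)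
Lemma norm1_sqr Q : norm1 Q ^ 2 <= 16 * norm2 Q.
Proof.
unfold norm1, norm2; eapply Rle_trans; [apply sumG_sqr|].
replace (16 * sumG (fun mu => sumG (fun nu => Q mu nu ^ 2))) with
  (4 * sumG (fun mu => 4 * sumG (fun nu => Q mu nu ^ 2)))
  by (unfold sumG, sumL; ring).
apply Rmult_le_compat_l; [lra|]; apply sumG_le; intro mu.
eapply Rle_trans; [apply sumG_sqr|].
apply Rmult_le_compat_l; [lra|]; apply Req_le, sumG_ext; intro nu.
apply pow2_abs.
Qed.

Lemma norm1_ge_term Q mu nu : Rabs (Q mu nu) <= norm1 Q.
Proof.
unfold norm1; eapply Rle_trans.
- apply (sumG_ge_term (fun nu => Rabs (Q mu nu))); intro; apply Rabs_pos.
- apply (sumG_ge_term (fun mu => sumG (fun nu => Rabs (Q mu nu)))); intro.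
  apply sumG_ge0; intro; apply Rabs_pos.
Qed.

Lemma norm2_ge_term Q mu nu : Q mu nu ^ 2 <= norm2 Q.
Proof.
unfold norm2; eapply Rle_trans.
- apply (sumG_ge_term (fun nu => Q mu nu ^ 2)); intro; apply pow2_ge_0.
- apply (sumG_ge_term (fun mu => sumG (fun nu => Q mu nu ^ 2))); intro.
  apply sumG_ge0; intro; apply pow2_ge_0.
Qed.

(** The derivative of [norm2] is at most 2 m [norm1]^2 in absolute value, hence at most 32 m [norm2]
    by [norm1_sqr]. *)
Lemma matrix_gronwall (Q dQ : R -> Greek -> Greek -> R) m T t :
  (forall x mu nu, is_derive (fun s => Q s mu nu) x (dQ x mu nu)) ->
  (forall x mu nu, Rabs x <= T -> Rabs (dQ x mu nu) <= m * norm1 (Q x)) ->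
  Rabs t <= T -> norm2 (Q t) <= norm2 (Q 0) * exp (32 * m * Rabs t).
Proof.
intros HQ Hd Ht.
apply (gronwall (fun x => norm2 (Q x))
   (fun x => sumG (fun mu => sumG (fun nu => 2 * (Q x mu nu * dQ x mu nu)))) _ T); auto.
- intro x; unfold norm2.
  apply (is_derive_sumG (fun mu x => sumG (fun nu => Q x mu nu ^ 2))); intro mu.
  apply (is_derive_sumG (fun nu x => Q x mu nu ^ 2)); intro nu.
  apply (is_derive_ext (fun s => Q s mu nu * Q s mu nu)); [intro; simpl; ring|].
  eapply is_derive_eq; [apply is_derive_mult_R; apply HQ|]; simpl; ring.
- intros x Hx.
  apply Rle_trans with (2 * (m * norm1 (Q x)) * norm1 (Q x)).
  + eapply Rle_trans; [apply Rabs_sumG|].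
    unfold norm1 at 2; rewrite <- sumG_mult_l; apply sumG_le; intro mu.
    eapply Rle_trans; [apply Rabs_sumG|].
    rewrite <- sumG_mult_l; apply sumG_le; intro nu.
    rewrite !Rabs_mult, (Rabs_right 2) by lra.
    pose proof (Hd x mu nu Hx); pose proof (Rabs_pos (Q x mu nu)); nra.
  + pose proof (norm1_sqr (Q x)) as H1.
    (* No sign is assumed for m, but the bound on [dQ] makes m [norm1] nonnegative, so m can be
       negative only where Q vanishes. *)
    assert (Hm : 0 <= m \/ norm1 (Q x) = 0).
    { pose proof (Hd x Tm Tm Hx); pose proof (Rabs_pos (dQ x Tm Tm)).
      assert (0 <= norm1 (Q x)).
      { eapply Rle_trans; [apply Rabs_pos|apply (norm1_ge_term _ Tm Tm)]. }
      destruct (Req_dec (norm1 (Q x)) 0); [now right|left]; nra. }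
    destruct Hm as [Hm|Hm]; [nra|].
    assert (E : norm2 (Q x) = 0); [|rewrite Hm, E; lra].
    apply Rle_antisym.
    * unfold norm2.
      replace 0 with (sumG (fun _ => sumG (fun _ => 0))) by (unfold sumG, sumL; ring).
      apply sumG_le; intro; apply sumG_le; intro.
      pose proof (norm1_ge_term (Q x) mu mu0) as H2; rewrite Hm in H2.
      pose proof (Rabs_pos (Q x mu mu0)).
      rewrite <- pow2_abs; nra.
    * apply sumG_ge0; intro; apply sumG_ge0; intro; apply pow2_ge_0.
Qed.

(** * The calculus of variations in the acceleration *)

(** O(s^n) uniformly on a compact time interval. Restricting to |s| <= 1 lets a higher power of s be
    dominated by a lower one. *)
Definition bigO (T : R) (n : nat) (f : R -> R -> R) : Prop :=
  exists C, forall s t, Rabs s <= 1 -> Rabs t <= T -> Rabs (f s t) <= C * Rabs s ^ n.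

Lemma bigO_ext T n f g :
  (forall s t, Rabs s <= 1 -> Rabs t <= T -> f s t = g s t) -> bigO T n f -> bigO T n g.
Proof. intros E [C H]; exists C; intros s t Hs Ht; rewrite <- E; auto. Qed.

Lemma bigO_plus T n f g : bigO T n f -> bigO T n g -> bigO T n (fun s t => f s t + g s t).
Proof.
intros [C Hf] [D Hg]; exists (C + D); intros s t Hs Ht.
specialize (Hf s t Hs Ht); specialize (Hg s t Hs Ht).
eapply Rle_trans; [apply Rabs_triang|]; lra.
Qed.

Lemma bigO_sumG T n (F : Greek -> R -> R -> R) :
  (forall mu, bigO T n (F mu)) -> bigO T n (fun s t => sumG (fun mu => F mu s t)).
Proof. intro H; unfold sumG, sumL; repeat apply bigO_plus; apply H. Qed.

Lemma bigO_mult T n m f g :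
  bigO T n f -> bigO T m g -> bigO T (n + m) (fun s t => f s t * g s t).
Proof.
intros [C Hf] [D Hg]; exists (C * D); intros s t Hs Ht.
specialize (Hf s t Hs Ht); specialize (Hg s t Hs Ht).
rewrite Rabs_mult, pow_add.
replace (C * D * (Rabs s ^ n * Rabs s ^ m)) with ((C * Rabs s ^ n) * (D * Rabs s ^ m)) by ring.
apply Rmult_le_compat; auto using Rabs_pos.
Qed.

Lemma bigO_S T n f : bigO T (S n) f -> bigO T n f.
Proof.
intros [C Hf]; exists (Rabs C); intros s t Hs Ht; specialize (Hf s t Hs Ht).
pose proof (Rabs_pos s); pose proof (pow_le _ n H); simpl in Hf.
eapply Rle_trans; [exact Hf|].
pose proof (Rle_abs C); pose proof (Rabs_pos C).
apply Rle_trans with (Rabs C * (Rabs s * Rabs s ^ n)); [apply Rmult_le_compat_r; nra|].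
apply Rmult_le_compat_l; nra.
Qed.

Lemma bigO_param T : bigO T 1 (fun s _ => s).
Proof. exists 1; intros; simpl; lra. Qed.

Lemma bigO_const T f : (forall t, continuous f t) -> bigO T 0 (fun _ t => f t).
Proof.
intro Hf; destruct (continuous_bounded f T Hf) as [M [_ HM]].
exists M; intros; simpl; rewrite Rmult_1_r; auto.
Qed.

Lemma Rabs_RInt_le (f : R -> R) t M :
  (forall x, continuous f x) -> (forall x, Rabs x <= Rabs t -> Rabs (f x) <= M) ->
  Rabs (RInt f 0 t) <= Rabs t * M.
Proof.
intros Hf HM; destruct (Rle_dec 0 t) as [Ht|Ht].
- rewrite (Rabs_right t) in * by lra.
  replace (t * M) with ((t - 0) * M) by ring.
  apply abs_RInt_le_const; [lra|now apply ex_RInt_cont|].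
  intros x Hx; apply HM; rewrite Rabs_right; lra.
- rewrite (Rabs_left t) in * by lra.
  rewrite <- (opp_RInt_swap (V := R_CompleteNormedModule) f) by now apply ex_RInt_cont.
  change (Rabs (- RInt f t 0) <= - t * M); rewrite Rabs_Ropp.
  replace (- t * M) with ((0 - t) * M) by ring.
  apply abs_RInt_le_const; [lra|now apply ex_RInt_cont|].
  intros x Hx; apply HM; destruct (Req_dec x 0) as [->|].
  + rewrite Rabs_R0; lra.
  + rewrite Rabs_left; lra.
Qed.

Lemma bigO_RInt T n f :
  (forall s t, continuous (f s) t) -> bigO T n f -> bigO T n (fun s t => RInt (f s) 0 t).
Proof.
intros Hc [C Hf]; exists (T * C); intros s t Hs Ht.
eapply Rle_trans.
- apply (Rabs_RInt_le _ _ (C * Rabs s ^ n)); [apply Hc|].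
  intros x Hx; apply Hf; lra.
- rewrite Rmult_assoc; apply Rmult_le_compat_r; [|exact Ht].
  eapply Rle_trans; [apply Rabs_pos|]; now apply (Hf s t).
Qed.

Definition movep (a h : path) (s : R) : path := fun i t => a i t + s * h i t.

Lemma C0path_movep a h s : C0path a -> C0path h -> C0path (movep a h s).
Proof.
intros Ha Hh i t; apply continuous_plus_R; [apply Ha|].
apply continuous_mult_R; [apply continuous_const_R|apply Hh].
Qed.

Definition tcont (Q : path -> R -> R) : Prop :=
  forall a, C0path a -> forall t, continuous (Q a) t.

(* The remainder is quadratic uniformly on compact intervals of time, which makes
   the notion stable under products and under integration in time. *)
Definition has_variation (h : path) (Q Q' : path -> R -> R) : Prop :=
  tcont Q /\ tcont Q' /\
  forall a, C0path a -> forall T,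
    bigO T 2 (fun s t => Q (movep a h s) t - Q a t - s * Q' a t).

Lemma has_variation_ext h Q1 Q1' Q2 Q2' :
  (forall a, C0path a -> forall t, Q1 a t = Q2 a t) ->
  (forall a, C0path a -> forall t, Q1' a t = Q2' a t) ->
  C0path h -> has_variation h Q1 Q1' -> has_variation h Q2 Q2'.
Proof.
intros E E' Hh [H1 [H2 H3]]; split; [|split].
- intros a Ha t; apply (continuous_ext (Q1 a)); [intro; now apply E|now apply H1].
- intros a Ha t; apply (continuous_ext (Q1' a)); [intro; now apply E'|now apply H2].
- intros a Ha T; eapply bigO_ext; [|apply (H3 a Ha T)].
  intros s t _ _; simpl; rewrite !E, E'; auto using C0path_movep.
Qed.

Lemma variation_const h (f : R -> R) :
  (forall t, continuous f t) -> has_variation h (fun _ => f) (fun _ _ => 0).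
Proof.
intro Hf; repeat split.
- intros a _ t; apply Hf.
- intros a _ t; apply continuous_const_R.
- intros a _ T; exists 0; intros s t _ _.
  replace (f t - f t - s * 0) with 0 by ring; rewrite Rabs_R0; lra.
Qed.

Lemma variation_plus h Q Q' P P' :
  has_variation h Q Q' -> has_variation h P P' ->
  has_variation h (fun a t => Q a t + P a t) (fun a t => Q' a t + P' a t).
Proof.
intros [H1 [H2 H3]] [K1 [K2 K3]]; repeat split.
- intros a Ha t; apply continuous_plus_R; auto.
- intros a Ha t; apply continuous_plus_R; auto.
- intros a Ha T; eapply bigO_ext; [|apply bigO_plus; [apply (H3 a Ha T)|apply (K3 a Ha T)]].
  intros s t _ _; simpl; ring.
Qed.

Lemma variation_mult h Q Q' P P' :
  has_variation h Q Q' -> has_variation h P P' ->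
  has_variation h (fun a t => Q a t * P a t) (fun a t => Q' a t * P a t + Q a t * P' a t).
Proof.
intros [H1 [H2 H3]] [K1 [K2 K3]]; repeat split.
- intros a Ha t; apply continuous_mult_R; auto.
- intros a Ha t; apply continuous_plus_R; apply continuous_mult_R; auto.
- intros a Ha T.
  assert (cQ := bigO_const T _ (H1 a Ha)); assert (cQ' := bigO_const T _ (H2 a Ha)).
  assert (cP := bigO_const T _ (K1 a Ha)); assert (cP' := bigO_const T _ (K2 a Ha)).
  assert (HP : bigO T 0 (fun s t => P (movep a h s) t)).
  { eapply bigO_ext; [|apply bigO_plus; [apply bigO_plus; [apply cP|]|]];
      [|apply bigO_S; exact (bigO_mult _ _ _ _ _ (bigO_param T) cP')
       |apply bigO_S, bigO_S, (K3 a Ha T)].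
    intros s t _ _; simpl; ring. }
  (* With R the quadratic remainders and a subscript s for the perturbed values, Q_s P_s - Q P - s
     (Q' P + Q P') = R_Q P_s + Q R_P + s Q' (s P') + s Q' R_P; the last term is even cubic. *)
  eapply bigO_ext; [|apply bigO_plus; [apply bigO_plus|]];
    [|exact (bigO_mult _ _ _ _ _ (H3 a Ha T) HP)
     |exact (bigO_mult _ _ _ _ _ cQ (K3 a Ha T))
     |apply bigO_plus;
       [exact (bigO_mult _ _ _ _ _ (bigO_param T)
         (bigO_mult _ _ _ _ _ cQ' (bigO_mult _ _ _ _ _ (bigO_param T) cP')))
       |apply bigO_S; exact (bigO_mult _ _ _ _ _ (bigO_param T)
         (bigO_mult _ _ _ _ _ cQ' (K3 a Ha T)))]].
  intros s t _ _; simpl; ring.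
Qed.

Lemma variation_scal h c Q Q' :
  has_variation h Q Q' -> has_variation h (fun a t => c * Q a t) (fun a t => c * Q' a t).
Proof.
intros [H1 [H2 H3]]; repeat split.
- intros a Ha t; apply continuous_mult_R; [apply continuous_const_R|auto].
- intros a Ha t; apply continuous_mult_R; [apply continuous_const_R|auto].
- intros a Ha T; eapply bigO_ext;
    [|exact (bigO_mult _ _ _ _ _ (bigO_const T (fun _ => c) (fun _ => continuous_const_R c _))
              (H3 a Ha T))].
  intros s t _ _; simpl; ring.
Qed.

Lemma variation_sumL h (Q Q' : Lat -> path -> R -> R) :
  (forall i, has_variation h (Q i) (Q' i)) ->
  has_variation h (fun a t => sumL (fun i => Q i a t)) (fun a t => sumL (fun i => Q' i a t)).
Proof. intro H; unfold sumL; repeat apply variation_plus; apply H. Qed.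

Lemma variation_sumG h (Q Q' : Greek -> path -> R -> R) :
  (forall mu, has_variation h (Q mu) (Q' mu)) ->
  has_variation h (fun a t => sumG (fun mu => Q mu a t)) (fun a t => sumG (fun mu => Q' mu a t)).
Proof.
intro H; unfold sumG; apply variation_plus; [|apply H].
apply (variation_sumL h (fun i => Q (Sp i)) (fun i => Q' (Sp i))); intro; apply H.
Qed.

Lemma variation_RInt h Q Q' : C0path h ->
  has_variation h Q Q' ->
  has_variation h (fun a t => RInt (Q a) 0 t) (fun a t => RInt (Q' a) 0 t).
Proof.
intros Hh [H1 [H2 H3]]; repeat split.
- intros a Ha t; eapply is_derive_cont, is_derive_primitive; auto.
- intros a Ha t; eapply is_derive_cont, is_derive_primitive; auto.
- intros a Ha T; eapply bigO_ext; [|apply bigO_RInt; [|apply (H3 a Ha T)]].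
  + intros s t _ _; simpl.
    assert (Hs := H1 _ (C0path_movep a h s Ha Hh)).
    assert (HsQ : forall x, continuous (fun t => s * Q' a t) x)
      by (intro x; apply continuous_mult_R; [apply continuous_const_R|auto]).
    rewrite RInt_minus_R, RInt_minus_R, RInt_scal_R; auto.
    intro x; apply continuous_minus_R; auto.
  + intros s t; simpl.
    assert (Hs := H1 _ (C0path_movep a h s Ha Hh)).
    repeat apply continuous_minus_R; auto.
    apply continuous_mult_R; [apply continuous_const_R|auto].
Qed.

Lemma is_derive_quadratic (f : R -> R) (l C : R) :
  (forall s, Rabs s <= 1 -> Rabs (f s - f 0 - s * l) <= C * Rabs s ^ 2) -> is_derive f 0 l.
Proof.
intro H; apply is_derive_Reals; intros e He.
assert (HC : 0 < Rabs C + 1) by (pose proof (Rabs_pos C); lra).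
assert (Hd : 0 < Rmin 1 (e / (Rabs C + 1))).
{ apply Rmin_glb_lt; [lra|]; now apply Rdiv_lt_0_compat. }
exists (mkposreal _ Hd); intros s Hs0 Hs; simpl in Hs.
assert (Hs1 : Rabs s < 1) by (eapply Rlt_le_trans; [exact Hs|apply Rmin_l]).
assert (Hs2 : Rabs s < e / (Rabs C + 1)) by (eapply Rlt_le_trans; [exact Hs|apply Rmin_r]).
rewrite Rplus_0_l.
replace ((f s - f 0) / s - l) with ((f s - f 0 - s * l) / s) by (field; exact Hs0).
unfold Rdiv; rewrite Rabs_mult, Rabs_inv.
assert (0 < Rabs s) by now apply Rabs_pos_lt.
apply Rmult_lt_reg_r with (Rabs s); [assumption|].
rewrite Rmult_assoc, Rinv_l, Rmult_1_r by lra.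
specialize (H s (Rlt_le _ _ Hs1)).
apply (Rmult_lt_compat_r (Rabs C + 1)) in Hs2; [|assumption].
replace (e / (Rabs C + 1) * (Rabs C + 1)) with e in Hs2 by (field; lra).
pose proof (Rle_abs C); simpl in H; nra.
Qed.

Lemma is_derive_variation h Q Q' : has_variation h Q Q' ->
  forall a, C0path a -> forall t, is_derive (fun s => Q (movep a h s) t) 0 (Q' a t).
Proof.
intros [_ [_ H]] a Ha t; destruct (H a Ha (Rabs t)) as [C HC].
apply (is_derive_quadratic _ _ C); intros s Hs.
replace (Q (movep a h 0) t) with (Q a t).
- apply HC; [exact Hs|lra].
- f_equal; unfold movep; do 2 (apply functional_extensionality; intro); ring.
Qed.

(** * The normalized frame *)

Lemma point_eq (p q : point) :
  (forall i, xi p i = xi q i) -> tau p = tau q -> (forall i t, acc p i t = acc q i t) -> p = q.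
Proof.
destruct p, q; simpl; intros H1 H2 H3; subst; f_equal.
- now apply functional_extensionality.
- apply functional_extensionality; intro; now apply functional_extensionality.
Qed.

Lemma move_0 p v : move p v 0 = p.
Proof. apply point_eq; intros; simpl; ring. Qed.

(** The normalization factor: the plain derivative along [dir E] is [wt E] times the frame
    derivative. *)
Definition wt (E : frame) (p : point) : R :=
  match E with Fcoord Tm => lapse p | _ => 1 end.

(** Relational form of [frame_op] which also records differentiability. The weight multiplies the
    value, so that the rules for sums and products pass through without any division by the
    lapse. *)
Definition is_frame (E : frame) (G : field) (p : point) (l : R) : Prop :=
  is_derive (fun s => G (move p (dir E) s)) 0 (wt E p * l).

Lemma wt_pos E p : inM p -> 0 < wt E p.
Proof. intros [_ H]; destruct E as [[]|]; simpl; lra. Qed.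

Lemma frame_opE E G p : frame_op E G p = / wt E p * dd (dir E) G p.
Proof. destruct E as [[]|]; simpl; unfold fundd; rewrite ?Rinv_1, ?Rmult_1_l; reflexivity. Qed.

Lemma is_frame_unique E G p l : inM p -> is_frame E G p l -> frame_op E G p = l.
Proof.
intros Hp H; rewrite frame_opE.
replace (dd (dir E) G p) with (wt E p * l) by (symmetry; exact (is_derive_unique _ _ _ H)).
 pose proof (wt_pos E p Hp); field; lra.
Qed.

Lemma dd_frame_op E G p : inM p -> dd (dir E) G p = wt E p * frame_op E G p.
Proof. intro Hp; rewrite frame_opE; pose proof (wt_pos E p Hp); field; lra. Qed.

Lemma is_frame_op E G p : inM p -> ex_dd (dir E) G p -> is_frame E G p (frame_op E G p).
Proof.
intros Hp H; unfold is_frame; rewrite <- dd_frame_op by exact Hp; now apply Derive_correct.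
Qed.

Lemma is_frame_eq E G p (l m : R) : is_frame E G p l -> l = m -> is_frame E G p m.
Proof. now intros H <-. Qed.

Lemma is_frame_const E c p : is_frame E (fun _ => c) p 0.
Proof. unfold is_frame; rewrite Rmult_0_r; apply is_derive_const_R. Qed.

Lemma is_frame_plus E G H p l m :
  is_frame E G p l -> is_frame E H p m -> is_frame E (fun q => G q + H q) p (l + m).
Proof.
intros HG HH; unfold is_frame; rewrite Rmult_plus_distr_l; now apply is_derive_plus_R.
Qed.

Lemma is_frame_mult E G H p l m :
  is_frame E G p l -> is_frame E H p m ->
  is_frame E (fun q => G q * H q) p (l * H p + G p * m).
Proof.
intros HG HH; unfold is_frame; eapply is_derive_eq; [apply is_derive_mult_R; eassumption|].
simpl; rewrite move_0; ring.
Qed.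

Lemma is_frame_minus E G H p l m :
  is_frame E G p l -> is_frame E H p m -> is_frame E (fun q => G q - H q) p (l - m).
Proof.
intros HG HH; unfold is_frame; rewrite Rmult_minus_distr_l; now apply is_derive_minus_R.
Qed.

Lemma is_frame_sumL E (G : Lat -> field) p (l : Lat -> R) :
  (forall i, is_frame E (G i) p (l i)) ->
  is_frame E (fun q => sumL (fun i => G i q)) p (sumL l).
Proof. intro H; unfold sumL; repeat apply is_frame_plus; apply H. Qed.

Lemma is_frame_sumG E (G : Greek -> field) p (l : Greek -> R) :
  (forall mu, is_frame E (G mu) p (l mu)) ->
  is_frame E (fun q => sumG (fun mu => G mu q)) p (sumG l).
Proof. intro H; unfold sumG, sumL; repeat apply is_frame_plus; apply H. Qed.

Lemma continuity_2d_pt_affine c v w s t :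
  continuity_2d_pt (fun s t => c + s * v + t * w) s t.
Proof.
repeat apply continuity_2d_pt_plus; try apply continuity_2d_pt_const;
  apply continuity_2d_pt_mult; auto using continuity_2d_pt_const, continuity_2d_pt_id1, continuity_2d_pt_id2.
Qed.

Lemma fcont_const c : fcont (fun _ => c).
Proof. intros p v w _ _ _; apply continuity_2d_pt_const. Qed.

Lemma fcont_plus F G : fcont F -> fcont G -> fcont (fun p => F p + G p).
Proof.
intros HF HG p v w Hp Hv Hw.
apply (continuity_2d_pt_plus (fun s t => F _) (fun s t => G _)); auto.
Qed.

Lemma fcont_mult F G : fcont F -> fcont G -> fcont (fun p => F p * G p).
Proof.
intros HF HG p v w Hp Hv Hw.
apply (continuity_2d_pt_mult (fun s t => F _) (fun s t => G _)); auto.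
Qed.

Lemma fcont_xi i : fcont (fun p => xi p i).
Proof. intros p v w _ _ _; apply continuity_2d_pt_affine. Qed.

Lemma fcont_tau (phi : R -> R) : (forall t, continuous phi t) -> fcont (fun p => phi (tau p)).
Proof.
intros Hphi p v w _ _ _; simpl.
apply (continuity_1d_2d_pt_comp phi (fun s t => tau p + s * tau v + t * tau w));
  [apply continuity_pt_filterlim, Hphi|apply continuity_2d_pt_affine].
Qed.

Lemma fcont_acc i : fcont (fun p => acc p i (tau p)).
Proof.
intros p v w [Hp _] Hv Hw; simpl.
assert (H : forall phi : R -> R, (forall t, continuous phi t) ->
  continuity_2d_pt (fun s t => phi (tau p + s * tau v + t * tau w)) 0 0).
{ intros phi Hphi; apply (continuity_1d_2d_pt_comp phi (fun s t => tau p + s * tau v + t * tau w));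
    [apply continuity_pt_filterlim, Hphi|apply continuity_2d_pt_affine]. }
repeat apply continuity_2d_pt_plus.
- apply (H (acc p i)), Hp.
- apply continuity_2d_pt_mult; [apply continuity_2d_pt_id1|apply (H (acc v i)), Hv].
- apply continuity_2d_pt_mult; [apply continuity_2d_pt_id2|apply (H (acc w i)), Hw].
Qed.

Lemma fcont_lapse : fcont lapse.
Proof.
unfold lapse, sumL; repeat apply fcont_plus; try apply fcont_const;
  apply fcont_mult; auto using fcont_xi, fcont_acc.
Qed.

Lemma C0path_move p v s : C0path (acc p) -> C0path (acc v) -> C0path (acc (move p v s)).
Proof.
intros Hp Hv i t; simpl; apply continuous_plus_R; [apply Hp|].
apply continuous_mult_R; [apply continuous_const_R|apply Hv].
Qed.

(** The lapse is continuous along two-parameter families, and a deviation smaller than [lapse p]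
    keeps it positive. *)
Lemma inM_near_2d p v w : inM p -> C0path (acc v) -> C0path (acc w) ->
  locally_2d (fun s t => inM (move (move p v s) w t)) 0 0.
Proof.
intros Hp Hv Hw; pose proof (fcont_lapse p v w Hp Hv Hw) as H.
destruct Hp as [Ha Hl].
destruct (H (mkposreal _ Hl)) as [d Hd]; exists d; intros s t Hs Ht.
split; [apply C0path_move; [apply C0path_move|]; assumption|].
specialize (Hd s t Hs Ht); simpl in Hd; rewrite !move_0 in Hd.
apply Rabs_def2 in Hd; lra.
Qed.

Lemma frame_ok_C0 E : frame_ok E -> C0path (acc (dir E)).
Proof.
intro HE; destruct E as [[]|]; simpl.
- intros j t; apply continuous_const_R.
- intros j t; apply continuous_const_R.
- intros j t; simpl; apply continuous_mult_R; [apply continuous_const_R|apply HE].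
Qed.

Lemma inM_near p v : inM p -> C0path (acc v) -> locally 0 (fun s => inM (move p v s)).
Proof.
intros Hp Hv; destruct (inM_near_2d p v v Hp Hv Hv) as [d Hd].
exists d; intros s Hs; rewrite <- (move_0 (move p v s) v); apply Hd.
- exact Hs.
- rewrite Rminus_diag, Rabs_R0; apply cond_pos.
Qed.

Lemma is_frame_ext E G H p l : frame_ok E -> inM p ->
  (forall q, inM q -> G q = H q) -> is_frame E G p l -> is_frame E H p l.
Proof.
intros HE Hp HGH; apply is_derive_ext_loc.
apply (filter_imp (fun s => inM (move p (dir E) s))); [auto|].
apply inM_near; [exact Hp|now apply frame_ok_C0].
Qed.

Lemma frame_op_ext E G H p : frame_ok E -> inM p ->
  (forall q, inM q -> G q = H q) -> frame_op E G p = frame_op E H p.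
Proof.
intros HE Hp HGH; rewrite !frame_opE; f_equal; apply Derive_ext_loc.
apply (filter_imp (fun s => inM (move p (dir E) s))); [auto|].
apply inM_near; [exact Hp|now apply frame_ok_C0].
Qed.

Definition frame_diff (G : field) : Prop :=
  forall E p, frame_ok E -> inM p -> is_frame E G p (frame_op E G p).

Lemma frame_diff_intro (G : field) :
  (forall E p, frame_ok E -> inM p -> exists l, is_frame E G p l) -> frame_diff G.
Proof.
intros H E p HE Hp; destruct (H E p HE Hp) as [l Hl].
now rewrite (is_frame_unique E G p l Hp Hl).
Qed.

Lemma frame_diff_ext G H : (forall q, inM q -> G q = H q) -> frame_diff G -> frame_diff H.
Proof.
intros E HG; apply frame_diff_intro; intros F p HF Hp.
exists (frame_op F G p); apply (is_frame_ext F G); auto.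
Qed.

Lemma frame_diff_const c : frame_diff (fun _ => c).
Proof. apply frame_diff_intro; intros E p _ _; exists 0; apply is_frame_const. Qed.

Lemma frame_diff_plus G H : frame_diff G -> frame_diff H -> frame_diff (fun p => G p + H p).
Proof.
intros HG HH; apply frame_diff_intro; intros E p HE Hp.
eexists; apply is_frame_plus; auto.
Qed.

Lemma frame_diff_mult G H : frame_diff G -> frame_diff H -> frame_diff (fun p => G p * H p).
Proof.
intros HG HH; apply frame_diff_intro; intros E p HE Hp.
eexists; apply is_frame_mult; auto.
Qed.

Lemma frame_diff_sumG (G : Greek -> field) :
  (forall mu, frame_diff (G mu)) -> frame_diff (fun p => sumG (fun mu => G mu p)).
Proof. intro H; unfold sumG, sumL; repeat apply frame_diff_plus; apply H. Qed.

Lemma frame_diff_sumL (G : Lat -> field) :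
  (forall i, frame_diff (G i)) -> frame_diff (fun p => sumL (fun i => G i p)).
Proof. intro H; unfold sumL; repeat apply frame_diff_plus; apply H. Qed.

Lemma Ck_frame_diff n F : Ck (S n) F -> frame_diff F.
Proof. intros [_ H] E p HE Hp; apply is_frame_op; [exact Hp|now apply (H E HE)]. Qed.

Lemma Ck_frame_op n F E : frame_ok E -> Ck (S n) F -> Ck n (frame_op E F).
Proof. intros HE [_ H]; now apply H. Qed.

Lemma Ck_fcont n F : Ck n F -> fcont F.
Proof. destruct n; [auto|now intros [H _]]. Qed.

(** The derivative of [wt E2] along E1. When both are [Fcoord Tm] the value 0 is a placeholder:
    there the derivative need not exist, and [is_frame_wt] excludes this direction. *)
Definition dwt (E1 E2 : frame) (p : point) : R :=
  match E2, E1 with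
  | Fcoord Tm, Fcoord (Sp i) => acc p i (tau p)
  | Fcoord Tm, Facc i phi => xi p i * phi (tau p)
  | _, _ => 0
  end.

Lemma is_frame_wt E1 E2 p : E1 <> Fcoord Tm -> is_frame E1 (wt E2) p (dwt E1 E2 p).
Proof.
intro H1.
assert (H0 : is_frame E1 (fun _ => 1) p 0) by apply is_frame_const.
destruct E2 as [[k|]|k psi].
1, 3: destruct E1 as [[]|]; exact H0.
clear H0; destruct E1 as [[i|]|i phi]; [|now destruct H1|]; unfold is_frame; simpl.
- apply (is_derive_ext_R (fun s => 1 + sumL (fun k => (xi p k + s * deltaL i k) * acc p k (tau p)))).
  + intro s; unfold lapse, sumL; simpl; now rewrite !Rmult_0_r, !Rplus_0_r.
  + unfold sumL; auto_derive; [exact I|]; destruct i; simpl; ring.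
- apply (is_derive_ext_R (fun s => 1 + sumL (fun k => xi p k * (acc p k (tau p) + s * (deltaL i k * phi (tau p)))))).
  + intro s; unfold lapse, sumL; simpl; now rewrite !Rmult_0_r, !Rplus_0_r.
  + unfold sumL; auto_derive; [exact I|]; destruct i; simpl; ring.
Qed.

Lemma fcont_wt E : fcont (wt E).
Proof.
destruct E as [[i|]|i phi]; [exact (fcont_const 1)|exact fcont_lapse|exact (fcont_const 1)].
Qed.

Lemma fcont_dwt E1 E2 : frame_ok E1 -> fcont (dwt E1 E2).
Proof.
intro H1; destruct E2 as [[j|]|j psi], E1 as [[i|]|i phi]; try exact (fcont_const 0).
- exact (fcont_acc i).
- exact (fcont_mult _ _ (fcont_xi i) (fcont_tau phi H1)).
Qed.

Lemma Derive_shift (f : R -> R) u : Derive (fun s => f (u + s)) 0 = Derive f u.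
Proof.
unfold Derive; f_equal; apply Lim_ext; intro h; rewrite Rplus_0_l, Rplus_0_r; reflexivity.
Qed.

Lemma is_derive_shift (f : R -> R) (u l : R) : is_derive (fun s => f (u + s)) 0 l -> is_derive f u l.
Proof.
intro H; apply (is_derive_ext_R (fun z => f (u + (z - u)))); [intro; f_equal; ring|].
apply (is_derive_eq _ _ (1 * l)); [|ring].
apply (is_derive_comp (V := R_NormedModule) (fun s => f (u + s)) (fun z => z - u)).
- now rewrite Rminus_diag.
- auto_derive; [exact I|ring].
Qed.

Lemma move_move_l p v w u t s :
  move (move (move p v u) w t) v s = move (move p v (u + s)) w t.
Proof. apply point_eq; intros; simpl; ring. Qed.

Lemma move_move_r p v w u t s :
  move (move (move p v u) w t) w s = move (move p v u) w (t + s).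
Proof. apply point_eq; intros; simpl; ring. Qed.

(** Schwarz's theorem for the plain derivatives along [dir E1] and [dir E2]. As [wt E1] is 1, only
    [wt E2] is differentiated, along E1, and this produces the [dwt] term. [D12] and [D21] are the
    two mixed derivatives written in the frame, where their continuity is part of [Ck 2]. *)
Lemma frame_op_swap E1 E2 F p : E1 <> Fcoord Tm -> frame_ok E1 -> frame_ok E2 ->
  Ck 2 F -> inM p ->
  dwt E1 E2 p * frame_op E2 F p + wt E2 p * frame_op E1 (frame_op E2 F) p
  = wt E2 p * frame_op E2 (frame_op E1 F) p.
Proof.
intros N1 H1 H2 HF Hp.
set (v := dir E1); set (w := dir E2).
assert (Hv := frame_ok_C0 _ H1 : C0path (acc v)); assert (Hw := frame_ok_C0 _ H2 : C0path (acc w)).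
assert (W1 : forall q, wt E1 q = 1) by (destruct E1 as [[]|]; intro; simpl; congruence).
assert (F1 := Ck_frame_op 1 F E1 H1 HF); assert (F2 := Ck_frame_op 1 F E2 H2 HF).
set (D12 q := dwt E1 E2 q * frame_op E2 F q + wt E2 q * frame_op E1 (frame_op E2 F) q).
set (D21 q := wt E2 q * frame_op E2 (frame_op E1 F) q).
assert (I12 : forall q, inM q -> is_derive (fun s => dd w F (move q v s)) 0 (D12 q)).
{ intros q Hq.
  assert (H : is_frame E1 (dd w F) q (D12 q)).
  { apply (is_frame_ext E1 (fun q => wt E2 q * frame_op E2 F q)); auto.
    - intros r Hr; symmetry; now apply dd_frame_op.
    - apply is_frame_mult; [now apply is_frame_wt|now apply (Ck_frame_diff 0)]. }
  unfold is_frame in H; now rewrite W1, Rmult_1_l in H. }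
assert (I21 : forall q, inM q -> is_derive (fun s => dd v F (move q w s)) 0 (D21 q)).
{ intros q Hq; apply (is_frame_ext E2 (frame_op E1 F)); auto.
  - intros r Hr; unfold v; now rewrite dd_frame_op, W1, Rmult_1_l.
  - now apply (Ck_frame_diff 0). }
assert (C12 : fcont D12).
{ apply fcont_plus; apply fcont_mult; [now apply fcont_dwt| |apply fcont_wt|].
  - now apply (Ck_fcont 1).
  - now apply (Ck_fcont 0), (Ck_frame_op 0). }
assert (C21 : fcont D21).
{ apply fcont_mult; [apply fcont_wt|]; now apply (Ck_fcont 0), (Ck_frame_op 0). }
set (f s t := F (move (move p v s) w t)).
assert (Dv : forall u t, Derive (fun z => f z t) u = dd v F (move (move p v u) w t)).
{ intros u t; unfold dd; rewrite <- Derive_shift; apply Derive_ext; intro s.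
  unfold f; now rewrite move_move_l. }
assert (Dw : forall u t, Derive (fun z => f u z) t = dd w F (move (move p v u) w t)).
{ intros u t; unfold dd; rewrite <- Derive_shift; apply Derive_ext; intro s.
  unfold f; now rewrite move_move_r. }
assert (J12 : forall u t, inM (move (move p v u) w t) ->
  is_derive (fun z => Derive (fun x => f z x) t) u (D12 (move (move p v u) w t))).
{ intros u t Hq; apply (is_derive_ext_R (fun z => dd w F (move (move p v z) w t)));
    [intro; symmetry; apply Dw|].
  apply is_derive_shift, (is_derive_ext_R (fun s => dd w F (move (move (move p v u) w t) v s)));
    [intro; now rewrite move_move_l|]; now apply I12. }
assert (J21 : forall u t, inM (move (move p v u) w t) ->
  is_derive (fun z => Derive (fun x => f x z) u) t (D21 (move (move p v u) w t))).
{ intros u t Hq; apply (is_derive_ext_R (fun z => dd v F (move (move p v u) w z)));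
    [intro; symmetry; apply Dv|].
  apply is_derive_shift, (is_derive_ext_R (fun s => dd v F (move (move (move p v u) w t) w s)));
    [intro; now rewrite move_move_r|]; now apply I21. }
assert (near := inM_near_2d p v w Hp Hv Hw).
assert (E : Derive (fun z => Derive (fun t => f z t) 0) 0 = Derive (fun z => Derive (fun t => f t z) 0) 0).
{ apply Schwarz.
  - apply (locally_2d_impl (fun u t => inM (move (move p v u) w t))); [|exact near].
    apply locally_2d_forall; intros u t Hq; repeat split.
    + destruct (proj2 HF E1 H1) as [Hd _]; destruct (Hd _ Hq) as [l Hl].
      exists l; apply is_derive_shift.
      apply (is_derive_ext_R (fun s => F (move (move (move p v u) w t) v s)));
        [intro; unfold f; now rewrite move_move_l|exact Hl].
    + destruct (proj2 HF E2 H2) as [Hd _]; destruct (Hd _ Hq) as [l Hl].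
      exists l; apply is_derive_shift.
      apply (is_derive_ext_R (fun s => F (move (move (move p v u) w t) w s)));
        [intro; unfold f; now rewrite move_move_r|exact Hl].
    + eexists; now apply J12.
    + eexists; now apply J21.
  - apply (continuity_2d_pt_ext_loc (fun u t => D12 (move (move p v u) w t))); [|now apply C12].
    apply (locally_2d_impl (fun u t => inM (move (move p v u) w t))); [|exact near].
    apply locally_2d_forall; intros u t Hq; symmetry; now apply is_derive_unique, J12.
  - apply (continuity_2d_pt_ext_loc (fun u t => D21 (move (move p v u) w t))); [|now apply C21].
    apply (locally_2d_impl (fun u t => inM (move (move p v u) w t))); [|exact near].
    apply locally_2d_forall; intros u t Hq; symmetry; now apply is_derive_unique, J21. }
assert (Hp' : inM (move (move p v 0) w 0)) by now rewrite !move_0.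
pose proof (is_derive_unique _ _ _ (J12 0 0 Hp')) as U12.
pose proof (is_derive_unique _ _ _ (J21 0 0 Hp')) as U21.
rewrite !move_0 in U12, U21.
exact (eq_trans (eq_sym U12) (eq_trans E U21)).
Qed.

Definition single (i : Lat) (phi : R -> R) : path := fun j t => deltaL i j * phi t.

Lemma C0path_single i phi : (forall t, continuous phi t) -> C0path (single i phi).
Proof.
intros H j t; apply continuous_mult_R; [apply continuous_const_R|apply H].
Qed.

Lemma is_frame_xi E j p :
  is_frame E (fun q => xi q j) p (match E with Fcoord (Sp i) => deltaL i j | _ => 0 end).
Proof.
unfold is_frame; destruct E as [[i|]|i phi]; simpl; auto_derive; auto; ring.
Qed.

Lemma is_frame_path (Q : path -> R -> R) E p (l : R) : frame_ok E -> inM p ->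
  match E with
  | Fcoord (Sp i) => l = 0
  | Fcoord Tm => exists q : R, is_derive (Q (acc p)) (tau p) q /\ l = q / lapse p
  | Facc i phi => exists Q', has_variation (single i phi) Q Q' /\ l = Q' (acc p) (tau p)
  end -> is_frame E (fun q => Q (acc q) (tau q)) p l.
Proof.
intros HE Hp H; unfold is_frame; destruct E as [[i|]|i phi].
- rewrite H, Rmult_0_r; apply (is_derive_ext_R (fun _ => Q (acc p) (tau p))).
  + intro s; f_equal; simpl.
    * do 2 (apply functional_extensionality; intro); ring.
    * ring.
  + apply is_derive_const_R.
- destruct H as [q [Hq ->]].
  assert (N := wt_pos (Fcoord Tm) p Hp); simpl in N.
  apply (is_derive_eq _ _ q); [|simpl; field; lra].
  apply (is_derive_ext_R (fun s => Q (acc p) (tau p + s))).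
  + intro s; simpl; f_equal.
    * do 2 (apply functional_extensionality; intro); ring.
    * ring.
  + apply (is_derive_eq _ _ (1 * q)); [|ring].
    apply (is_derive_comp (V := R_NormedModule) (Q (acc p)) (fun s => tau p + s)).
    * now rewrite Rplus_0_r.
    * auto_derive; [exact I|ring].
- destruct H as [Q' [HQ ->]]; simpl; rewrite Rmult_1_l.
  apply (is_derive_ext_R (fun s => Q (movep (acc p) (single i phi) s) (tau p))).
  + intro s; simpl; now rewrite Rmult_0_r, Rplus_0_r.
  + apply (is_derive_variation _ _ _ HQ); apply Hp.
Qed.

(** As a function of t, [chi t T] is the signed indicator of the interval between 0 and T, negative
    when T < 0, which is the sign of the oriented integral. *)
Lemma is_RInt_gen_chi (g : R -> R) T : (forall t, continuous g t) ->
  is_RInt_gen (fun t => chi t T * g t) (Rbar_locally m_infty) (Rbar_locally p_infty)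
    (RInt g 0 T).
Proof.
intros Hg P HP.
exists (fun x => x < Rmin 0 T) (fun y => Rmax 0 T < y).
- exists (Rmin 0 T); auto.
- exists (Rmax 0 T); auto.
- intros x y Hx Hy; exists (RInt g 0 T); split; [|now apply locally_singleton].
  (* Only interior points are tested: at the common endpoints [chi] may take another value, which
     does not affect the integral. *)
  assert (Z : forall u v, (u <= v) -> (forall t, u < t < v -> chi t T = 0) ->
     is_RInt (fun t => chi t T * g t) u v 0).
  { intros u v Huv Hc; apply (is_RInt_ext (fun _ => 0)).
    - intros t Ht; rewrite Rmin_left, Rmax_right in Ht by lra; rewrite Hc by lra.
      change (0 = 0 * g t); ring.
    - evar_last; [apply (is_RInt_const (V := R_NormedModule))|].
      exact (Rmult_0_r (v - u)). }
  simpl; destruct (Rle_dec 0 T) as [HT|HT].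
  + rewrite Rmin_left in Hx by lra; rewrite Rmax_right in Hy by lra.
    apply (is_RInt_ext (fun t => chi t T * g t)); [reflexivity|].
    replace (RInt g 0 T) with (0 + (RInt g 0 T + 0)) by ring.
    apply (is_RInt_Chasles (V := R_NormedModule) _ x 0 y).
    { apply Z; [lra|]; intros t Ht; unfold chi, theta.
      destruct (Rle_dec 0 t), (Rle_dec 0 (T - t)), (Rle_dec 0 (-t)), (Rle_dec 0 (t - T)); lra. }
    apply (is_RInt_Chasles (V := R_NormedModule) _ 0 T y).
    { apply (is_RInt_ext g).
      - intros t Ht; rewrite Rmin_left, Rmax_right in Ht by lra.
        assert (E : chi t T = 1); [|rewrite E; symmetry; apply Rmult_1_l].
        unfold chi, theta.
        destruct (Rle_dec 0 t), (Rle_dec 0 (T - t)), (Rle_dec 0 (-t)), (Rle_dec 0 (t - T)); lra.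
      - apply (RInt_correct (V := R_CompleteNormedModule)); now apply ex_RInt_cont. }
    apply Z; [lra|]; intros t Ht; unfold chi, theta.
    destruct (Rle_dec 0 t), (Rle_dec 0 (T - t)), (Rle_dec 0 (-t)), (Rle_dec 0 (t - T)); lra.
  + rewrite Rmin_right in Hx by lra; rewrite Rmax_left in Hy by lra.
    replace (RInt g 0 T) with (0 + (RInt g 0 T + 0)) by ring.
    apply (is_RInt_Chasles (V := R_NormedModule) _ x T y).
    { apply Z; [lra|]; intros t Ht; unfold chi, theta.
      destruct (Rle_dec 0 t), (Rle_dec 0 (T - t)), (Rle_dec 0 (-t)), (Rle_dec 0 (t - T)); lra. }
    apply (is_RInt_Chasles (V := R_NormedModule) _ T 0 y).
    { apply (is_RInt_ext (fun t => - g t)).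
      - intros t Ht; rewrite Rmin_left, Rmax_right in Ht by lra.
        assert (E : chi t T = -1); [|rewrite E; simpl; change (- g t = -1 * g t); ring].
        unfold chi, theta.
        destruct (Rle_dec 0 t), (Rle_dec 0 (T - t)), (Rle_dec 0 (-t)), (Rle_dec 0 (t - T)); lra.
      - rewrite <- (opp_RInt_swap (V := R_CompleteNormedModule) g T 0) by now apply ex_RInt_cont.
        apply (is_RInt_opp (V := R_NormedModule) g).
        apply (RInt_correct (V := R_CompleteNormedModule)); now apply ex_RInt_cont. }
    apply Z; [lra|]; intros t Ht; unfold chi, theta.
    destruct (Rle_dec 0 t), (Rle_dec 0 (T - t)), (Rle_dec 0 (-t)), (Rle_dec 0 (t - T)); lra.
Qed.

(** * Derivations *)

(** What the frame derivatives, P and D have in common. [der_ext] allows a function to be replaced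
    by an expression valid only on the domain, such as [DgenE]; the Leibniz rule is asked of
    frame-differentiable functions only. The brackets then follow from the values on k. *)
Record derivation (X : operator) : Prop := Derivation {
  der_ext : forall G H p, inM p -> (forall q, inM q -> G q = H q) -> X G p = X H p;
  der_const : forall c p, inM p -> X (fun _ => c) p = 0;
  der_plus : forall G H p, inM p -> frame_diff G -> frame_diff H ->
    X (fun q => G q + H q) p = X G p + X H p;
  der_mult : forall G H p, inM p -> frame_diff G -> frame_diff H ->
    X (fun q => G q * H q) p = X G p * H p + G p * X H p }.

Section Derivation.
Context (X : operator) (HX : derivation X).

Lemma der_scal c G p : inM p -> frame_diff G -> X (fun q => c * G q) p = c * X G p.
Proof.
intros Hp HG; rewrite (der_mult X HX (fun _ => c) G p Hp (frame_diff_const c) HG).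
rewrite (der_const X HX c p Hp); ring.
Qed.

Lemma der_minus G H p : inM p -> frame_diff G -> frame_diff H ->
  X (fun q => G q - H q) p = X G p - X H p.
Proof.
intros Hp HG HH.
rewrite (der_ext X HX _ (fun q => G q + -1 * H q) p Hp) by (intros; ring).
rewrite (der_plus X HX G (fun q => -1 * H q)); auto.
- rewrite der_scal by auto; ring.
- apply frame_diff_mult; auto using frame_diff_const.
Qed.

Lemma der_sumL (G : Lat -> field) p : inM p -> (forall i, frame_diff (G i)) ->
  X (fun q => sumL (fun i => G i q)) p = sumL (fun i => X (G i) p).
Proof.
intros Hp HG; unfold sumL.
rewrite (der_plus X HX (fun q => G x1 q + G x2 q) (G x3)); auto using frame_diff_plus.
rewrite (der_plus X HX (G x1) (G x2)); auto.
Qed.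

Lemma der_sumG (G : Greek -> field) p : inM p -> (forall mu, frame_diff (G mu)) ->
  X (fun q => sumG (fun mu => G mu q)) p = sumG (fun mu => X (G mu) p).
Proof.
intros Hp HG; unfold sumG.
rewrite (der_plus X HX (fun q => sumL (fun i => G (Sp i) q)) (G Tm)); auto.
- rewrite (der_sumL (fun i => G (Sp i))); auto.
- apply (frame_diff_sumL (fun i => G (Sp i))); auto.
Qed.

End Derivation.

Lemma derivation_frame_op E : frame_ok E -> derivation (frame_op E).
Proof.
intro HE; split; intros.
- now apply frame_op_ext.
- apply is_frame_unique; [assumption|apply is_frame_const].
- apply is_frame_unique; [assumption|apply is_frame_plus; auto].
- apply is_frame_unique; [assumption|apply is_frame_mult; auto].
Qed.

(** * Functions of the coordinates at a fixed acceleration *)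

Definition slice_lapse (a : path) (q : event) : R := lapse (at_acc a q).

Lemma slice_lapseE a x t : slice_lapse a (x, t) = 1 + sumL (fun i => x i * a i t).
Proof. reflexivity. Qed.

(** Sorted by dx dx, dx dt and dt dt: the coefficients are the Killing equations. *)
Lemma interval_variationE a Z T A q dx dt :
  interval_variation a Z T A q dx dt =
  sumL (fun i => sumL (fun j => dx i * dx j * partial a (Sp j) (Z i) q))
  + dt * sumL (fun i => dx i * (partial a Tm (Z i) q
      - slice_lapse a q * partial a (Sp i) (fun q => slice_lapse a q * T q) q
      + slice_lapse a q * T q * a i (snd q)))
  - slice_lapse a q * dt ^ 2 * (partial a Tm (fun q => slice_lapse a q * T q) q
     + sumL (fun i => Z i q * a i (snd q)) + sumL (fun i => fst q i * A i (snd q))).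
Proof.
unfold interval_variation, Defs.differential, slice_lapse; cbv zeta beta.
unfold sumL; ring.
Qed.

(** The Killing equation of the Fermi-Walker metric, split into space-space, space-time and
    time-time parts, with V standing for N T and a source xi . A from the change of the
    acceleration. *)
Definition killing (a : path) (Z : Lat -> event -> R) (V : event -> R) (A : path) (q : event) : Prop :=
  (forall i j, partial a (Sp j) (Z i) q = - partial a (Sp i) (Z j) q) /\
  (forall i, partial a Tm (Z i) q = slice_lapse a q * partial a (Sp i) V q - V q * a i (snd q)) /\
  partial a Tm V q = - sumL (fun i => Z i q * a i (snd q)) - sumL (fun i => fst q i * A i (snd q)).

(** A quadratic form in (dx, dt) vanishes iff its coefficients do. They are extracted at (0, 1), at
    (dx, 0) with polarization at e_i + e_j, and at (e_i, 1). *)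
Lemma interval_variation_killing a Z T A q : 0 < slice_lapse a q ->
  (forall dx dt, interval_variation a Z T A q dx dt = 0) <->
  killing a Z (fun q => slice_lapse a q * T q) A q.
Proof.
intro N; split.
- intro H.
  assert (H0 : partial a Tm (fun q => slice_lapse a q * T q) q
     + sumL (fun i => Z i q * a i (snd q)) + sumL (fun i => fst q i * A i (snd q)) = 0).
  { pose proof (H (fun _ => 0) 1) as E; rewrite interval_variationE in E.
    apply (Rmult_eq_reg_l (slice_lapse a q)); [|lra].
    unfold sumL in *; lra. }
  assert (H1 : forall dx, sumL (fun i => sumL (fun j => dx i * dx j * partial a (Sp j) (Z i) q)) = 0).
  { intro dx; pose proof (H dx 0) as E; rewrite interval_variationE in E; lra. }
  assert (Hd : forall i, partial a (Sp i) (Z i) q = 0).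
  { intro i; pose proof (H1 (deltaL i)) as E; unfold sumL in E; destruct i; simpl in E; lra. }
  split; [|split].
  + intros i j.
    pose proof (H1 (fun k => deltaL i k + deltaL j k)) as E; unfold sumL in E.
    pose proof (Hd x1); pose proof (Hd x2); pose proof (Hd x3).
    destruct i, j; simpl in E; lra.
  + intro i; pose proof (H (deltaL i) 1) as E; rewrite interval_variationE in E.
    rewrite H0, H1 in E; unfold sumL in E; destruct i; simpl in E; lra.
  + lra.
- intros [H1 [H2 H3]] dx dt; rewrite interval_variationE, H3.
  rewrite (sumL_ext (fun i => dx i * (_ - _ + _)) (fun _ => 0)) by (intro; rewrite H2; ring).
  assert (E : sumL (fun i => sumL (fun j => dx i * dx j * partial a (Sp j) (Z i) q)) = 0); [|rewrite E; unfold sumL; ring].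
  pose proof (H1 x1 x1); pose proof (H1 x2 x2); pose proof (H1 x3 x3).
  assert (E1 : partial a (Sp x1) (Z x1) q = 0) by lra.
  assert (E2 : partial a (Sp x2) (Z x2) q = 0) by lra.
  assert (E3 : partial a (Sp x3) (Z x3) q = 0) by lra.
  unfold sumL; rewrite E1, E2, E3, (H1 x1 x2), (H1 x1 x3), (H1 x2 x3); ring.
Qed.

Section Slice.
Context (a : path) (Ha : C0path a).
Notation lapse_a := (slice_lapse a).

Lemma inM_at_acc q : inM (at_acc a q) <-> 0 < lapse_a q.
Proof. split; [now intros [_ H]|intro H; split; [exact Ha|exact H]]. Qed.

Lemma is_derive_partial_Sp F x t j : C1_slice a F -> 0 < lapse_a (x, t) ->
  is_derive (fun s => F (fun i => x i + s * deltaL j i, t)) 0 (partial a (Sp j) F (x, t)).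
Proof.
intros HF Hq; destruct (HF (x, t) (proj2 (inM_at_acc _) Hq) (Sp j)) as [H _].
apply (is_derive_ext_R (fun s => lift F (move (at_acc a (x, t)) (dir (Fcoord (Sp j))) s))).
- intro s; unfold lift; simpl; do 2 f_equal; ring.
- now apply Derive_correct.
Qed.

Lemma is_derive_partial_Tm F x t : C1_slice a F -> 0 < lapse_a (x, t) ->
  is_derive (fun s => F (x, s)) t (partial a Tm F (x, t)).
Proof.
intros HF Hq; destruct (HF (x, t) (proj2 (inM_at_acc _) Hq) Tm) as [H _].
apply is_derive_shift.
apply (is_derive_ext_R (fun s => lift F (move (at_acc a (x, t)) (dir (Fcoord Tm)) s))).
- intro s; unfold lift; simpl; do 2 f_equal; [apply functional_extensionality; intro|]; ring.
- now apply Derive_correct.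
Qed.

Lemma lapse_near_2d x t w k : 0 < lapse_a (x, t) ->
  locally_2d (fun h u => 0 < lapse_a (fun i => x i + h * w i + u * deltaL k i, t)) 0 0.
Proof.
intro Hq; pose (v := mkPoint w 0 (fun _ _ => 0)).
assert (Hv : C0path (acc v)) by (intros i s; apply continuous_const_R).
pose proof (inM_near_2d (at_acc a (x, t)) v (dir (Fcoord (Sp k))) (proj2 (inM_at_acc _) Hq) Hv
  (frame_ok_C0 (Fcoord (Sp k)) I)) as H.
destruct H as [d H]; exists d; intros h u Hh Hu; apply (proj1 (inM_at_acc _)).
replace (at_acc a (fun i => x i + h * w i + u * deltaL k i, t)) with
  (move (move (at_acc a (x, t)) v h) (dir (Fcoord (Sp k))) u); [now apply H|].
apply point_eq; intros; simpl; ring.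
Qed.

Lemma partial_continuity_2d F x t w k : C1_slice a F -> 0 < lapse_a (x, t) ->
  continuity_2d_pt (fun h u => partial a (Sp k) F (fun i => x i + h * w i + u * deltaL k i, t)) 0 0.
Proof.
intros HF Hq; destruct (HF (x, t) (proj2 (inM_at_acc _) Hq) (Sp k)) as [_ H]; intro e.
destruct (proj1 (filterlim_locally _ _) H e) as [d Hd].
(* This m makes every component of the displacement h w + u e_k at most max(|h|, |u|) m. *)
set (m := 1 + Rabs (w x1) + Rabs (w x2) + Rabs (w x3)).
assert (Pw : forall i, Rabs (w i) + 1 <= m).
{ intro i; unfold m; pose proof (Rabs_pos (w x1)); pose proof (Rabs_pos (w x2));
    pose proof (Rabs_pos (w x3)); destruct i; lra. }
assert (Pm : 0 < m) by (pose proof (Pw x1); pose proof (Rabs_pos (w x1)); lra).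
assert (Pd : 0 < d / m) by (apply Rdiv_lt_0_compat; [apply cond_pos|exact Pm]).
exists (mkposreal _ Pd); intros h u Hh Hu; simpl in Hh, Hu.
rewrite Rminus_0_r in Hh, Hu.
replace (fun i => x i + 0 * w i + 0 * deltaL k i) with x
  by (apply functional_extensionality; intro; ring).
apply Hd; split; [|apply ball_center].
intro i; change (Rabs (x i + h * w i + u * deltaL k i - x i) < d).
replace (x i + h * w i + u * deltaL k i - x i) with (h * w i + u * deltaL k i) by ring.
eapply Rle_lt_trans; [apply Rabs_triang|]; rewrite !Rabs_mult.
assert (Rabs (deltaL k i) <= 1) by (destruct k, i; simpl; rewrite ?Rabs_R0, ?Rabs_R1; lra).
apply Rle_lt_trans with (Rmax (Rabs h) (Rabs u) * m).
- pose proof (Rmax_l (Rabs h) (Rabs u)); pose proof (Rmax_r (Rabs h) (Rabs u)).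
  pose proof (Rabs_pos h); pose proof (Rabs_pos u); pose proof (Rabs_pos (w i)); pose proof (Pw i).
  pose proof (Rabs_pos (deltaL k i)).
  assert (Rabs h * Rabs (w i) <= Rmax (Rabs h) (Rabs u) * Rabs (w i)) by (apply Rmult_le_compat_r; lra).
  assert (Rabs u * Rabs (deltaL k i) <= Rmax (Rabs h) (Rabs u) * 1) by (apply Rmult_le_compat; lra).
  assert (Rmax (Rabs h) (Rabs u) * (Rabs (w i) + 1) <= Rmax (Rabs h) (Rabs u) * m)
    by (apply Rmult_le_compat_l; lra).
  lra.
- apply (Rmult_lt_reg_r (/ m)); [now apply Rinv_0_lt_compat|].
  rewrite Rmult_assoc, Rinv_r, Rmult_1_r by lra; now apply Rmax_lub_lt.
Qed.

(** By the mean value theorem in the second variable the increment is h c [dg h y] with y between 0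
    and h c, and continuity of [dg] concludes. No differentiability of g in h is required. *)
Lemma is_derive_increment (g dg : R -> R -> R) c :
  locally_2d (fun h u => is_derive (g h) u (dg h u)) 0 0 -> continuity_2d_pt dg 0 0 ->
  is_derive (fun h => g h (h * c) - g h 0) 0 (c * dg 0 0).
Proof.
intros [d Hd] Hc; apply is_derive_Reals; intros e He.
assert (Pc : 0 < Rabs c + 1) by (pose proof (Rabs_pos c); lra).
assert (Pe : 0 < e / (Rabs c + 1)) by now apply Rdiv_lt_0_compat.
destruct (Hc (mkposreal _ Pe)) as [d' Hd'].
set (r := Rmin d d'); assert (Pr : 0 < r) by (apply Rmin_glb_lt; apply cond_pos).
assert (Pk : 0 < r / (Rabs c + 1)) by now apply Rdiv_lt_0_compat.
exists (mkposreal _ Pk); intros h Hh0 Hh; simpl in Hh.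
rewrite !Rplus_0_l, Rmult_0_l, Rminus_diag, Rminus_0_r.
assert (Hhr : Rabs h * (Rabs c + 1) < r).
{ apply (Rmult_lt_compat_r (Rabs c + 1)) in Hh; [|exact Pc].
  replace (r / (Rabs c + 1) * (Rabs c + 1)) with r in Hh by (field; lra); exact Hh. }
assert (Hh1 : Rabs h < r) by (pose proof (Rabs_pos h); pose proof (Rabs_pos c); nra).
assert (Hu : forall u, Rmin 0 (h * c) <= u <= Rmax 0 (h * c) -> Rabs u < r).
{ intros u Hu; apply Rle_lt_trans with (Rabs (h * c)).
  - unfold Rmin, Rmax in Hu; destruct (Rle_dec 0 (h * c)).
    + rewrite !Rabs_right by lra; lra.
    + rewrite !Rabs_left1 by lra; lra.
  - rewrite Rabs_mult; pose proof (Rabs_pos h); pose proof (Rabs_pos c); nra. }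
assert (Hr1 : r <= d) by apply Rmin_l; assert (Hr2 : r <= d') by apply Rmin_r.
assert (HD : forall u, Rmin 0 (h * c) <= u <= Rmax 0 (h * c) -> is_derive (g h) u (dg h u)).
{ intros u Hu'; specialize (Hu u Hu'); apply Hd; rewrite Rminus_0_r; lra. }
destruct (MVT_gen (g h) 0 (h * c) (dg h)) as [y [Hy E]].
- intros u Hu'; apply HD; lra.
- intros u Hu'; apply continuity_pt_filterlim, (is_derive_cont _ _ _ (HD u Hu')).
- rewrite E.
  replace (dg h y * (h * c - 0) / h - c * dg 0 0) with (c * (dg h y - dg 0 0)) by (field; exact Hh0).
  specialize (Hu y Hy).
  assert (H : Rabs (dg h y - dg 0 0) < e / (Rabs c + 1))
    by (apply Hd'; rewrite Rminus_0_r; lra).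
  rewrite Rabs_mult.
  apply (Rmult_lt_compat_r (Rabs c + 1)) in H; [|exact Pc].
  replace (e / (Rabs c + 1) * (Rabs c + 1)) with e in H by (field; lra).
  pose proof (Rabs_pos (dg h y - dg 0 0)); pose proof (Rabs_pos c); nra.
Qed.

Lemma is_derive_axis F x t w k c : C1_slice a F -> 0 < lapse_a (x, t) ->
  is_derive (fun h => F (fun i => x i + h * w i + h * c * deltaL k i, t)
                    - F (fun i => x i + h * w i, t)) 0 (c * partial a (Sp k) F (x, t)).
Proof.
intros HF Hq.
pose (g h u := F (fun i => x i + h * w i + u * deltaL k i, t)).
pose (dg h u := partial a (Sp k) F (fun i => x i + h * w i + u * deltaL k i, t)).
apply (is_derive_ext_R (fun h => g h (h * c) - g h 0)).
- intro h; unfold g; f_equal; do 3 f_equal; apply functional_extensionality; intro; ring.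
- replace (partial a (Sp k) F (x, t)) with (dg 0 0).
  + apply is_derive_increment; [|now apply partial_continuity_2d].
    apply (locally_2d_impl (fun h u => 0 < lapse_a (fun i => x i + h * w i + u * deltaL k i, t)));
      [|now apply lapse_near_2d].
    apply locally_2d_forall; intros h u Hhu; apply is_derive_shift.
    apply (is_derive_ext_R (fun s => F (fun i => (x i + h * w i + u * deltaL k i) + s * deltaL k i, t))).
    * intro s; unfold g; do 2 f_equal; apply functional_extensionality; intro; ring.
    * now apply is_derive_partial_Sp.
  + unfold dg; do 2 f_equal; apply functional_extensionality; intro; ring.
Qed.

(** Continuous partial derivatives give directional derivatives: the increment telescopes along a
    staircase of three axis-parallel steps, each treated by [is_derive_axis]. *)
Lemma is_derive_directional F x t v : C1_slice a F -> 0 < lapse_a (x, t) ->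
  is_derive (fun h => F (fun i => x i + h * v i, t)) 0
    (sumL (fun i => v i * partial a (Sp i) F (x, t))).
Proof.
intros HF Hq.
(* The corners of the staircase: [w3] keeps only the third component of v, and [w2] the last two. *)
pose (w2 := fun i => match i with x1 => 0 | _ => v i end).
pose (w3 := fun i => match i with x3 => v i | _ => 0 end).
apply (is_derive_ext_R (fun h =>
  (F (fun i => x i + h * w2 i + h * v x1 * deltaL x1 i, t) - F (fun i => x i + h * w2 i, t)) +
  (F (fun i => x i + h * w3 i + h * v x2 * deltaL x2 i, t) - F (fun i => x i + h * w3 i, t)) +
  (F (fun i => x i + h * 0 + h * v x3 * deltaL x3 i, t) - F (fun i => x i + h * 0, t)) + F (x, t))).
- intro h.
  replace (fun i => x i + h * w2 i + h * v x1 * deltaL x1 i) with (fun i => x i + h * v i)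
    by (apply functional_extensionality; intros []; unfold w2; simpl; ring).
  replace (fun i => x i + h * w3 i + h * v x2 * deltaL x2 i) with (fun i => x i + h * w2 i)
    by (apply functional_extensionality; intros []; unfold w2, w3; simpl; ring).
  replace (fun i => x i + h * 0 + h * v x3 * deltaL x3 i) with (fun i => x i + h * w3 i)
    by (apply functional_extensionality; intros []; unfold w3; simpl; ring).
  replace (fun i => x i + h * 0) with x by (apply functional_extensionality; intro; ring).
  ring.
- eapply is_derive_eq.
  + exact (is_derive_plus_R _ _ _ _ _ (is_derive_plus_R _ _ _ _ _ (is_derive_plus_R _ _ _ _ _
      (is_derive_axis F x t w2 x1 (v x1) HF Hq) (is_derive_axis F x t w3 x2 (v x2) HF Hq))
      (is_derive_axis F x t (fun _ => 0) x3 (v x3) HF Hq)) (is_derive_const_R (F (x, t)) 0)).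
  + unfold sumL; simpl; ring.
Qed.

Lemma is_derive_segment F y v t s : C1_slice a F -> 0 < lapse_a (fun i => y i + s * v i, t) ->
  is_derive (fun s => F (fun i => y i + s * v i, t)) s
    (sumL (fun i => v i * partial a (Sp i) F (fun i => y i + s * v i, t))).
Proof.
intros HF Hq; apply is_derive_shift.
apply (is_derive_ext_R (fun h => F (fun i => (y i + s * v i) + h * v i, t))).
- intro h; do 2 f_equal; apply functional_extensionality; intro; ring.
- now apply is_derive_directional.
Qed.

(** At a fixed time the domain is a half-space of the xi-space, hence convex. *)
Lemma lapse_segment x y t s : 0 < lapse_a (x, t) -> 0 < lapse_a (y, t) -> 0 <= s <= 1 ->
  0 < lapse_a (fun i => y i + s * (x i - y i), t).
Proof.
rewrite !slice_lapseE; intros Hx Hy Hs.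
replace (1 + sumL (fun i => (y i + s * (x i - y i)) * a i t)) with
 ((1 - s) * (1 + sumL (fun i => y i * a i t)) + s * (1 + sumL (fun i => x i * a i t)))
  by (unfold sumL; ring).
destruct (Req_dec s 0) as [->|]; nra.
Qed.

Lemma lapse_origin t : lapse_a (fun _ => 0, t) = 1.
Proof. rewrite slice_lapseE; unfold sumL; ring. Qed.

Lemma lapse_near_t x t : 0 < lapse_a (x, t) -> locally t (fun s => 0 < lapse_a (x, s)).
Proof.
intro H.
assert (C : continuous (fun s => lapse_a (x, s)) t).
{ apply (continuous_ext (fun s => 1 + sumL (fun i => x i * a i s))); [intro; reflexivity|].
  apply continuous_plus_R; [apply continuous_const_R|].
  apply (continuous_sumL (fun i s => x i * a i s)); intro i.
  apply continuous_mult_R; [apply continuous_const_R|apply Ha]. }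
apply C; apply (open_gt 0 _ H).
Qed.

(** * Solutions of the Killing equation *)

Section Killing.
Context (Z : Lat -> event -> R) (V : event -> R) (A : path)
  (CZ : forall i, C1_slice a (Z i)) (CV : C1_slice a V)
  (HK : forall q, 0 < lapse_a q -> killing a Z V A q).

(** The only possible affine coefficients: values and gradients of Z and V on the origin worldline,
    which lies in the domain because the lapse is 1 there. *)
Let O : Lat -> R := fun _ => 0.
Let e (r : R) (j i : Lat) : R := r * deltaL j i.
Let b i t := Z i (O, t).
Let V0 t := V (O, t).
Let om i j t := partial a (Sp j) (Z i) (O, t).
Let v i t := partial a (Sp i) V (O, t).

Let lapse_O t : 0 < lapse_a (O, t).
Proof. unfold O; rewrite lapse_origin; lra. Qed.

Let om_antisym i j t : om i j t = - om j i t.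
Proof. apply (HK (O, t)), lapse_O. Qed.

(** At the points r e_j on the axes the linear coefficients of Z and V can be read off by difference
    with the origin. *)
Let exists_radius t : exists r, 0 < r /\ forall j, 0 < lapse_a (e r j, t).
Proof.
set (m := 1 + Rabs (a x1 t) + Rabs (a x2 t) + Rabs (a x3 t)).
assert (Pw : forall i, Rabs (a i t) + 1 <= m).
{ intro i; unfold m; pose proof (Rabs_pos (a x1 t)); pose proof (Rabs_pos (a x2 t));
    pose proof (Rabs_pos (a x3 t)); destruct i; lra. }
assert (Pm : 0 < m) by (pose proof (Pw x1); pose proof (Rabs_pos (a x1 t)); lra).
exists (/ m); split; [now apply Rinv_0_lt_compat|]; intro j.
replace (lapse_a (e (/ m) j, t)) with (/ m * (m + a j t)).
- apply Rmult_lt_0_compat; [now apply Rinv_0_lt_compat|].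
  pose proof (Pw j); pose proof (Rle_abs (- a j t)) as Hj; rewrite Rabs_Ropp in Hj; lra.
- rewrite slice_lapseE; unfold e, sumL; destruct j; simpl; field; lra.
Qed.

(** Along the segment from y to x, the derivative of Z . (x - y) is the symmetric part of the
    gradient of Z evaluated on x - y, and it vanishes by the Killing equation. Only first
    derivatives of Z enter. *)
Let monotone x y t : 0 < lapse_a (x, t) -> 0 < lapse_a (y, t) ->
  sumL (fun i => (Z i (x, t) - Z i (y, t)) * (x i - y i)) = 0.
Proof.
intros Hx Hy.
pose (f s := sumL (fun i => Z i (fun k => y k + s * (x k - y k), t) * (x i - y i))).
assert (E : f 0 = f 1).
{ apply (eq_is_derive (V := R_NormedModule) f); [|lra]; intros s Hs.
  assert (Hq := lapse_segment x y t s Hx Hy Hs).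
  eapply is_derive_eq.
  - apply (is_derive_sumL (fun i s => Z i (fun k => y k + s * (x k - y k), t) * (x i - y i))); intro i.
    apply is_derive_mult_R; [|apply is_derive_const_R].
    apply (is_derive_segment (Z i) y (fun k => x k - y k) t s (CZ i) Hq).
  - destruct (HK _ Hq) as [H _].
    pose proof (H x1 x1) as H1; pose proof (H x2 x2) as H2; pose proof (H x3 x3) as H3.
    set (q := (fun i => y i + s * (x i - y i), t) : event) in *.
    assert (E1 : partial a (Sp x1) (Z x1) q = 0) by lra.
    assert (E2 : partial a (Sp x2) (Z x2) q = 0) by lra.
    assert (E3 : partial a (Sp x3) (Z x3) q = 0) by lra.
    unfold sumL; rewrite E1, E2, E3, (H x1 x2), (H x1 x3), (H x2 x3).
    change (@zero R_NormedModule) with 0; ring. }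
transitivity (f 1 - f 0); [|lra]; unfold f.
replace (fun k => y k + 1 * (x k - y k)) with x by (apply functional_extensionality; intro; ring).
replace (fun k => y k + 0 * (x k - y k)) with y by (apply functional_extensionality; intro; ring).
unfold sumL; ring.
Qed.

(* Antisymmetry of the bilinear form (Z(x) - Z(0)) . y forces Z to be affine. *)
Lemma killing_Z_affine x t i : 0 < lapse_a (x, t) ->
  Z i (x, t) = b i t + sumL (fun k => om i k t * x k).
Proof.
destruct (exists_radius t) as [r [Pr Hr]].
pose (g i x := Z i (x, t) - b i t).
assert (A0 : forall x, 0 < lapse_a (x, t) -> sumL (fun i => g i x * x i) = 0).
{ intros y Hy; pose proof (monotone y O t Hy (lapse_O t)) as E; rewrite <- E.
  unfold g, b, O, sumL; ring. }
(* Polarization: in [monotone] at the two points the diagonal terms vanish by [A0]. *)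
assert (A1 : forall x y, 0 < lapse_a (x, t) -> 0 < lapse_a (y, t) ->
  sumL (fun i => g i x * y i) = - sumL (fun i => g i y * x i)).
{ intros y z Hy Hz; pose proof (monotone y z t Hy Hz) as E.
  pose proof (A0 y Hy) as E1; pose proof (A0 z Hz) as E2.
  unfold g, sumL in *; lra. }
(* [A1] against the fixed point r e_j expresses g_j(y) linearly in y, with these coefficients. *)
pose (c i k := - (g k (e r i) / r)).
assert (L : forall x i, 0 < lapse_a (x, t) -> Z i (x, t) = b i t + sumL (fun k => c i k * x k)).
{ intros y j Hy; pose proof (A1 y (e r j) Hy (Hr j)) as E.
  assert (E' : g j y * r = - sumL (fun i => g i (e r j) * y i)).
  { rewrite <- E; unfold e, sumL; destruct j; simpl; ring. }
  assert (E2 : g j y = sumL (fun k => c j k * y k)); [|unfold g in E2; lra].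
  apply (Rmult_eq_reg_r r); [|lra]; rewrite E'; unfold c, sumL; field; lra. }
(* The dependence of c on r is only apparent: differentiating the affine formula at the origin
   identifies c with the gradient there. *)
assert (C : forall i k, om i k t = c i k).
{ intros j k.
  assert (D := is_derive_partial_Sp (Z j) O t k (CZ j) (lapse_O t)).
  assert (D' : is_derive (fun s => Z j (fun i => O i + s * deltaL k i, t)) 0 (c j k)).
  { apply (is_derive_ext_loc_R (fun s => b j t + s * c j k)).
    - destruct (lapse_near_2d O t O k (lapse_O t)) as [d Hd]; exists d; intros s Hs.
      rewrite L.
      + unfold O, sumL; destruct k; simpl; ring.
      + replace (fun i => O i + s * deltaL k i) with (fun i => O i + 0 * O i + s * deltaL k i)
          by (apply functional_extensionality; intro; ring).
        apply Hd; [rewrite Rminus_diag, Rabs_R0; apply cond_pos|exact Hs].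
    - auto_derive; [exact I|ring]. }
  exact (eq_trans (eq_sym (is_derive_unique _ _ _ D)) (is_derive_unique _ _ _ D')). }
intro Hx; rewrite (L x i Hx); f_equal; apply sumL_ext; intro k; now rewrite C.
Qed.

Lemma killing_b' i t : is_derive (b i) t (v i t - V0 t * a i t).
Proof.
destruct (HK (O, t) (lapse_O t)) as [_ [H _]].
eapply is_derive_eq; [apply (is_derive_partial_Tm (Z i) O t (CZ i) (lapse_O t))|].
rewrite H; unfold O; rewrite lapse_origin; unfold v, V0, O; simpl; ring.
Qed.

(** On the ray s x, antisymmetry of [om] gives x . Z(s x, t) = x . b(t), so that [om], not yet known
    to be differentiable in time, drops out. Differentiating both sides in time, by the mixed
    Killing equation on the left and by [killing_b'] on the right, gives a linear first-order
    equation in s for V, of which V0 + s (v . x) is a solution. *)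
Lemma killing_V_affine x t : 0 < lapse_a (x, t) ->
  V (x, t) = V0 t + sumL (fun i => v i t * x i).
Proof.
intro Hx.
pose (y s := fun i : Lat => O i + s * x i).
assert (Hy : forall s, 0 <= s <= 1 -> 0 < lapse_a (y s, t)).
{ intros s Hs; pose proof (lapse_segment x O t s Hx (lapse_O t) Hs) as H.
  replace (y s) with (fun i => O i + s * (x i - O i)); [exact H|].
  apply functional_extensionality; intro; unfold y, O; ring. }
pose (al := sumL (fun i => x i * a i t)).
assert (N : forall s, lapse_a (y s, t) = 1 + s * al).
{ intro s; rewrite slice_lapseE; unfold y, O, al, sumL; ring. }
pose (vx := sumL (fun i => v i t * x i)).
pose (D s := V (y s, t) - V0 t - s * vx).
pose (V' s := sumL (fun i => x i * partial a (Sp i) V (y s, t))).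
assert (DV : forall s, 0 <= s <= 1 -> is_derive (fun s => V (y s, t)) s (V' s)).
{ intros s Hs; apply (is_derive_segment V O x t s CV (Hy s Hs)). }
assert (ODE : forall s, 0 <= s <= 1 -> (1 + s * al) * V' s - V (y s, t) * al = vx - V0 t * al).
{ intros s Hs; destruct (HK _ (Hy s Hs)) as [_ [H _]].
  assert (D1 : is_derive (fun t' => sumL (fun i => x i * Z i (y s, t'))) t
    (sumL (fun i => x i * partial a Tm (Z i) (y s, t)))).
  { apply (is_derive_sumL (fun i t' => x i * Z i (y s, t'))); intro i; apply is_derive_scal_R.
    apply is_derive_partial_Tm; auto. }
  assert (D2 : is_derive (fun t' => sumL (fun i => x i * Z i (y s, t'))) t
    (sumL (fun i => x i * (v i t - V0 t * a i t)))).
  { apply (is_derive_ext_loc_R (fun t' => sumL (fun i => x i * b i t'))).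
    - generalize (lapse_near_t (y s) t (Hy s Hs)); apply filter_imp; intros t' Ht'.
      symmetry; transitivity (sumL (fun i => x i * (b i t' + sumL (fun k => om i k t' * y s k)))).
      { apply sumL_ext; intro i; now rewrite killing_Z_affine. }
      pose proof (om_antisym x1 x1 t'); pose proof (om_antisym x2 x2 t'); pose proof (om_antisym x3 x3 t').
      assert (E1 : om x1 x1 t' = 0) by lra.
      assert (E2 : om x2 x2 t' = 0) by lra.
      assert (E3 : om x3 x3 t' = 0) by lra.
      unfold y, O, sumL.
      rewrite E1, E2, E3, (om_antisym x1 x2), (om_antisym x1 x3), (om_antisym x2 x3).
      ring.
    - apply (is_derive_sumL (fun i t' => x i * b i t')); intro i; apply is_derive_scal_R.
      apply killing_b'. }
  pose proof (eq_trans (eq_sym (is_derive_unique _ _ _ D1)) (is_derive_unique _ _ _ D2)) as E.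
  rewrite (sumL_ext _ (fun i => x i * (lapse_a (y s, t) * partial a (Sp i) V (y s, t)
     - V (y s, t) * a i t))) in E by (intro i; f_equal; apply H).
  rewrite N in E; unfold V', vx, al, sumL in *; lra. }
(* The deviation D solves the homogeneous equation (1 + s al) D' = al D, whose solutions are
   multiples of the lapse 1 + s al; since D 0 = 0, the deviation vanishes. *)
assert (E : D 0 / (1 + 0 * al) = D 1 / (1 + 1 * al)).
{ apply (eq_is_derive (V := R_NormedModule) (fun s => D s / (1 + s * al))); [|lra].
  intros s Hs; pose proof (Hy s Hs) as P; rewrite N in P.
  assert (DD : is_derive D s (V' s - vx)).
  { unfold D; eapply is_derive_eq.
    - apply is_derive_minus_R; [apply is_derive_minus_R; [now apply DV|apply is_derive_const_R]|].
      apply is_derive_mult_R; [apply is_derive_id|apply is_derive_const_R].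
    - simpl; change (@one R_AbsRing) with 1; ring. }
  assert (DN : is_derive (fun s => 1 + s * al) s al) by (auto_derive; [exact I|ring]).
  assert (P0 : 1 + s * al <> 0) by lra.
  eapply is_derive_eq; [exact (is_derive_div D _ s _ _ DD DN P0)|].
  change (@zero R_NormedModule) with 0.
  apply (Rmult_eq_reg_r ((1 + s * al) ^ 2)); [|apply pow_nonzero, P0].
  rewrite Rmult_0_l; transitivity ((V' s - vx) * (1 + s * al) - D s * al); [field; exact P0|].
  pose proof (ODE s Hs); unfold D; lra. }
assert (P1 : 1 + 1 * al <> 0) by (pose proof (Hy 1 ltac:(lra)) as P; rewrite N in P; lra).
assert (E0 : D 0 = 0).
{ unfold D, V0; replace (y 0) with O; [ring|].
  apply functional_extensionality; intro; unfold y, O; ring. }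
rewrite E0 in E; unfold Rdiv in E; rewrite Rmult_0_l in E; symmetry in E.
apply Rmult_integral in E; destruct E as [E|E]; [|now apply Rinv_neq_0_compat in E].
unfold D in E; replace (y 1) with x in E; [unfold vx in E; lra|].
apply functional_extensionality; intro; unfold y, O; ring.
Qed.

Lemma killing_dV x t i : 0 < lapse_a (x, t) -> partial a (Sp i) V (x, t) = v i t.
Proof.
intro Hx.
assert (D := is_derive_partial_Sp V x t i CV Hx).
assert (D' : is_derive (fun s => V (fun k => x k + s * deltaL i k, t)) 0 (v i t)).
{ apply (is_derive_ext_loc_R (fun s => V (x, t) + s * v i t)).
  - destruct (lapse_near_2d x t O i Hx) as [d Hd]; exists d; intros s Hs.
    rewrite !killing_V_affine; auto.
    + unfold sumL; destruct i; simpl; ring.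
    + replace (fun k => x k + s * deltaL i k) with (fun k => x k + 0 * O k + s * deltaL i k)
        by (apply functional_extensionality; intro; ring).
      apply Hd; [rewrite Rminus_diag, Rabs_R0; apply cond_pos|exact Hs].
  - auto_derive; [exact I|ring]. }
exact (eq_trans (eq_sym (is_derive_unique _ _ _ D)) (is_derive_unique _ _ _ D')).
Qed.

(** Near t, [om i j] is the difference quotient of [Z i] between r e_j and the origin, with r fixed
    at time t, so it inherits its time derivative from Z. *)
Lemma killing_om' i j t : is_derive (om i j) t (v i t * a j t - v j t * a i t).
Proof.
destruct (exists_radius t) as [r [Pr Hr]].
apply (is_derive_ext_loc_R (fun s => / r * (Z i (e r j, s) - b i s))).
- generalize (lapse_near_t _ _ (Hr j)); apply filter_imp; intros s Hs.
  rewrite killing_Z_affine by exact Hs; unfold e, sumL; destruct j; simpl; field; lra.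
- eapply is_derive_eq.
  + apply is_derive_scal_R, is_derive_minus_R; [apply is_derive_partial_Tm; auto|apply killing_b'].
  + destruct (HK _ (Hr j)) as [_ [H _]]; rewrite H, killing_dV, killing_V_affine, slice_lapseE by auto.
    unfold e, sumL; destruct j; simpl; field; lra.
Qed.

Lemma killing_V0' t : is_derive V0 t (- sumL (fun i => b i t * a i t)).
Proof.
destruct (HK (O, t) (lapse_O t)) as [_ [_ H]].
eapply is_derive_eq; [apply (is_derive_partial_Tm V O t CV (lapse_O t))|].
etransitivity; [exact H|]; unfold b, O, sumL; simpl; ring.
Qed.

Lemma killing_v' i t : is_derive (v i) t (- sumL (fun k => om k i t * a k t) - A i t).
Proof.
destruct (exists_radius t) as [r [Pr Hr]].
apply (is_derive_ext_loc_R (fun s => / r * (V (e r i, s) - V0 s))).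
- generalize (lapse_near_t _ _ (Hr i)); apply filter_imp; intros s Hs.
  rewrite killing_V_affine by exact Hs; unfold e, sumL; destruct i; simpl; field; lra.
- eapply is_derive_eq.
  + apply is_derive_scal_R, is_derive_minus_R; [apply is_derive_partial_Tm; auto|apply killing_V0'].
  + destruct (HK _ (Hr i)) as [_ [_ H]]; rewrite H.
    unfold sumL; rewrite !killing_Z_affine by auto.
    unfold e, sumL; destruct i; simpl; field; lra.
Qed.

Lemma killing_solution : exists (b : Lat -> R -> R) (V0 : R -> R) (om : Lat -> Lat -> R -> R)
    (v : Lat -> R -> R),
  (forall x t, 0 < lapse_a (x, t) ->
     (forall i, Z i (x, t) = b i t + sumL (fun k => om i k t * x k)) /\
     V (x, t) = V0 t + sumL (fun i => v i t * x i)) /\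
  (forall i j t, om i j t = - om j i t) /\
  (forall i t, is_derive (b i) t (v i t - V0 t * a i t)) /\
  (forall t, is_derive V0 t (- sumL (fun i => b i t * a i t))) /\
  (forall i j t, is_derive (om i j) t (v i t * a j t - v j t * a i t)) /\
  (forall i t, is_derive (v i) t (- sumL (fun k => om k i t * a k t) - A i t)).
Proof.
exists b, V0, om, v; split; [|split; [|split; [|split; [|split]]]];
  auto using killing_b', killing_V0', killing_om', killing_v'.
intros x t Hx; split; [intro|]; auto using killing_Z_affine, killing_V_affine.
Qed.

End Killing.
End Slice.

Lemma eta_sym mu nu : eta mu nu = eta nu mu.
Proof. destruct mu as [[]|], nu as [[]|]; reflexivity. Qed.

(** * The extension of the Poincare algebra *)

(* The commutator of vector fields is opposite to the commutator of the matrices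
   by which they act on (x^mu, 1), whence the sign. *)
Definition param_br (th th' : param) : param :=
  (opp (poincare_br (fst th) (fst th')), zero).

Lemma param_br_is_lie : is_lie_bracket param_br.
Proof.
assert (par_f_opp : forall (v : poincare_space) mu, par_f (opp v : poincare_space) mu = - par_f v mu) by reflexivity.
assert (par_Om_opp : forall (v : poincare_space) mu nu, par_Om (opp v : poincare_space) mu nu = - par_Om v mu nu) by reflexivity.
assert (fst_plus : forall u v : param, fst (plus u v) = plus (fst u) (fst v)) by reflexivity.
assert (fst_scal : forall (r : R_Ring) (v : param), fst (scal r v) = scal r (fst v)) by reflexivity.
assert (fst_br : forall u v, fst (param_br u v) = opp (poincare_br (fst u) (fst v))) by reflexivity.
assert (Z2 : @zero C0paths = plus zero zero) by (symmetry; apply plus_zero_r).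
assert (Zs : forall r : R_Ring, @zero C0paths = scal r zero) by (intro; symmetry; apply scal_zero_r).
assert (C : forall u v : param, fst u = fst v -> snd u = snd v -> u = v)
  by (intros [? ?] [? ?]; simpl; intros; subst; reflexivity).
assert (Z3 : plus (plus (@zero C0paths) zero) zero = zero) by now rewrite !plus_zero_r.
split; [|split; [|split; [|split; [|split]]]]; intros;
  (apply C; [|first [exact Z2|exact (Zs r)|reflexivity|exact Z3]]);
  rewrite ?fst_plus, ?fst_scal, ?fst_br; apply poincare_eq; intros;
  repeat (repeat rewrite ?par_f_opp, ?par_Om_opp, ?fst_plus, ?fst_scal, ?fst_br,
            ?par_f_plus, ?par_f_scal, ?par_f_zero, ?par_f_br,
            ?par_Om_plus, ?par_Om_scal, ?par_Om_zero, ?par_Om_br;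
          unfold poincare_br_f, poincare_br_Om, tens_mul; rewrite ?tens_actE;
          unfold sumL); ring.
Qed.

(** The sign undoes that of [param_br]: - (- [u, v]) = [- u, - v]. *)
Definition param_proj (th : mkLie param_br_is_lie) : poincare := opp (fst th).

Lemma param_br_extension : is_abelian_extension param_proj.
Proof.
assert (par_f_opp : forall (v : poincare_space) mu, par_f (opp v : poincare_space) mu = - par_f v mu)
  by reflexivity.
assert (par_Om_opp : forall (v : poincare_space) mu nu,
  par_Om (opp v : poincare_space) mu nu = - par_Om v mu nu) by reflexivity.
assert (proj_zero : forall u, param_proj u = zero -> fst u = zero).
{ intros u Hu; rewrite <- (opp_opp (fst u)); unfold param_proj in Hu; rewrite Hu.
  apply (opp_zero (G := poincare_space)). }
split; [|split; [|split; [|split]]].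
- intros u v; exact (opp_plus (G := poincare_space) (fst u) (fst v)).
- intros r u; unfold param_proj; symmetry; exact (scal_opp_r (V := poincare_space) r (fst u)).
- intros u v; apply poincare_eq; intros.
  + change (- - poincare_br_f (fst u) (fst v) mu = poincare_br_f (opp (fst u)) (opp (fst v)) mu).
    unfold poincare_br_f, tens_act, sumG, sumL; rewrite !par_f_opp, !par_Om_opp; ring.
  + change (- - poincare_br_Om (fst u) (fst v) mu nu = poincare_br_Om (opp (fst u)) (opp (fst v)) mu nu).
    unfold poincare_br_Om, tens_mul, tens_act, sumG, sumL; rewrite !par_Om_opp; ring.
- intro w; exists (opp (w : poincare_space), zero); apply (opp_opp (G := poincare_space)).
- intros u v Hu Hv; apply proj_zero in Hu; apply proj_zero in Hv.
  change (param_br u v = zero); unfold param_br; rewrite Hu, Hv.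
  apply (f_equal (fun x => (x, zero))); apply poincare_eq; intros.
  + change (- poincare_br_f zero zero mu = 0).
    unfold poincare_br_f, tens_act, sumG, sumL; rewrite !par_f_zero, !par_Om_zero; ring.
  + change (- poincare_br_Om zero zero mu nu = 0).
    unfold poincare_br_Om, tens_mul, tens_act, sumG, sumL; rewrite !par_Om_zero; ring.
Qed.

Lemma param_proj_zero th : param_proj th = zero <-> fst th = zero.
Proof.
unfold param_proj; split; intro H.
- rewrite <- (opp_opp (fst th)), H; apply (opp_zero (G := poincare_space)).
- rewrite H; apply (opp_zero (G := poincare_space)).
Qed.

(** * Smoothness of the coordinate functions and continuity on events *)

Lemma frame_op_const E c : frame_op E (fun _ => c) = fun _ => 0.
Proof.
apply functional_extensionality; intro p; rewrite frame_opE; unfold dd.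
rewrite Derive_const; ring.
Qed.

Lemma Ck_const n c : Ck n (fun _ => c).
Proof.
revert c; induction n as [|n IH]; intro c; simpl; [apply fcont_const|].
split; [apply fcont_const|]; intros E HE; split.
- intros p _; exists 0; apply is_derive_const_R.
- rewrite frame_op_const; apply IH.
Qed.

(* The value for [Fcoord Tm] has to vanish because of the weight 1 / lapse. *)
Lemma Ck_of_const_derivative (F : field) (c : frame -> R) : fcont F -> c (Fcoord Tm) = 0 ->
  (forall E p, is_derive (fun s => F (move p (dir E) s)) 0 (c E)) ->
  (forall E, frame_op E F = fun _ => c E) /\ forall n, Ck n F.
Proof.
intros HF H4 Hc.
assert (HE : forall E, frame_op E F = fun _ => c E).
{ intro E; apply functional_extensionality; intro p; rewrite frame_opE.
  replace (dd (dir E) F p) with (c E) by (symmetry; exact (is_derive_unique _ _ _ (Hc E p))).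
  destruct E as [[i|]|i phi]; simpl; rewrite ?H4, ?Rinv_1; ring. }
split; [exact HE|]; intros [|n]; simpl; [exact HF|split; [exact HF|]].
intros E HE'; split; [intros p _; eexists; apply Hc|rewrite HE; apply Ck_const].
Qed.

Definition frame_xi (j : Lat) (E : frame) : R :=
  match E with Fcoord (Sp i) => deltaL i j | _ => 0 end.

Lemma coord_xi_frame j :
  (forall E, frame_op E (coord_xi j) = fun _ => frame_xi j E) /\ forall n, Ck n (coord_xi j).
Proof.
apply Ck_of_const_derivative; [apply fcont_xi|reflexivity|].
intros [[i|]|i phi] p; unfold coord_xi; simpl; auto_derive; auto; ring.
Qed.

Definition frame_acc (j : Lat) (t : R) (E : frame) : R :=
  match E with Facc i phi => deltaL i j * phi t | _ => 0 end.

Lemma coord_acc_frame j t :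
  (forall E, frame_op E (coord_acc j t) = fun _ => frame_acc j t E) /\ forall n, Ck n (coord_acc j t).
Proof.
apply Ck_of_const_derivative; [|reflexivity|].
- intros p v w _ _ _; apply continuity_2d_pt_affine.
- intros [[i|]|i phi] p; unfold coord_acc; simpl; auto_derive; auto; ring.
Qed.

Lemma continuous_ext_loc_R {U : UniformSpace} (f g : U -> R) x :
  locally x (fun y => f y = g y) -> continuous f x -> continuous g x.
Proof. exact (continuous_ext_loc g f x). Qed.

Definition econt (F : event -> R) : Prop := forall q, continuous F q.

Lemma econt_time (f : R -> R) : (forall t, continuous f t) -> econt (fun q => f (snd q)).
Proof. intros H q; apply (continuous_comp snd f); [apply continuous_snd|apply H]. Qed.

Lemma econt_space i : econt (fun q => fst q i).
Proof.
intros [x t]; apply filterlim_locally; intro e; exists e; intros [y s] [H _].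
exact (H i).
Qed.

Lemma econt_plus F G : econt F -> econt G -> econt (fun q => F q + G q).
Proof. intros HF HG q; now apply continuous_plus_R. Qed.

Lemma econt_minus F G : econt F -> econt G -> econt (fun q => F q - G q).
Proof. intros HF HG q; now apply continuous_minus_R. Qed.

Lemma econt_mult F G : econt F -> econt G -> econt (fun q => F q * G q).
Proof. intros HF HG q; now apply continuous_mult_R. Qed.

Lemma econt_const c : econt (fun _ => c).
Proof. intro q; apply continuous_const_R. Qed.

Lemma econt_sumL (F : Lat -> event -> R) : (forall i, econt (F i)) -> econt (fun q => sumL (fun i => F i q)).
Proof. intros HF q; apply (continuous_sumL F); intro i; apply HF. Qed.

Lemma econt_sumG (F : Greek -> event -> R) : (forall i, econt (F i)) -> econt (fun q => sumG (fun i => F i q)).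
Proof. intros HF q; apply (continuous_sumG F); intro i; apply HF. Qed.

Section Tetrad.
Context (Lam : tetrad) (HLam : is_Lambda Lam).
Notation dn := (Lam_dn_up Lam).
Notation kvec := (kvec Lam).
Notation kvec_dn := (kvec_dn Lam).
Notation Pgen := (Pgen Lam).
Notation Jgen := (Jgen Lam).
Notation Dgen := (Dgen Lam).
Notation Xgen := (Xgen Lam).

(** * The Lorentz matrix and its variation *)

Definition sg (mu : Greek) : R := eta mu mu.

Lemma sg_sqr mu : sg mu * sg mu = 1.
Proof. destruct mu as [[]|]; unfold sg; simpl; ring. Qed.

Lemma Lam_dn_upE a t mu nu : Lam_dn_up Lam a t mu nu = sg mu * sg nu * Lam a t mu nu.
Proof.
unfold Lam_dn_up, raise_snd, lower_fst, sg.
destruct mu as [[]|], nu as [[]|]; expand_sums; ring.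
Qed.

Lemma Lam_0 a mu nu : C0path a -> Lam a 0 mu nu = deltaG mu nu.
Proof. intro Ha; apply (HLam a Ha). Qed.

Lemma is_derive_Lam a t mu nu : C0path a ->
  is_derive (fun s => Lam a s mu nu) t (sumG (fun be => Lam a t mu be * Wmat a t be nu)).
Proof. intro Ha; apply (HLam a Ha). Qed.

Lemma dn_0 a mu nu : C0path a -> dn a 0 mu nu = deltaG mu nu.
Proof.
intro Ha; rewrite Lam_dn_upE, Lam_0 by exact Ha.
destruct mu as [[]|], nu as [[]|]; unfold sg; simpl; ring.
Qed.

(** W only couples space with time, so conjugation by eta changes its sign. This is the equation of
    the inverse transpose of Lambda. *)
Lemma is_derive_dn a t mu nu : C0path a ->
  is_derive (fun s => dn a s mu nu) t (- sumG (fun be => Wmat a t nu be * dn a t mu be)).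
Proof.
intro Ha; apply (is_derive_ext_R (fun s => sg mu * sg nu * Lam a s mu nu)).
{ intro; symmetry; apply Lam_dn_upE. }
eapply is_derive_eq; [apply is_derive_scal_R, is_derive_Lam, Ha|].
assert (E : forall be, dn a t mu be = sg mu * sg be * Lam a t mu be) by (intro; apply Lam_dn_upE).
destruct nu as [[]|]; expand_sums; rewrite !E; unfold sg; simpl; ring.
Qed.

Lemma tcont_Lam mu nu : tcont (fun a t => Lam a t mu nu).
Proof. intros a Ha t; eapply is_derive_cont, is_derive_Lam, Ha. Qed.

Lemma tcont_dn mu nu : tcont (fun a t => dn a t mu nu).
Proof. intros a Ha t; eapply is_derive_cont, is_derive_dn, Ha. Qed.

(** The two terms of the derivative are Lambda W Lambda^-1 with opposite signs, so the product keeps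
    its value at 0. *)
Lemma Lorentz_r a t mu nu : C0path a ->
  sumG (fun rho => Lam a t mu rho * dn a t nu rho) = deltaG mu nu.
Proof.
intro Ha.
apply (eq_of_is_derive (fun t => sumG (fun rho => Lam a t mu rho * dn a t nu rho))
         (fun _ => deltaG mu nu) (fun _ => 0)).
- transitivity (sumG (fun rho => deltaG mu rho * deltaG nu rho)).
  + apply sumG_ext; intro; now rewrite Lam_0, dn_0.
  + rewrite sumG_delta_l; destruct mu as [[]|], nu as [[]|]; expand_sums; ring.
- clear t; intro t; eapply is_derive_eq.
  + apply is_derive_sumG; intro rho; apply is_derive_mult_R;
      [apply is_derive_Lam, Ha|apply is_derive_dn, Ha].
  + expand_sums; ring.
- intro; apply is_derive_const_R.
Qed.

Lemma Wmat_bounded a T : C0path a ->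
  exists m, 0 <= m /\ forall t be al, Rabs t <= T -> Rabs (Wmat a t be al) <= m.
Proof.
intro Ha.
destruct (continuous_bounded (a x1) T (Ha x1)) as [m1 [P1 H1]].
destruct (continuous_bounded (a x2) T (Ha x2)) as [m2 [P2 H2]].
destruct (continuous_bounded (a x3) T (Ha x3)) as [m3 [P3 H3]].
exists (m1 + m2 + m3); split; [lra|]; intros t be al Ht.
specialize (H1 t Ht); specialize (H2 t Ht); specialize (H3 t Ht).
destruct be as [[]|], al as [[]|]; simpl; rewrite ?Rabs_R0; lra.
Qed.

Lemma Rabs_sum_mult_le (F G : Greek -> R) m N :
  (forall mu, Rabs (F mu) <= m) -> sumG (fun mu => Rabs (G mu)) <= N -> 0 <= m ->
  Rabs (sumG (fun mu => F mu * G mu)) <= m * N.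
Proof.
intros HF HG Hm; eapply Rle_trans; [apply Rabs_sumG|].
apply Rle_trans with (sumG (fun mu => m * Rabs (G mu))).
- apply sumG_le; intro mu; rewrite Rabs_mult.
  apply Rmult_le_compat_r; [apply Rabs_pos|apply HF].
- rewrite sumG_mult_l; now apply Rmult_le_compat_l.
Qed.

Lemma norm1_row Q mu : sumG (fun nu => Rabs (Q mu nu)) <= norm1 Q.
Proof.
apply (sumG_ge_term (fun mu => sumG (fun nu => Rabs (Q mu nu)))); intro.
apply sumG_ge0; intro; apply Rabs_pos.
Qed.

Lemma norm1_col Q nu : sumG (fun mu => Rabs (Q mu nu)) <= norm1 Q.
Proof.
unfold norm1; apply sumG_le; intro mu.
apply (sumG_ge_term (fun nu => Rabs (Q mu nu))); intro; apply Rabs_pos.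
Qed.

(* From a right inverse one gets a left inverse without determinants:
   Lam^-1 Lam - 1 solves the linear equation Q' = Q W - W Q with Q(0) = 0. *)
Lemma Lorentz_l a t mu nu : C0path a ->
  sumG (fun rho => dn a t rho mu * Lam a t rho nu) = deltaG mu nu.
Proof.
intro Ha.
pose (Q t mu nu := sumG (fun rho => dn a t rho mu * Lam a t rho nu) - deltaG mu nu).
destruct (Wmat_bounded a (Rabs t) Ha) as [m [Hm HW]].
assert (H0 : norm2 (Q 0) = 0).
{ unfold norm2; replace 0 with (sumG (fun _ => sumG (fun _ => 0))) at 1
    by (expand_sums; ring).
  assert (E : forall mu nu, Q 0 mu nu = 0).
  { intros k l; unfold Q; unfold sumG, sumL; rewrite !dn_0, !Lam_0 by exact Ha.
    destruct k as [[]|], l as [[]|]; simpl; ring. }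
  apply sumG_ext; intro k; apply sumG_ext; intro l; rewrite E; ring. }
assert (H : norm2 (Q t) <= 0).
{ rewrite <- (Rmult_0_l (exp (32 * (2 * m) * Rabs t))), <- H0.
  apply (matrix_gronwall Q (fun t k l => sumG (fun be => Wmat a t be l * Q t k be)
     - sumG (fun be => Wmat a t k be * Q t be l)) (2 * m) (Rabs t)); [| |lra].
  - intros x k l; unfold Q; eapply is_derive_eq.
    + apply is_derive_minus_R; [|apply is_derive_const_R].
      apply is_derive_sumG; intro rho; apply is_derive_mult_R;
        [apply is_derive_dn, Ha|apply is_derive_Lam, Ha].
    + destruct k as [[]|], l as [[]|]; expand_sums; ring.
  - intros x k l Hx; eapply Rle_trans; [apply Rabs_triang|]; rewrite Rabs_Ropp.
    replace (2 * m * norm1 (Q x)) with (m * norm1 (Q x) + m * norm1 (Q x)) by ring.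
    apply Rplus_le_compat; apply Rabs_sum_mult_le; auto using norm1_row, norm1_col. }
pose proof (norm2_ge_term (Q t) mu nu); pose proof (pow2_ge_0 (Q t mu nu)).
assert (E : Q t mu nu = 0) by (apply Rsqr_0_uniq; unfold Rsqr; nra).
unfold Q in E; lra.
Qed.

Definition Smat (h a : path) (t : R) (mu nu : Greek) : R :=
  sumL (fun i => h i t * (Lam a t mu (Sp i) * dn a t nu Tm + Lam a t mu Tm * dn a t nu (Sp i))).
Definition Ymat (h a : path) (t : R) (mu nu : Greek) : R :=
  RInt (fun s => Smat h a s mu nu) 0 t.
(** The worldline of the spatial origin in inertial coordinates. *)
Definition zvec (a : path) (t : R) (mu : Greek) : R := RInt (fun s => Lam a s mu Tm) 0 t.
Definition Uvec (h a : path) (t : R) (mu : Greek) : R :=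
  RInt (fun s => sumG (fun nu => Smat h a s mu nu * zvec a s nu)) 0 t.

Lemma Smat_W h a t mu nu : Smat h a t mu nu =
  sumG (fun k => Lam a t mu k * sumG (fun l => Wmat h t k l * dn a t nu l)).
Proof. unfold Smat; expand_sums; ring. Qed.

Lemma Smat_antisym h a t mu nu : sg nu * Smat h a t mu nu = - (sg mu * Smat h a t nu mu).
Proof.
unfold Smat, sumL; rewrite !Lam_dn_upE.
generalize (sg_sqr mu), (sg_sqr nu); destruct mu as [[]|], nu as [[]|]; unfold sg; simpl; intros; ring.
Qed.

Lemma tcont_Smat h mu nu : C0path h -> tcont (fun a t => Smat h a t mu nu).
Proof.
intros Hh a Ha t; unfold Smat.
apply (continuous_sumL (fun i t => _)); intro i.
apply continuous_mult_R; [apply Hh|].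
apply continuous_plus_R; apply continuous_mult_R;
  first [now apply (tcont_Lam _ _ a)|now apply (tcont_dn _ _ a)].
Qed.

Lemma is_derive_Ymat h a t mu nu : C0path h -> C0path a ->
  is_derive (fun s => Ymat h a s mu nu) t (Smat h a t mu nu).
Proof.
intros Hh Ha; unfold Ymat; apply (is_derive_primitive (fun s => Smat h a s mu nu)).
now apply (tcont_Smat h mu nu).
Qed.

Lemma is_derive_zvec a t mu : C0path a -> is_derive (fun s => zvec a s mu) t (Lam a t mu Tm).
Proof.
intros Ha; unfold zvec; apply (is_derive_primitive (fun s => Lam a s mu Tm)).
now apply (tcont_Lam mu Tm).
Qed.

Lemma tcont_zvec mu : tcont (fun a t => zvec a t mu).
Proof. intros a Ha t; eapply is_derive_cont, is_derive_zvec, Ha. Qed.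

Lemma tcont_Ymat h mu nu : C0path h -> tcont (fun a t => Ymat h a t mu nu).
Proof. intros Hh a Ha t; eapply is_derive_cont, is_derive_Ymat; auto. Qed.

Lemma is_derive_Uvec h a t mu : C0path h -> C0path a ->
  is_derive (fun s => Uvec h a s mu) t (sumG (fun nu => Smat h a t mu nu * zvec a t nu)).
Proof.
intros Hh Ha; unfold Uvec.
apply (is_derive_primitive (fun s => sumG (fun nu => Smat h a s mu nu * zvec a s nu))).
intro s; apply (continuous_sumG (fun nu s => _)); intro nu; apply continuous_mult_R;
  [now apply (tcont_Smat h mu nu)|now apply (tcont_zvec nu)].
Qed.

Lemma tcont_Uvec h mu : C0path h -> tcont (fun a t => Uvec h a t mu).
Proof. intros Hh a Ha t; eapply is_derive_cont, is_derive_Uvec; auto. Qed.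

Lemma Ymat_antisym h a t mu nu : C0path h -> C0path a ->
  sg nu * Ymat h a t mu nu = - (sg mu * Ymat h a t nu mu).
Proof.
intros Hh Ha.
apply (eq_of_is_derive (fun t => sg nu * Ymat h a t mu nu)
   (fun t => - (sg mu * Ymat h a t nu mu)) (fun t => sg nu * Smat h a t mu nu)).
- unfold Ymat; rewrite !RInt_point_R; ring.
- intro s; apply is_derive_scal_R, is_derive_Ymat; auto.
- intro s; apply (is_derive_ext_R (fun t => - sg mu * Ymat h a t nu mu)); [intro; ring|].
  eapply is_derive_eq; [apply is_derive_scal_R, is_derive_Ymat; auto|].
  rewrite Smat_antisym; ring.
Qed.

(* The path-perturbation formula: Lam_s Lam_0^-1 has derivative s Lam_s W_h Lam_0^-1. *)
Lemma Lam_movep h a s t mu nu : C0path h -> C0path a ->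
  Lam (movep a h s) t mu nu = Lam a t mu nu + s *
    sumG (fun rho => RInt (fun x => sumG (fun k => Lam (movep a h s) x mu k *
                        sumG (fun l => Wmat h x k l * dn a x rho l))) 0 t * Lam a t rho nu).
Proof.
intros Hh Ha; assert (Hs := C0path_movep a h s Ha Hh).
assert (HR : forall t rho, sumG (fun k => Lam (movep a h s) t mu k * dn a t rho k) =
   deltaG mu rho + s * RInt (fun x => sumG (fun k => Lam (movep a h s) x mu k *
                        sumG (fun l => Wmat h x k l * dn a x rho l))) 0 t).
{ clear t; intros t rho.
  apply (eq_of_is_derive (fun t => sumG (fun k => Lam (movep a h s) t mu k * dn a t rho k))
   (fun t => deltaG mu rho + s * RInt (fun x => sumG (fun k => Lam (movep a h s) x mu k *
                        sumG (fun l => Wmat h x k l * dn a x rho l))) 0 t)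
   (fun x => s * sumG (fun k => Lam (movep a h s) x mu k *
                        sumG (fun l => Wmat h x k l * dn a x rho l)))).
  - rewrite RInt_point_R, Rmult_0_r, Rplus_0_r.
    rewrite <- (sumG_delta_l mu (fun k => deltaG k rho)); apply sumG_ext; intro k.
    rewrite Lam_0, dn_0 by assumption; f_equal.
    destruct rho as [[]|], k as [[]|]; reflexivity.
  - clear t; intro t; eapply is_derive_eq.
    + apply is_derive_sumG; intro k; apply is_derive_mult_R;
        [apply is_derive_Lam, Hs|apply is_derive_dn, Ha].
    + expand_sums; unfold movep; ring.
  - clear t; intro t; eapply is_derive_eq.
    + apply is_derive_plus_R; [apply is_derive_const_R|].
      apply is_derive_scal_R, is_derive_primitive; intro x.
      apply (continuous_sumG (fun k x => _)); intro k.
      apply continuous_mult_R; [now apply (tcont_Lam mu k)|].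
      apply (continuous_sumG (fun l x => _)); intro l.
      apply continuous_mult_R; [|now apply (tcont_dn rho l)].
      destruct k, l; simpl; first [apply Hh|apply continuous_const_R].
    + simpl; ring. }
rewrite <- (sumG_delta_l mu (fun rho => Lam a t rho nu)).
rewrite <- sumG_mult_l, <- sumG_plus.
transitivity (sumG (fun rho => sumG (fun k => Lam (movep a h s) t mu k * dn a t rho k) * Lam a t rho nu)).
(* Insert Lambda^-1 Lambda = 1 between the perturbed matrix and its column index, by [Lorentz_l]. *)
- rewrite <- (sumG_delta_r nu (fun k => Lam (movep a h s) t mu k)) at 1.
  transitivity (sumG (fun k => Lam (movep a h s) t mu k *
     sumG (fun rho => dn a t rho k * Lam a t rho nu))).
  + apply sumG_ext; intro k; now rewrite Lorentz_l.
  + unfold sumG, sumL; ring.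
- apply sumG_ext; intro rho; rewrite HR; ring.
Qed.

(** An a priori bound uniform in |s| <= 1: the matrix W of a + s h is at most m + n there, and the
    Gronwall inequality starts from the identity matrix, of squared norm 4. The passage from squares
    to absolute values uses |x| <= 1 + x^2. *)
Lemma bigO_Lam h a T mu nu : C0path h -> C0path a ->
  bigO T 0 (fun s t => Lam (movep a h s) t mu nu).
Proof.
intros Hh Ha.
destruct (Wmat_bounded a T Ha) as [m [Hm HW]]; destruct (Wmat_bounded h T Hh) as [n [Hn HW']].
exists (1 + 4 * exp (32 * (m + n) * T)); intros s t Hs Ht; simpl; rewrite Rmult_1_r.
assert (Hp := C0path_movep a h s Ha Hh).
pose (Q t := Lam (movep a h s) t).
assert (H : norm2 (Q t) <= norm2 (Q 0) * exp (32 * (m + n) * Rabs t)).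
{ apply (matrix_gronwall Q (fun t mu nu => sumG (fun be => Wmat (movep a h s) t be nu * Q t mu be))
    _ T); [| |exact Ht].
  - intros x k l; eapply is_derive_eq; [now apply is_derive_Lam|].
    apply sumG_ext; intro; apply Rmult_comm.
  - intros x k l Hx; apply Rabs_sum_mult_le; [|apply norm1_row|lra].
    intro be; apply Rle_trans with (Rabs (Wmat a x be l) + Rabs s * Rabs (Wmat h x be l)).
    + rewrite <- Rabs_mult; eapply Rle_trans; [|apply Rabs_triang]; apply Req_le; f_equal.
      destruct be, l; simpl; unfold movep; ring.
    + specialize (HW x be l Hx); specialize (HW' x be l Hx).
      pose proof (Rabs_pos (Wmat h x be l)); pose proof (Rabs_pos s); nra. }
assert (H0 : norm2 (Q 0) = 4).
{ unfold norm2, Q, sumG, sumL; rewrite !Lam_0 by exact Hp; simpl; ring. }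
rewrite H0 in H; pose proof (norm2_ge_term (Q t) mu nu) as H1; unfold Q in H1 at 1.
assert (H2 : exp (32 * (m + n) * Rabs t) <= exp (32 * (m + n) * T)).
{ destruct (Rle_lt_or_eq_dec _ _ Ht) as [Ht'| ->]; [|lra].
  destruct (Req_dec (m + n) 0) as [->|]; [rewrite !Rmult_0_r, !Rmult_0_l; lra|].
  left; apply exp_increasing, Rmult_lt_compat_l; lra. }
assert (forall x, Rabs x <= 1 + x ^ 2).
{ intro x; rewrite <- (pow2_abs x); pose proof (pow2_ge_0 (Rabs x - 1)); pose proof (Rabs_pos x); nra. }
specialize (H3 (Lam (movep a h s) t mu nu)); lra.
Qed.

(** [Lam_movep] is used twice. With the bound [bigO_Lam] under the integral it gives Lam_s - Lam =
    O(s); putting this back, the remainder is s times the integral of (Lam_s - Lam) W_h Lambda^-1,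
    multiplied by Lambda, hence O(s^2). *)
Lemma variation_Lam h mu nu : C0path h ->
  has_variation h (fun a t => Lam a t mu nu)
    (fun a t => sumG (fun rho => Ymat h a t mu rho * Lam a t rho nu)).
Proof.
intro Hh; split; [apply tcont_Lam|split].
{ intros a Ha t; apply (continuous_sumG (fun rho t => _)); intro rho; apply continuous_mult_R;
    [now apply (tcont_Ymat h mu rho)|now apply (tcont_Lam rho nu)]. }
intros a Ha T.
assert (cD : forall k l t, continuous (fun x => Wmat h x k l) t).
{ intros k l t; destruct k, l; simpl; first [apply Hh|apply continuous_const_R]. }
assert (cI : forall (f : Greek -> R -> R), (forall k t, continuous (f k) t) -> forall rho t,
   continuous (fun x => sumG (fun k => f k x * sumG (fun l => Wmat h x k l * dn a x rho l))) t).
{ intros f Hf rho t; apply (continuous_sumG (fun k x => _)); intro k.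
  apply continuous_mult_R; [apply Hf|].
  apply (continuous_sumG (fun l x => _)); intro l.
  apply continuous_mult_R; [apply cD|now apply (tcont_dn rho l)]. }
assert (OD : forall k rho, bigO T 0 (fun _ x => sumG (fun l => Wmat h x k l * dn a x rho l))).
{ intros k rho; apply (bigO_const T (fun x => sumG (fun l => Wmat h x k l * dn a x rho l))); intro t.
  apply (continuous_sumG (fun l x => _)); intro l.
  apply continuous_mult_R; [apply cD|now apply (tcont_dn rho l)]. }
(* The integral operator of [Lam_movep] preserves the order in s. *)
assert (OI : forall n (f : Greek -> R -> R -> R), (forall k s t, continuous (f k s) t) ->
  (forall k, bigO T n (f k)) ->
  bigO T n (fun s t => sumG (fun rho => RInt (fun x => sumG (fun k => f k s x *
                        sumG (fun l => Wmat h x k l * dn a x rho l))) 0 t * Lam a t rho nu))).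
{ intros n f Hc Hf; apply (bigO_sumG T n (fun rho s t => _)); intro rho.
  rewrite <- (Nat.add_0_r n); apply bigO_mult;
    [|exact (bigO_const T _ (tcont_Lam rho nu a Ha))].
  apply (bigO_RInt T n (fun s x => _)).
  - intros s t; apply (cI (fun k => f k s)); intros; apply Hc.
  - apply (bigO_sumG T n (fun k s x => _)); intro k.
    rewrite <- (Nat.add_0_r n); apply bigO_mult; [apply Hf|apply OD]. }
assert (cL : forall k s t, continuous (fun t => Lam (movep a h s) t mu k) t).
{ intros k s; apply (tcont_Lam mu k), C0path_movep; auto. }
assert (O1 : forall k, bigO T 1 (fun s t => Lam (movep a h s) t mu k - Lam a t mu k)).
{ intro k.
  assert (OI' : bigO T 0 (fun s t => sumG (fun rho => RInt (fun x => sumG (fun l =>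
     Lam (movep a h s) x mu l * sumG (fun l' => Wmat h x l l' * dn a x rho l'))) 0 t * Lam a t rho k))).
  { apply (bigO_sumG T 0 (fun rho s t => _)); intro rho.
    apply (bigO_mult T 0 0); [|exact (bigO_const T _ (tcont_Lam rho k a Ha))].
    apply (bigO_RInt T 0 (fun s x => _)).
    - intros s t; apply (cI (fun k t => Lam (movep a h s) t mu k)); intros; apply cL.
    - apply (bigO_sumG T 0 (fun k s x => _)); intro l.
      apply (bigO_mult T 0 0); [now apply bigO_Lam|apply OD]. }
  eapply bigO_ext; [|exact (bigO_mult _ _ _ _ _ (bigO_param T) OI')].
  intros s t _ _; simpl; rewrite (Lam_movep h a s t mu k Hh Ha); ring. }
assert (cL0 : forall k t, continuous (fun t => Lam a t mu k) t)
  by (intro k; now apply (tcont_Lam mu k)).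
eapply bigO_ext; [|exact (bigO_mult _ _ _ _ _ (bigO_param T)
  (OI 1%nat (fun k s t => Lam (movep a h s) t mu k - Lam a t mu k)
   (fun k s t => continuous_minus_R _ _ _ (cL k s t) (cL0 k t)) O1))].
intros s t _ _; simpl.
rewrite (Lam_movep h a s t mu nu Hh Ha).
transitivity (s * (sumG (fun rho => RInt (fun x => sumG (fun k => Lam (movep a h s) x mu k *
       sumG (fun l => Wmat h x k l * dn a x rho l))) 0 t * Lam a t rho nu)
   - sumG (fun rho => Ymat h a t mu rho * Lam a t rho nu))); [|ring].
f_equal; unfold Rminus; rewrite <- (Rmult_1_l (sumG (fun rho => Ymat _ _ _ _ _ * _))).
rewrite Ropp_mult_distr_l, <- sumG_mult_l, <- sumG_plus; apply sumG_ext; intro rho.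
assert (E : RInt (fun x => sumG (fun k => (Lam (movep a h s) x mu k + - Lam a x mu k) *
       sumG (fun l => Wmat h x k l * dn a x rho l))) 0 t =
  RInt (fun x => sumG (fun k => Lam (movep a h s) x mu k *
       sumG (fun l => Wmat h x k l * dn a x rho l))) 0 t - Ymat h a t mu rho).
{ unfold Ymat; rewrite <- RInt_minus_R.
  - apply RInt_ext_R; intros x; rewrite Smat_W; unfold sumG, sumL; ring.
  - apply (cI (fun k t => Lam (movep a h s) t mu k)); intros; apply cL.
  - now apply (tcont_Smat h mu rho). }
rewrite E; ring.
Qed.

Lemma variation_dn h mu nu : C0path h ->
  has_variation h (fun a t => dn a t mu nu)
    (fun a t => - sumG (fun rho => Ymat h a t rho mu * dn a t rho nu)).
Proof.
intro Hh; eapply has_variation_ext;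
  [| |exact Hh|exact (variation_scal h (sg mu * sg nu) _ _ (variation_Lam h mu nu Hh))].
- intros a Ha t; simpl; now rewrite Lam_dn_upE.
- intros a Ha t; simpl.
  replace (- sumG (fun rho => Ymat h a t rho mu * dn a t rho nu)) with
    (-1 * sumG (fun rho => Ymat h a t rho mu * dn a t rho nu)) by ring.
  rewrite <- !sumG_mult_l; apply sumG_ext; intro rho; rewrite Lam_dn_upE.
  pose proof (Ymat_antisym h a t rho mu Hh Ha) as E.
  replace (-1 * (Ymat h a t rho mu * (sg rho * sg nu * Lam a t rho nu))) with
    (sg mu * sg mu * (- (sg rho * Ymat h a t rho mu)) * sg nu * Lam a t rho nu)
    by (rewrite sg_sqr; ring).
  replace (sg mu * sg mu * - (sg rho * Ymat h a t rho mu) * sg nu * Lam a t rho nu)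
    with (sg mu * sg rho * (- (sg mu * Ymat h a t rho mu)) * sg nu * Lam a t rho nu) by ring.
  rewrite E.
  replace (sg mu * sg rho * - - (sg rho * Ymat h a t mu rho) * sg nu * Lam a t rho nu) with
    (sg rho * sg rho * sg mu * Ymat h a t mu rho * sg nu * Lam a t rho nu) by ring.
  rewrite sg_sqr; ring.
Qed.

(** Integration by parts: Lambda_4 is the derivative of z, and S_h that of Y. *)
Lemma RInt_Ymat_Lam h a t mu : C0path h -> C0path a ->
  RInt (fun s => sumG (fun rho => Ymat h a s mu rho * Lam a s rho Tm)) 0 t =
  sumG (fun rho => Ymat h a t mu rho * zvec a t rho) - Uvec h a t mu.
Proof.
intros Hh Ha.
apply (eq_of_is_derive
  (fun t => RInt (fun s => sumG (fun rho => Ymat h a s mu rho * Lam a s rho Tm)) 0 t)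
  (fun t => sumG (fun rho => Ymat h a t mu rho * zvec a t rho) - Uvec h a t mu)
  (fun s => sumG (fun rho => Ymat h a s mu rho * Lam a s rho Tm))).
- unfold Ymat, zvec, Uvec, sumG, sumL; rewrite !RInt_point_R; ring.
- intro s; apply is_derive_primitive; intro x.
  apply (continuous_sumG (fun rho x => _)); intro; apply continuous_mult_R;
    [now apply (tcont_Ymat h mu mu0)|now apply (tcont_Lam mu0 Tm)].
- intro s; eapply is_derive_eq.
  + apply is_derive_minus_R; [|now apply is_derive_Uvec].
    apply is_derive_sumG; intro rho; apply is_derive_mult_R;
      [now apply is_derive_Ymat|now apply is_derive_zvec].
  + unfold sumG, sumL; ring.
Qed.

Lemma variation_zvec h mu : C0path h ->
  has_variation h (fun a t => zvec a t mu)
    (fun a t => sumG (fun rho => Ymat h a t mu rho * zvec a t rho) - Uvec h a t mu).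
Proof.
intro Hh; eapply has_variation_ext;
  [| |exact Hh|exact (variation_RInt h _ _ Hh (variation_Lam h mu Tm Hh))].
- reflexivity.
- intros a Ha t; simpl; now apply RInt_Ymat_Lam.
Qed.

(** * Second variations *)

(** Since delta_h Lambda = Y_h Lambda, conjugation by Lambda makes S_g vary by the commutator
    [Y_h, S_g]. *)
Definition dSmat h g a t mu nu : R :=
  sumG (fun rho => Ymat h a t mu rho * Smat g a t rho nu)
  - sumG (fun rho => Smat g a t mu rho * Ymat h a t rho nu).
Definition dYmat h g a t mu nu : R := RInt (fun s => dSmat h g a s mu nu) 0 t.
Definition dUvec h g a t mu : R :=
  RInt (fun s => sumG (fun nu => dSmat h g a s mu nu * zvec a s nu
     + Smat g a s mu nu * (sumG (fun rho => Ymat h a s nu rho * zvec a s rho) - Uvec h a s nu))) 0 t.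

Lemma variation_Smat h g mu nu : C0path h -> C0path g ->
  has_variation h (fun a t => Smat g a t mu nu) (fun a t => dSmat h g a t mu nu).
Proof.
intros Hh Hg.
assert (H : forall i, _) by exact (fun i => variation_mult h _ _ _ _
  (variation_const h (g i) (Hg i)) (variation_plus h _ _ _ _
    (variation_mult h _ _ _ _ (variation_Lam h mu (Sp i) Hh) (variation_dn h nu Tm Hh))
    (variation_mult h _ _ _ _ (variation_Lam h mu Tm Hh) (variation_dn h nu (Sp i) Hh)))).
eapply has_variation_ext; [| |exact Hh|exact (variation_sumL h _ _ H)].
- reflexivity.
- intros a Ha t; unfold dSmat, Smat, sumG, sumL; ring.
Qed.

Lemma variation_Ymat h g mu nu : C0path h -> C0path g ->
  has_variation h (fun a t => Ymat g a t mu nu) (fun a t => dYmat h g a t mu nu).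
Proof. intros Hh Hg; apply variation_RInt; [exact Hh|now apply variation_Smat]. Qed.

Lemma variation_Uvec h g mu : C0path h -> C0path g ->
  has_variation h (fun a t => Uvec g a t mu) (fun a t => dUvec h g a t mu).
Proof.
intros Hh Hg; apply variation_RInt; [exact Hh|].
exact (variation_sumG h _ _ (fun nu => variation_mult h _ _ _ _
  (variation_Smat h g mu nu Hh Hg) (variation_zvec h nu Hh))).
Qed.

Lemma is_derive_dYmat h g a t mu nu : C0path h -> C0path g -> C0path a ->
  is_derive (fun s => dYmat h g a s mu nu) t (dSmat h g a t mu nu).
Proof.
intros Hh Hg Ha; apply (is_derive_primitive (fun s => dSmat h g a s mu nu)).
apply (variation_Smat h g mu nu Hh Hg); exact Ha.
Qed.

Lemma is_derive_dUvec h g a t mu : C0path h -> C0path g -> C0path a ->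
  is_derive (fun s => dUvec h g a s mu) t
   (sumG (fun nu => dSmat h g a t mu nu * zvec a t nu
     + Smat g a t mu nu * (sumG (fun rho => Ymat h a t nu rho * zvec a t rho) - Uvec h a t nu))).
Proof.
intros Hh Hg Ha.
apply (is_derive_primitive (fun t => sumG (fun nu => dSmat h g a t mu nu * zvec a t nu
     + Smat g a t mu nu * (sumG (fun rho => Ymat h a t nu rho * zvec a t rho) - Uvec h a t nu)))).
intro x; apply (continuous_sumG (fun nu x => _)); intro nu.
apply continuous_plus_R; apply continuous_mult_R.
- apply (variation_Smat h g mu nu Hh Hg); exact Ha.
- now apply (tcont_zvec nu).
- now apply (tcont_Smat g mu nu).
- apply (variation_zvec h nu Hh); exact Ha.
Qed.

(** The zero-curvature identity: the time derivative of [Y_h, Y_g] is [Y_h, S_g] - [Y_g, S_h]. *)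
Lemma dYmat_sym h g a t mu nu : C0path h -> C0path g -> C0path a ->
  dYmat h g a t mu nu = dYmat g h a t mu nu
   + (sumG (fun rho => Ymat h a t mu rho * Ymat g a t rho nu)
      - sumG (fun rho => Ymat g a t mu rho * Ymat h a t rho nu)).
Proof.
intros Hh Hg Ha.
apply (eq_of_is_derive (fun t => dYmat h g a t mu nu)
  (fun t => dYmat g h a t mu nu
   + (sumG (fun rho => Ymat h a t mu rho * Ymat g a t rho nu)
      - sumG (fun rho => Ymat g a t mu rho * Ymat h a t rho nu)))
  (fun t => dSmat h g a t mu nu)).
- unfold dYmat, Ymat, sumG, sumL; rewrite !RInt_point_R; ring.
- intro s; now apply is_derive_dYmat.
- intro s; eapply is_derive_eq.
  + apply is_derive_plus_R; [now apply is_derive_dYmat|].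
    apply is_derive_minus_R; apply is_derive_sumG; intro rho; apply is_derive_mult_R;
      now apply is_derive_Ymat.
  + unfold dSmat, sumG, sumL; ring.
Qed.

(** The translation part of the same identity: (Y, U) behaves as one element of the affine Lie
    algebra. *)
Lemma dUvec_sym h g a t mu : C0path h -> C0path g -> C0path a ->
  dUvec h g a t mu = dUvec g h a t mu
   + (sumG (fun rho => Ymat h a t mu rho * Uvec g a t rho)
      - sumG (fun rho => Ymat g a t mu rho * Uvec h a t rho)).
Proof.
intros Hh Hg Ha.
apply (eq_of_is_derive (fun t => dUvec h g a t mu)
  (fun t => dUvec g h a t mu
   + (sumG (fun rho => Ymat h a t mu rho * Uvec g a t rho)
      - sumG (fun rho => Ymat g a t mu rho * Uvec h a t rho)))
  (fun t => sumG (fun nu => dSmat h g a t mu nu * zvec a t nu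
     + Smat g a t mu nu * (sumG (fun rho => Ymat h a t nu rho * zvec a t rho) - Uvec h a t nu)))).
- unfold dUvec, Ymat, Uvec, sumG, sumL; rewrite !RInt_point_R; ring.
- intro s; now apply is_derive_dUvec.
- intro s; eapply is_derive_eq.
  + apply is_derive_plus_R; [now apply is_derive_dUvec|].
    apply is_derive_minus_R; apply is_derive_sumG; intro rho; (apply is_derive_mult_R;
      [now apply is_derive_Ymat|now apply is_derive_Uvec]).
  + unfold dSmat, sumG, sumL; ring.
Qed.

(** X smears the three D_i separately; this and the next two lemmas add the contributions up to the
    objects attached to the whole path. *)
Lemma Smat_single h a t mu nu :
  sumL (fun i => Smat (single i (h i)) a t mu nu) = Smat h a t mu nu.
Proof. unfold Smat, single, sumL; simpl; ring. Qed.

Lemma Ymat_single h a t mu nu : C0path h -> C0path a ->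
  sumL (fun i => Ymat (single i (h i)) a t mu nu) = Ymat h a t mu nu.
Proof.
intros Hh Ha.
apply (eq_of_is_derive (fun t => sumL (fun i => Ymat (single i (h i)) a t mu nu))
  (fun t => Ymat h a t mu nu) (fun t => Smat h a t mu nu)).
- unfold Ymat, sumL; rewrite !RInt_point_R; ring.
- intro s; rewrite <- Smat_single; apply is_derive_sumL; intro i.
  apply is_derive_Ymat; auto; apply C0path_single, Hh.
- intro s; now apply is_derive_Ymat.
Qed.

Lemma Uvec_single h a t mu : C0path h -> C0path a ->
  sumL (fun i => Uvec (single i (h i)) a t mu) = Uvec h a t mu.
Proof.
intros Hh Ha.
apply (eq_of_is_derive (fun t => sumL (fun i => Uvec (single i (h i)) a t mu))
  (fun t => Uvec h a t mu) (fun t => sumG (fun nu => Smat h a t mu nu * zvec a t nu))).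
- unfold Uvec, sumL; rewrite !RInt_point_R; ring.
- intro s.
  apply (is_derive_eq _ _ (sumL (fun i => sumG (fun nu => Smat (single i (h i)) a s mu nu * zvec a s nu)))).
  + apply is_derive_sumL; intro i; apply is_derive_Uvec; auto; apply C0path_single, Hh.
  + transitivity (sumG (fun nu => sumL (fun i => Smat (single i (h i)) a s mu nu) * zvec a s nu)).
    * unfold sumG, sumL; ring.
    * apply sumG_ext; intro; now rewrite Smat_single.
- intro s; now apply is_derive_Uvec.
Qed.

(** * The inertial coordinates k and the smeared coefficient of D *)

Lemma kvecE be p : kvec be p =
  sumL (fun j => Lam (acc p) (tau p) be (Sp j) * xi p j) + zvec (acc p) (tau p) be.
Proof. reflexivity. Qed.

(* The coefficient of P_mu in the generator D smeared with h; it is minus the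
   variation of k^mu along h. *)
Definition Bvec (h : path) (mu : Greek) : field :=
  fun p => Uvec h (acc p) (tau p) mu
    - sumG (fun nu => Ymat h (acc p) (tau p) mu nu * kvec nu p).

Lemma G_dn_upE a s t al nu :
  G_dn_up Lam a s t al nu = sumG (fun si => Lam a s si al * dn a t si nu).
Proof.
transitivity (sg al * sg nu * Gmat Lam a s t al nu).
- unfold G_dn_up, raise_snd, lower_fst, sg.
  destruct al as [[]|], nu as [[]|]; expand_sums; ring.
- unfold Gmat; rewrite <- sumG_mult_l; apply sumG_ext; intro si.
  rewrite !Lam_dn_upE.
  replace (sg al * sg nu * (sg si * sg al * Lam a s si al * Lam a t si nu)) with
   (sg al * sg al * (sg nu * sg si * Lam a s si al * Lam a t si nu)) by ring.
  rewrite sg_sqr; ring.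
Qed.

(** Delta is the displacement k - z(t) of the event from the origin at time t, resolved in the frame
    Lambda(t). *)
Lemma DeltaE a nu T t x : C0path a -> Defs.Delta Lam a nu T t x =
  sumG (fun si => dn a t si nu *
    (sumL (fun j => Lam a T si (Sp j) * x j) + zvec a T si - zvec a t si)).
Proof.
intro Ha; unfold Defs.Delta.
assert (E : RInt (fun t' => G_dn_up Lam a t' t Tm nu) t T =
  sumG (fun si => zvec a T si * dn a t si nu) - sumG (fun si => zvec a t si * dn a t si nu)).
{ apply is_RInt_unique.
  apply (is_RInt_derive (V := R_CompleteNormedModule) (fun s => sumG (fun si => zvec a s si * dn a t si nu))).
  - intros s _; rewrite G_dn_upE.
    apply (is_derive_sumG (fun si s => zvec a s si * dn a t si nu)); intro si.
    eapply is_derive_eq; [apply is_derive_mult_R; [now apply is_derive_zvec|apply is_derive_const_R]|].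
    simpl; ring.
  - intros s _; apply (continuous_ext (fun s => sumG (fun si => Lam a s si Tm * dn a t si nu))).
    + intro; symmetry; apply G_dn_upE.
    + apply (continuous_sumG (fun si s => _)); intro si; apply continuous_mult_R;
        [now apply (tcont_Lam si Tm)|apply continuous_const_R]. }
rewrite E.
transitivity (sumL (fun j => x j * sumG (fun si => Lam a T si (Sp j) * dn a t si nu))
  + (sumG (fun si => zvec a T si * dn a t si nu) - sumG (fun si => zvec a t si * dn a t si nu))).
- f_equal; apply sumL_ext; intro; now rewrite G_dn_upE.
- unfold sumG, sumL; ring.
Qed.

(** An impulse of acceleration at time t boosts the later frame about z(t) and so displaces k by S
    (k - z(t)); D carries the opposite displacement. *)
Lemma DcoefE i phi t mu p : inM p -> phi t * Dcoef Lam i t mu p =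
  chi t (tau p) * sumG (fun si => - Smat (single i phi) (acc p) t mu si *
     (kvec si p - zvec (acc p) t si)).
Proof.
intros [Hp _]; unfold Dcoef; rewrite !DeltaE by exact Hp.
assert (U : forall nu, Lam_up_up Lam (acc p) t mu nu = sg nu * Lam (acc p) t mu nu)
  by (intros [[]|]; unfold Lam_up_up, raise_snd, sg; expand_sums; ring).
rewrite !U.
rewrite (sumG_ext (fun si => - Smat _ _ _ _ _ * _) (fun si =>
 - (phi t * (Lam (acc p) t mu (Sp i) * dn (acc p) t si Tm
    + Lam (acc p) t mu Tm * dn (acc p) t si (Sp i))) *
 (sumL (fun j => Lam (acc p) (tau p) si (Sp j) * xi p j) + zvec (acc p) (tau p) si
   - zvec (acc p) t si))).
- unfold sg; destruct i; simpl; unfold sumG, sumL; ring.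
- intro si; rewrite kvecE; f_equal; f_equal.
  unfold Smat, single; destruct i; unfold sumL; simpl; ring.
Qed.

Lemma tcont_Smat_z h mu si c : C0path h ->
  tcont (fun a t => - Smat h a t mu si * (c - zvec a t si)).
Proof.
intros Hh a Ha t; apply continuous_mult_R.
- apply (continuous_ext (fun t => -1 * Smat h a t mu si)); [intro; simpl; ring|].
  apply continuous_mult_R; [apply continuous_const_R|now apply (tcont_Smat h mu si)].
- apply continuous_minus_R; [apply continuous_const_R|now apply (tcont_zvec si)].
Qed.

Lemma RInt_Dcoef i phi mu p : (forall t, continuous phi t) -> inM p ->
  RInt_gen (fun t => phi t * Dcoef Lam i t mu p) (Rbar_locally m_infty) (Rbar_locally p_infty)
  = Bvec (single i phi) mu p.
Proof.
intros Hphi Hp.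
set (h := single i phi); assert (Hh : C0path h) by now apply C0path_single.
assert (Ha := proj1 Hp).
set (g t := sumG (fun si => - Smat h (acc p) t mu si * (kvec si p - zvec (acc p) t si))).
assert (Hg : forall t, continuous g t).
{ intro t; unfold g; apply (continuous_sumG (fun si t => - Smat h (acc p) t mu si * (kvec si p - zvec (acc p) t si))).
  intro si; now apply (tcont_Smat_z h mu si (kvec si p)). }
apply is_RInt_gen_unique.
replace (Bvec h mu p) with (RInt g 0 (tau p)).
- apply (is_RInt_gen_ext (fun t => chi t (tau p) * g t)); [|now apply is_RInt_gen_chi].
  apply filter_forall; intros; symmetry; now apply DcoefE.
(* Here k stays frozen at p and only the upper limit T varies; the identity is used at T =
   [tau p]. *)
- apply (eq_of_is_derive (fun T => RInt g 0 T) (fun T => Uvec h (acc p) T mu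
    - sumG (fun nu => Ymat h (acc p) T mu nu * kvec nu p)) g).
  + unfold Uvec, Ymat, sumG, sumL; rewrite !RInt_point_R; ring.
  + intro t; now apply is_derive_primitive.
  + intro t; eapply is_derive_eq.
    * apply is_derive_minus_R; [now apply is_derive_Uvec|].
      apply is_derive_sumG; intro nu; apply is_derive_mult_R;
        [now apply is_derive_Ymat|apply is_derive_const_R].
    * unfold g, sumG, sumL; simpl; ring.
Qed.

Lemma DgenE i phi F p : (forall t, continuous phi t) -> inM p ->
  Dgen i phi F p = frame_op (Facc i phi) F p
    + sumG (fun mu => Bvec (single i phi) mu p * Pgen mu F p).
Proof.
intros Hphi Hp; unfold Defs.Dgen; simpl; f_equal.
apply sumG_ext; intro mu; now rewrite RInt_Dcoef.
Qed.

Definition frame_dn (E : frame) (nu si : Greek) (p : point) : R :=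
  match E with
  | Fcoord (Sp i) => 0
  | Fcoord Tm => - sumG (fun be => Wmat (acc p) (tau p) si be * dn (acc p) (tau p) nu be) / lapse p
  | Facc i phi => - sumG (fun rho => Ymat (single i phi) (acc p) (tau p) rho nu
                              * dn (acc p) (tau p) rho si)
  end.

Lemma is_frame_dn E nu si p : frame_ok E -> inM p ->
  is_frame E (fun q => dn (acc q) (tau q) nu si) p (frame_dn E nu si p).
Proof.
intros HE Hp; apply (is_frame_path (fun a t => dn a t nu si)); auto.
destruct E as [[i|]|i phi]; simpl; [reflexivity| |].
- eexists; split; [apply is_derive_dn; [apply Hp]|reflexivity].
- eexists; split; [apply variation_dn; [now apply C0path_single]|reflexivity].
Qed.

Definition frame_Lam (E : frame) (mu nu : Greek) (p : point) : R :=
  match E with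
  | Fcoord (Sp i) => 0
  | Fcoord Tm => sumG (fun be => Lam (acc p) (tau p) mu be * Wmat (acc p) (tau p) be nu) / lapse p
  | Facc i phi => sumG (fun rho => Ymat (single i phi) (acc p) (tau p) mu rho
                              * Lam (acc p) (tau p) rho nu)
  end.

Lemma is_frame_Lam E mu nu p : frame_ok E -> inM p ->
  is_frame E (fun q => Lam (acc q) (tau q) mu nu) p (frame_Lam E mu nu p).
Proof.
intros HE Hp; apply (is_frame_path (fun a t => Lam a t mu nu)); auto.
destruct E as [[i|]|i phi]; simpl; [reflexivity| |].
- eexists; split; [apply is_derive_Lam; [apply Hp]|reflexivity].
- eexists; split; [apply variation_Lam; [now apply C0path_single]|reflexivity].
Qed.

Definition frame_k (E : frame) (be : Greek) (p : point) : R :=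
  match E with
  | Fcoord nu => Lam (acc p) (tau p) be nu
  | Facc i phi => - Bvec (single i phi) be p
  end.

Lemma is_frame_zvec E mu p : frame_ok E -> inM p ->
  is_frame E (fun q => zvec (acc q) (tau q) mu) p
   match E with
   | Fcoord (Sp i) => 0
   | Fcoord Tm => Lam (acc p) (tau p) mu Tm / lapse p
   | Facc i phi => sumG (fun rho => Ymat (single i phi) (acc p) (tau p) mu rho
        * zvec (acc p) (tau p) rho) - Uvec (single i phi) (acc p) (tau p) mu
   end.
Proof.
intros HE Hp; apply (is_frame_path (fun a t => zvec a t mu)); auto.
destruct E as [[i|]|i phi]; simpl; [reflexivity| |].
- eexists; split; [apply is_derive_zvec; [apply Hp]|reflexivity].
- eexists; split; [apply variation_zvec; [now apply C0path_single]|reflexivity].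
Qed.

(** In the time direction Lambda W xi contributes (xi . a) Lambda_4 and z contributes Lambda_4;
    together they make lapse times Lambda_4, and the normalization divides by the lapse. Along an
    acceleration the result is Y (Lambda xi + z) - U. *)
Lemma is_frame_k E be p : frame_ok E -> inM p ->
  is_frame E (kvec be) p (frame_k E be p).
Proof.
intros HE Hp; assert (N := wt_pos (Fcoord Tm) p Hp); simpl in N.
eapply is_frame_eq.
- apply (is_frame_plus E (fun p => sumL (fun j => Lam (acc p) (tau p) be (Sp j) * xi p j))
      (fun p => zvec (acc p) (tau p) be)); [|now apply is_frame_zvec].
  apply (is_frame_sumL E (fun j p => Lam (acc p) (tau p) be (Sp j) * xi p j)); intro j.
  apply is_frame_mult; [now apply is_frame_Lam|apply is_frame_xi].
- destruct E as [[i|]|i phi].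
  + destruct i; expand_sums; ring.
  + unfold frame_k, frame_Lam, lapse, sumL in *; expand_sums; field; lra.
  + unfold frame_k, frame_Lam, Bvec.
    rewrite (sumG_ext (fun nu => _ * kvec nu p)
     (fun nu => Ymat (single i phi) (acc p) (tau p) be nu *
       (sumL (fun j => Lam (acc p) (tau p) nu (Sp j) * xi p j) + zvec (acc p) (tau p) nu)))
      by (intro; now rewrite kvecE).
    unfold sumG, sumL; ring.
Qed.

Lemma Smat_Lam h a t mu j : C0path a ->
  sumG (fun rho => Smat h a t mu rho * Lam a t rho (Sp j)) = Lam a t mu Tm * h j t.
Proof.
intro Ha; transitivity (sumL (fun i => h i t *
   (Lam a t mu (Sp i) * sumG (fun rho => dn a t rho Tm * Lam a t rho (Sp j))
   + Lam a t mu Tm * sumG (fun rho => dn a t rho (Sp i) * Lam a t rho (Sp j))))).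
- unfold Smat, sumG, sumL; ring.
- unfold sumL; rewrite !Lorentz_l by assumption; destruct j; simpl; ring.
Qed.

(** In the time direction the derivatives of U and Y give S_g (z - k) = - S_g Lambda xi, which
    [Smat_Lam] evaluates to - (g . xi) Lambda_4. *)
Definition frame_B (E : frame) (g : path) (mu : Greek) (p : point) : R :=
  match E with
  | Fcoord nu => - sumG (fun rho => Ymat g (acc p) (tau p) mu rho * Lam (acc p) (tau p) rho nu)
      - deltaG Tm nu * Lam (acc p) (tau p) mu Tm * sumL (fun i => g i (tau p) * xi p i) / lapse p
  | Facc i phi => dUvec (single i phi) g (acc p) (tau p) mu
      - sumG (fun rho => dYmat (single i phi) g (acc p) (tau p) mu rho * kvec rho p
          + Ymat g (acc p) (tau p) mu rho * - Bvec (single i phi) rho p)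
  end.

Lemma is_frame_B E g mu p : frame_ok E -> C0path g -> inM p ->
  is_frame E (Bvec g mu) p (frame_B E g mu p).
Proof.
intros HE Hg Hp; assert (N := wt_pos (Fcoord Tm) p Hp); simpl in N.
assert (HU : is_frame E (fun q => Uvec g (acc q) (tau q) mu) p
   match E with
   | Fcoord (Sp i) => 0
   | Fcoord Tm => sumG (fun nu => Smat g (acc p) (tau p) mu nu * zvec (acc p) (tau p) nu) / lapse p
   | Facc i phi => dUvec (single i phi) g (acc p) (tau p) mu
   end).
{ apply (is_frame_path (fun a t => Uvec g a t mu)); auto.
  destruct E as [[i|]|i phi]; simpl; [reflexivity| |].
  - eexists; split; [apply is_derive_Uvec; [exact Hg|apply Hp]|reflexivity].
  - eexists; split; [apply variation_Uvec; [now apply C0path_single|exact Hg]|reflexivity]. }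
assert (HY : forall nu, is_frame E (fun q => Ymat g (acc q) (tau q) mu nu) p
   match E with
   | Fcoord (Sp i) => 0
   | Fcoord Tm => Smat g (acc p) (tau p) mu nu / lapse p
   | Facc i phi => dYmat (single i phi) g (acc p) (tau p) mu nu
   end).
{ intro nu; apply (is_frame_path (fun a t => Ymat g a t mu nu)); auto.
  destruct E as [[i|]|i phi]; simpl; [reflexivity| |].
  - eexists; split; [apply is_derive_Ymat; [exact Hg|apply Hp]|reflexivity].
  - eexists; split; [apply variation_Ymat; [now apply C0path_single|exact Hg]|reflexivity]. }
eapply is_frame_eq.
- apply is_frame_minus; [exact HU|].
  apply (is_frame_sumG E (fun nu q => Ymat g (acc q) (tau q) mu nu * kvec nu q)); intro nu.
  apply is_frame_mult; [apply HY|now apply is_frame_k].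
- destruct E as [[i|]|i phi].
  + unfold frame_B; simpl; unfold sumG, sumL; field; lra.
  + unfold frame_B, frame_k; simpl.
    apply Rminus_diag_uniq.
    transitivity ((sumL (fun j => (Lam (acc p) (tau p) mu Tm * g j (tau p)
       - sumG (fun rho => Smat g (acc p) (tau p) mu rho * Lam (acc p) (tau p) rho (Sp j))) * xi p j))
       / lapse p).
    * rewrite (sumG_ext (fun nu => _ / _ * kvec nu p + _) (fun nu => Smat g (acc p) (tau p) mu nu / lapse p *
        (sumL (fun j => Lam (acc p) (tau p) nu (Sp j) * xi p j) + zvec (acc p) (tau p) nu)
        + Ymat g (acc p) (tau p) mu nu * Lam (acc p) (tau p) nu Tm)) by (intro; now rewrite kvecE).
      unfold sumG, sumL; field; lra.
    * unfold sumL; rewrite !Smat_Lam by apply Hp; field; lra.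
  + reflexivity.
Qed.

(** As B is minus the variation of k, this is the symmetry of the second variation of k. The
    commutators from [dYmat_sym] and [dUvec_sym] cancel against the products of Y with B. *)
Lemma frame_B_sym i phi j psi mu p :
  (forall t, continuous phi t) -> (forall t, continuous psi t) -> inM p ->
  frame_B (Facc i phi) (single j psi) mu p = frame_B (Facc j psi) (single i phi) mu p.
Proof.
intros Hphi Hpsi [Hp _].
set (h := single i phi); set (g := single j psi).
assert (Hh : C0path h) by now apply C0path_single.
assert (Hg : C0path g) by now apply C0path_single.
unfold frame_B; fold h g.
rewrite (dUvec_sym h g) by assumption.
rewrite (sumG_ext (fun rho => dYmat h g _ _ mu rho * _ + _)
  (fun rho => (dYmat g h (acc p) (tau p) mu rho
   + (sumG (fun si => Ymat h (acc p) (tau p) mu si * Ymat g (acc p) (tau p) si rho)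
      - sumG (fun si => Ymat g (acc p) (tau p) mu si * Ymat h (acc p) (tau p) si rho))) * kvec rho p
   + Ymat g (acc p) (tau p) mu rho * - Bvec h rho p))
  by (intro rho; now rewrite (dYmat_sym h g)).
unfold Bvec, sumG, sumL; ring.
Qed.

(** * Commutators of P and D *)

Lemma PgenE mu F p :
  Pgen mu F p = sumG (fun nu => dn (acc p) (tau p) mu nu * frame_op (Fcoord nu) F p).
Proof. reflexivity. Qed.

Lemma derivation_Pgen mu : derivation (Pgen mu).
Proof.
assert (D := fun nu => derivation_frame_op (Fcoord nu) I).
split; intros; rewrite !PgenE.
- apply sumG_ext; intro nu; f_equal; now apply (der_ext _ (D nu)).
- rewrite <- (Rmult_0_l (sumG (fun _ => 0))), <- sumG_mult_l.
  apply sumG_ext; intro nu; rewrite (der_const _ (D nu)) by assumption; ring.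
- rewrite <- sumG_plus; apply sumG_ext; intro nu.
  rewrite (der_plus _ (D nu)) by assumption; ring.
- rewrite <- sumG_mult_r, <- sumG_mult_l, <- sumG_plus; apply sumG_ext; intro nu.
  rewrite (der_mult _ (D nu)) by assumption; ring.
Qed.

Lemma derivation_Dgen i phi : (forall t, continuous phi t) -> derivation (Dgen i phi).
Proof.
intro Hphi.
assert (D := derivation_frame_op (Facc i phi) Hphi); assert (P := derivation_Pgen).
split; intros; rewrite !DgenE by assumption.
- f_equal; [now apply (der_ext _ D)|].
  apply sumG_ext; intro nu; f_equal; now apply (der_ext _ (P nu)).
- rewrite (der_const _ D) by assumption.
  rewrite (sumG_ext _ (fun _ => 0)); [unfold sumG, sumL; ring|].
  intro nu; rewrite (der_const _ (P nu)) by assumption; ring.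
- rewrite (der_plus _ D) by assumption.
  rewrite (sumG_ext _ (fun mu => Bvec (single i phi) mu p * Pgen mu G p +
      Bvec (single i phi) mu p * Pgen mu H p)); [rewrite sumG_plus; ring|].
  intro nu; rewrite (der_plus _ (P nu)) by assumption; ring.
- rewrite (der_mult _ D) by assumption.
  rewrite (sumG_ext _ (fun mu => Bvec (single i phi) mu p * Pgen mu G p * H p +
      G p * (Bvec (single i phi) mu p * Pgen mu H p)));
    [rewrite sumG_plus, sumG_mult_r, sumG_mult_l; ring|].
  intro nu; rewrite (der_mult _ (P nu)) by assumption; ring.
Qed.

Lemma frame_diff_kvec mu : frame_diff (kvec mu).
Proof. apply frame_diff_intro; intros E p HE Hp; eexists; now apply is_frame_k. Qed.

Lemma frame_diff_Bvec h mu : C0path h -> frame_diff (Bvec h mu).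
Proof. intro Hh; apply frame_diff_intro; intros E p HE Hp; eexists; now apply is_frame_B. Qed.

Lemma frame_diff_dn mu nu : frame_diff (fun p => dn (acc p) (tau p) mu nu).
Proof. apply frame_diff_intro; intros E p HE Hp; eexists; now apply is_frame_dn. Qed.

Lemma frame_diff_frame_op E F : frame_ok E -> Ck 2 F -> frame_diff (frame_op E F).
Proof. intros HE HF; now apply (Ck_frame_diff 0), (Ck_frame_op 1). Qed.

Lemma frame_diff_Pgen mu F : Ck 2 F -> frame_diff (Pgen mu F).
Proof.
intro HF.
apply (frame_diff_sumG (fun nu p => dn (acc p) (tau p) mu nu * frame_op (Fcoord nu) F p)); intro nu.
apply frame_diff_mult; [apply frame_diff_dn|now apply frame_diff_frame_op].
Qed.

Lemma frame_diff_Dgen i phi F : (forall t, continuous phi t) -> Ck 2 F -> frame_diff (Dgen i phi F).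
Proof.
intros Hphi HF.
apply (frame_diff_ext (fun p => frame_op (Facc i phi) F p
    + sumG (fun mu => Bvec (single i phi) mu p * Pgen mu F p))).
- intros q Hq; now rewrite DgenE.
- apply frame_diff_plus; [now apply frame_diff_frame_op|].
  apply (frame_diff_sumG (fun mu p => Bvec (single i phi) mu p * Pgen mu F p)); intro mu.
  apply frame_diff_mult; [now apply frame_diff_Bvec, C0path_single|now apply frame_diff_Pgen].
Qed.

Lemma frame_op_Pgen E nu F p : frame_ok E -> Ck 2 F -> inM p ->
  frame_op E (Pgen nu F) p = sumG (fun si => frame_dn E nu si p * frame_op (Fcoord si) F p
     + dn (acc p) (tau p) nu si * frame_op E (frame_op (Fcoord si) F) p).
Proof.
intros HE HF Hp; apply is_frame_unique; [exact Hp|].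
apply (is_frame_sumG E (fun nu0 p => dn (acc p) (tau p) nu nu0 * frame_op (Fcoord nu0) F p)); intro si.
apply is_frame_mult; [now apply is_frame_dn|now apply frame_diff_frame_op].
Qed.

(** The frame itself does not commute: [S4] says that [hatd_4, hatd_i] is a_i / lapse times hatd_4.
    The evolution of Lambda along tau, that is the W term of [frame_dn], cancels this. *)
Lemma Pgen_comm mu nu F p : Ck 2 F -> inM p -> Pgen mu (Pgen nu F) p = Pgen nu (Pgen mu F) p.
Proof.
intros HF Hp; assert (N := wt_pos (Fcoord Tm) p Hp); simpl wt in N.
assert (S4 : forall i, frame_op (Fcoord Tm) (frame_op (Fcoord (Sp i)) F) p =
  acc p i (tau p) * frame_op (Fcoord Tm) F p / lapse p
  + frame_op (Fcoord (Sp i)) (frame_op (Fcoord Tm) F) p).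
{ intro i; apply (Rmult_eq_reg_l (lapse p)); [|lra].
  assert (D : Fcoord (Sp i) <> Fcoord Tm) by discriminate.
  pose proof (frame_op_swap (Fcoord (Sp i)) (Fcoord Tm) F p D I I HF Hp) as H.
  cbn [wt dwt] in H; rewrite <- H; field; lra. }
assert (S3 : forall i j, frame_op (Fcoord (Sp i)) (frame_op (Fcoord (Sp j)) F) p =
  frame_op (Fcoord (Sp j)) (frame_op (Fcoord (Sp i)) F) p).
{ intros i j; pose proof (frame_op_swap (Fcoord (Sp i)) (Fcoord (Sp j)) F p) as H.
  simpl wt in H; simpl dwt in H; rewrite Rmult_0_l, Rplus_0_l, !Rmult_1_l in H.
  apply H; simpl; auto; discriminate. }
rewrite !PgenE, (sumG_ext _ _ (fun rho => f_equal _ (frame_op_Pgen (Fcoord rho) nu F p I HF Hp))).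
rewrite (sumG_ext (fun nu0 => _ * frame_op (Fcoord nu0) (Pgen mu F) p) _
  (fun rho => f_equal _ (frame_op_Pgen (Fcoord rho) mu F p I HF Hp))).
unfold sumG, sumL, frame_dn.
rewrite !S4, (S3 x2 x1), (S3 x3 x1), (S3 x3 x2).
unfold sumG, sumL; cbn [Wmat].
generalize (frame_op (Fcoord Tm) (frame_op (Fcoord Tm) F) p).
generalize (fun i => frame_op (Fcoord (Sp i)) (frame_op (Fcoord Tm) F) p).
generalize (fun i j => frame_op (Fcoord (Sp i)) (frame_op (Fcoord (Sp j)) F) p).
generalize (fun nu => frame_op (Fcoord nu) F p).
generalize (fun mu nu => dn (acc p) (tau p) mu nu).
intros; field; lra.
Qed.

Lemma Pgen_kvec mu nu p : inM p -> Pgen mu (kvec nu) p = deltaG mu nu.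
Proof.
intro Hp; rewrite PgenE.
transitivity (sumG (fun rho => Lam (acc p) (tau p) nu rho * dn (acc p) (tau p) mu rho)).
- apply sumG_ext; intro rho.
  rewrite (is_frame_unique _ _ _ _ Hp (is_frame_k (Fcoord rho) nu p I Hp)); simpl; ring.
- rewrite Lorentz_r by apply Hp; destruct mu as [[]|], nu as [[]|]; reflexivity.
Qed.

Lemma Dgen_kvec i phi nu p : (forall t, continuous phi t) -> inM p -> Dgen i phi (kvec nu) p = 0.
Proof.
intros Hphi Hp; rewrite DgenE by assumption.
rewrite (is_frame_unique _ _ _ _ Hp (is_frame_k (Facc i phi) nu p Hphi Hp)).
rewrite (sumG_ext _ (fun mu => Bvec (single i phi) mu p * deltaG mu nu)).
- rewrite sumG_delta_r; simpl; ring.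
- intro mu; now rewrite Pgen_kvec.
Qed.

Lemma Pgen_Bvec nu h mu p : C0path h -> inM p ->
  Pgen nu (Bvec h mu) p = - Ymat h (acc p) (tau p) mu nu
    - dn (acc p) (tau p) nu Tm * Lam (acc p) (tau p) mu Tm *
      sumL (fun i => h i (tau p) * xi p i) / lapse p.
Proof.
intros Hh Hp; rewrite PgenE.
rewrite (sumG_ext _ (fun si => dn (acc p) (tau p) nu si * frame_B (Fcoord si) h mu p)).
2: { intro si; f_equal; apply is_frame_unique; [exact Hp|now apply is_frame_B]. }
transitivity (- sumG (fun rho => Ymat h (acc p) (tau p) mu rho *
     sumG (fun si => Lam (acc p) (tau p) rho si * dn (acc p) (tau p) nu si))
   - dn (acc p) (tau p) nu Tm * Lam (acc p) (tau p) mu Tm *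
      sumL (fun i => h i (tau p) * xi p i) / lapse p).
- assert (N := wt_pos (Fcoord Tm) p Hp); simpl wt in N.
  unfold frame_B, sumG, sumL; cbn [deltaG]; field; lra.
- f_equal; f_equal.
  rewrite (sumG_ext _ (fun rho => Ymat h (acc p) (tau p) mu rho * deltaG rho nu)).
  + apply sumG_delta_r.
  + intro rho; now rewrite Lorentz_r by apply Hp.
Qed.

Lemma frame_op_of_Pgen F p si : inM p ->
  sumG (fun mu => Lam (acc p) (tau p) mu si * Pgen mu F p) = frame_op (Fcoord si) F p.
Proof.
intro Hp; transitivity (sumG (fun nu => sumG (fun mu => dn (acc p) (tau p) mu nu * Lam (acc p) (tau p) mu si)
   * frame_op (Fcoord nu) F p)).
- unfold Defs.Pgen, sumG, sumL; simpl; ring.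
- rewrite (sumG_ext _ (fun nu => deltaG si nu * frame_op (Fcoord nu) F p)).
  + apply sumG_delta_l.
  + intro nu; rewrite Lorentz_l by apply Hp; f_equal.
    destruct si as [[]|], nu as [[]|]; reflexivity.
Qed.

(** Two cancellations: the variation - Y of Lambda^-1 along h matches the Y term of P B, and the
    variation h . xi of the lapse, which enters when the functional derivative passes hatd_4,
    matches the Lambda_4 term of P B. *)
Lemma Dgen_Pgen_comm i phi nu F p : (forall t, continuous phi t) -> Ck 2 F -> inM p ->
  Dgen i phi (Pgen nu F) p = Pgen nu (Dgen i phi F) p.
Proof.
intros Hphi HF Hp; assert (N := wt_pos (Fcoord Tm) p Hp); simpl wt in N.
set (h := single i phi); assert (Hh : C0path h) by now apply C0path_single.
rewrite DgenE by assumption; fold h.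
rewrite (der_ext _ (derivation_Pgen nu) (Dgen i phi F) (fun p => frame_op (Facc i phi) F p
    + sumG (fun mu => Bvec h mu p * Pgen mu F p)) p Hp) by (intros; now apply DgenE).
rewrite (der_plus _ (derivation_Pgen nu) (frame_op (Facc i phi) F)
   (fun p => sumG (fun mu => Bvec h mu p * Pgen mu F p))); auto.
2: now apply frame_diff_frame_op.
2: { apply (frame_diff_sumG (fun mu p => Bvec h mu p * Pgen mu F p)); intro mu.
  apply frame_diff_mult; [now apply frame_diff_Bvec|now apply frame_diff_Pgen]. }
rewrite (der_sumG _ (derivation_Pgen nu) (fun mu p => Bvec h mu p * Pgen mu F p)); auto.
2: { intro mu; apply frame_diff_mult; [now apply frame_diff_Bvec|now apply frame_diff_Pgen]. }
rewrite (sumG_ext (fun mu => Pgen nu (fun p => Bvec h mu p * Pgen mu F p) p)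
  (fun mu => (- Ymat h (acc p) (tau p) mu nu
    - dn (acc p) (tau p) nu Tm * Lam (acc p) (tau p) mu Tm *
      sumL (fun i => h i (tau p) * xi p i) / lapse p) * Pgen mu F p
    + Bvec h mu p * Pgen mu (Pgen nu F) p)).
2: { intro mu; rewrite (der_mult _ (derivation_Pgen nu)); auto using frame_diff_Bvec, frame_diff_Pgen.
  now rewrite Pgen_Bvec, (Pgen_comm nu mu). }
rewrite frame_op_Pgen by auto.
rewrite (PgenE nu (frame_op (Facc i phi) F)).
assert (S3 : forall j, frame_op (Fcoord (Sp j)) (frame_op (Facc i phi) F) p =
   frame_op (Facc i phi) (frame_op (Fcoord (Sp j)) F) p).
{ intros j; pose proof (frame_op_swap (Facc i phi) (Fcoord (Sp j)) F p) as H.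
  simpl wt in H; simpl dwt in H; rewrite Rmult_0_l, Rplus_0_l, !Rmult_1_l in H.
  symmetry; apply H; simpl; auto; discriminate. }
assert (S4 : frame_op (Fcoord Tm) (frame_op (Facc i phi) F) p =
  sumL (fun k => h k (tau p) * xi p k) * frame_op (Fcoord Tm) F p / lapse p
  + frame_op (Facc i phi) (frame_op (Fcoord Tm) F) p).
{ apply (Rmult_eq_reg_l (lapse p)); [|lra].
  assert (D : Facc i phi <> Fcoord Tm) by discriminate.
  pose proof (frame_op_swap (Facc i phi) (Fcoord Tm) F p D Hphi I HF Hp) as H.
  cbn [wt dwt] in H; rewrite <- H.
  unfold h, single, sumL; destruct i; simpl; field; lra. }
rewrite (sumG_ext (fun nu0 => _ * frame_op (Fcoord nu0) (frame_op (Facc i phi) F) p)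
 (fun si => dn (acc p) (tau p) nu si * frame_op (Facc i phi) (frame_op (Fcoord si) F) p +
   deltaG Tm si * (dn (acc p) (tau p) nu Tm *
    (sumL (fun k => h k (tau p) * xi p k) * frame_op (Fcoord Tm) F p / lapse p)))).
2: { intros [j|]; [rewrite S3; simpl deltaG; ring|rewrite S4; simpl deltaG; ring]. }
rewrite <- (frame_op_of_Pgen F p Tm Hp).
rewrite (sumG_ext (fun si => frame_dn (Facc i phi) nu si p * _ + _)
 (fun si => - sumG (fun rho => Ymat h (acc p) (tau p) rho nu * dn (acc p) (tau p) rho si)
    * frame_op (Fcoord si) F p
    + dn (acc p) (tau p) nu si * frame_op (Facc i phi) (frame_op (Fcoord si) F) p)) by reflexivity.
rewrite !sumG_plus, sumG_delta_l.
assert (E : sumG (fun mu => - sumG (fun rho => Ymat h (acc p) (tau p) rho nu * dn (acc p) (tau p) rho mu)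
    * frame_op (Fcoord mu) F p) = sumG (fun mu => - Ymat h (acc p) (tau p) mu nu * Pgen mu F p)).
{ rewrite (sumG_ext (fun mu => - Ymat h (acc p) (tau p) mu nu * Pgen mu F p)
   (fun mu => - Ymat h (acc p) (tau p) mu nu *
      sumG (fun si => dn (acc p) (tau p) mu si * frame_op (Fcoord si) F p))) by reflexivity.
  unfold sumG, sumL; ring. }
rewrite E; unfold sumG, sumL; field; lra.
Qed.

(** [K] expands one order of the product into terms whose sum is symmetric in the two smeared
    generators: by [frame_op_swap], by exchange of the second and third sums, by [frame_B_sym], and
    by [Pgen_comm]. *)
Lemma Dgen_comm i phi j psi F p :
  (forall t, continuous phi t) -> (forall t, continuous psi t) -> Ck 2 F -> inM p ->
  Dgen i phi (Dgen j psi F) p = Dgen j psi (Dgen i phi F) p.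
Proof.
assert (K : forall i phi j psi, (forall t, continuous phi t) -> (forall t, continuous psi t) ->
  Ck 2 F -> inM p -> Dgen i phi (Dgen j psi F) p =
  frame_op (Facc i phi) (frame_op (Facc j psi) F) p
  + sumG (fun mu => Bvec (single i phi) mu p * Pgen mu (frame_op (Facc j psi) F) p)
  + sumG (fun mu => Bvec (single j psi) mu p * Pgen mu (frame_op (Facc i phi) F) p)
  + sumG (fun mu => (frame_B (Facc i phi) (single j psi) mu p
       + sumG (fun nu => Bvec (single i phi) nu p * Pgen nu (Bvec (single j psi) mu) p
           + Bvec (single j psi) nu p * Pgen nu (Bvec (single i phi) mu) p)) * Pgen mu F p)
  + sumG (fun mu => sumG (fun nu => Bvec (single j psi) mu p * Bvec (single i phi) nu p
       * Pgen mu (Pgen nu F) p))).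
{ clear i phi j psi; intros i phi j psi Hphi Hpsi HF Hp.
  set (h := single i phi); assert (Hh : C0path h) by now apply C0path_single.
  set (g := single j psi); assert (Hg : C0path g) by now apply C0path_single.
  assert (DD := derivation_Dgen i phi Hphi).
  rewrite (der_ext _ DD (Dgen j psi F) (fun p => frame_op (Facc j psi) F p
    + sumG (fun mu => Bvec g mu p * Pgen mu F p)) p Hp) by (intros; now apply DgenE).
  rewrite (der_plus _ DD (frame_op (Facc j psi) F) (fun p => sumG (fun mu => Bvec g mu p * Pgen mu F p))); auto.
  2: now apply frame_diff_frame_op.
  2: { apply (frame_diff_sumG (fun mu p => Bvec g mu p * Pgen mu F p)); intro mu.
    apply frame_diff_mult; [now apply frame_diff_Bvec|now apply frame_diff_Pgen]. }
  rewrite (der_sumG _ DD (fun mu p => Bvec g mu p * Pgen mu F p)); auto.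
  2: { intro mu; apply frame_diff_mult; [now apply frame_diff_Bvec|now apply frame_diff_Pgen]. }
  rewrite (sumG_ext (fun mu => Dgen i phi (fun p => Bvec g mu p * Pgen mu F p) p)
   (fun mu => (frame_B (Facc i phi) g mu p + sumG (fun nu => Bvec h nu p * Pgen nu (Bvec g mu) p))
      * Pgen mu F p + Bvec g mu p * (Pgen mu (frame_op (Facc i phi) F) p +
        sumG (fun nu => Pgen mu (Bvec h nu) p * Pgen nu F p + Bvec h nu p * Pgen mu (Pgen nu F) p)))).
  2: { intro mu; rewrite (der_mult _ DD); auto using frame_diff_Bvec, frame_diff_Pgen.
    f_equal.
    - f_equal; rewrite DgenE by assumption; f_equal.
      apply is_frame_unique; [exact Hp|now apply is_frame_B].
    (* Exchanging D and P first leaves P acting on the functional derivative of F, the mirror image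
       of a term produced by the outer D. *)
    - f_equal; rewrite Dgen_Pgen_comm by assumption.
      rewrite (der_ext _ (derivation_Pgen mu) (Dgen i phi F) (fun p => frame_op (Facc i phi) F p
        + sumG (fun mu => Bvec h mu p * Pgen mu F p)) p Hp) by (intros; now apply DgenE).
      rewrite (der_plus _ (derivation_Pgen mu) (frame_op (Facc i phi) F)
        (fun p => sumG (fun mu => Bvec h mu p * Pgen mu F p))); auto.
      2: now apply frame_diff_frame_op.
      2: { apply (frame_diff_sumG (fun mu p => Bvec h mu p * Pgen mu F p)); intro nu.
        apply frame_diff_mult; [now apply frame_diff_Bvec|now apply frame_diff_Pgen]. }
      f_equal; rewrite (der_sumG _ (derivation_Pgen mu) (fun mu p => Bvec h mu p * Pgen mu F p)); auto.
      2: { intro nu; apply frame_diff_mult; [now apply frame_diff_Bvec|now apply frame_diff_Pgen]. }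
      apply sumG_ext; intro nu.
      now rewrite (der_mult _ (derivation_Pgen mu)) by auto using frame_diff_Bvec, frame_diff_Pgen. }
  rewrite DgenE by assumption; fold h.
  unfold sumG, sumL; ring. }
intros Hphi Hpsi HF Hp; rewrite !K by assumption.
assert (S : frame_op (Facc i phi) (frame_op (Facc j psi) F) p =
   frame_op (Facc j psi) (frame_op (Facc i phi) F) p).
{ pose proof (frame_op_swap (Facc i phi) (Facc j psi) F p) as H.
  simpl wt in H; simpl dwt in H; rewrite Rmult_0_l, Rplus_0_l, !Rmult_1_l in H.
  apply H; simpl; auto; discriminate. }
rewrite S, (sumG_exchange (fun mu nu => Bvec (single i phi) mu p * Bvec (single j psi) nu p
       * Pgen mu (Pgen nu F) p)).
rewrite (sumG_ext (fun nu => sumG (fun mu => Bvec (single i phi) mu p * Bvec (single j psi) nu p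
       * Pgen mu (Pgen nu F) p)) (fun nu => sumG (fun mu => Bvec (single j psi) nu p
       * Bvec (single i phi) mu p * Pgen nu (Pgen mu F) p))).
2: { intro nu; apply sumG_ext; intro mu; rewrite (Pgen_comm nu mu) by assumption; ring. }
rewrite (sumG_ext (fun mu => (frame_B (Facc j psi) _ mu p + _) * _) (fun mu => (frame_B (Facc i phi) (single j psi) mu p
       + sumG (fun nu => Bvec (single i phi) nu p * Pgen nu (Bvec (single j psi) mu) p
           + Bvec (single j psi) nu p * Pgen nu (Bvec (single i phi) mu) p)) * Pgen mu F p)).
2: { intro mu; rewrite (frame_B_sym j psi i phi) by assumption; f_equal; f_equal.
  apply sumG_ext; intro nu; ring. }
ring.
Qed.

(** * The Lorentz generators and the general transformation *)

Lemma frame_diff_kvec_dn be : frame_diff (kvec_dn be).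
Proof.
apply (frame_diff_sumG (fun al p => eta be al * kvec al p)); intro al.
apply frame_diff_mult; [apply frame_diff_const|now apply frame_diff_kvec].
Qed.

Lemma der_kvec_dn X be p : derivation X -> inM p ->
  X (kvec_dn be) p = sumG (fun al => eta be al * X (kvec al) p).
Proof.
intros HX Hp.
transitivity (sumG (fun al => X (fun p => eta be al * kvec al p) p)).
- apply (der_sumG X HX (fun al p => eta be al * kvec al p) p Hp); intro al.
  apply frame_diff_mult; [apply frame_diff_const|now apply frame_diff_kvec].
- apply sumG_ext; intro al; apply (der_scal X HX); [exact Hp|now apply frame_diff_kvec].
Qed.

Lemma Pgen_kvec_dn mu be p : inM p -> Pgen mu (kvec_dn be) p = eta be mu.
Proof.
intro Hp; rewrite der_kvec_dn by (auto; now apply derivation_Pgen).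
rewrite (sumG_ext _ (fun al => eta be al * deltaG al mu)); [apply sumG_delta_r|].
intro al; rewrite Pgen_kvec by assumption; destruct mu as [[]|], al as [[]|]; reflexivity.
Qed.

Lemma Dgen_kvec_dn i phi be p : (forall t, continuous phi t) -> inM p ->
  Dgen i phi (kvec_dn be) p = 0.
Proof.
intros Hphi Hp; rewrite der_kvec_dn by (auto; now apply derivation_Dgen).
rewrite (sumG_ext _ (fun _ => 0)); [unfold sumG, sumL; ring|].
intro al; rewrite Dgen_kvec by assumption; ring.
Qed.

Lemma der_Jgen X al be F p : derivation X -> Ck 2 F -> inM p ->
  X (Jgen al be F) p =
  X (kvec_dn be) p * Pgen al F p + kvec_dn be p * X (Pgen al F) p
  - (X (kvec_dn al) p * Pgen be F p + kvec_dn al p * X (Pgen be F) p).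
Proof.
intros HX HF Hp; unfold Defs.Jgen.
assert (Hk := frame_diff_kvec_dn); assert (HP := fun mu => frame_diff_Pgen mu F HF).
rewrite (der_minus X HX (fun p => kvec_dn be p * Pgen al F p) (fun p => kvec_dn al p * Pgen be F p));
  auto using frame_diff_mult.
rewrite !(der_mult X HX) by auto; ring.
Qed.

Lemma Jgen_Pgen_comm al be mu :
  op_eq (comm (Jgen al be) (Pgen mu))
        (fun F p => eta mu al * Pgen be F p - eta mu be * Pgen al F p).
Proof.
intros F HF p Hp; unfold comm.
rewrite (der_Jgen (Pgen mu)) by (auto; now apply derivation_Pgen).
rewrite !Pgen_kvec_dn by assumption; unfold Defs.Jgen.
rewrite (Pgen_comm mu al), (Pgen_comm mu be) by assumption.
rewrite (eta_sym mu al), (eta_sym mu be); ring.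
Qed.

Lemma Jgen_comm al be mu nu :
  op_eq (comm (Jgen al be) (Jgen mu nu))
        (fun F p => eta mu al * Jgen be nu F p - eta mu be * Jgen al nu F p
                  - eta nu al * Jgen be mu F p + eta nu be * Jgen al mu F p).
Proof.
intros F HF p Hp; unfold comm.
assert (E : forall al be mu nu, Jgen al be (Jgen mu nu F) p =
  kvec_dn be p * Pgen al (Jgen mu nu F) p - kvec_dn al p * Pgen be (Jgen mu nu F) p) by reflexivity.
rewrite !E, !der_Jgen by (auto; now apply derivation_Pgen).
rewrite !Pgen_kvec_dn by assumption; unfold Defs.Jgen.
rewrite (Pgen_comm mu al), (Pgen_comm mu be), (Pgen_comm nu al),
  (Pgen_comm nu be) by assumption.
rewrite !(eta_sym mu), !(eta_sym nu); ring.
Qed.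

Lemma Dgen_Jgen_comm i phi al be : (forall t, continuous phi t) ->
  op_eq (comm (Dgen i phi) (Jgen al be)) op_zero.
Proof.
intros Hphi F HF p Hp; unfold comm, op_zero.
rewrite der_Jgen by (auto; now apply derivation_Dgen).
rewrite !Dgen_kvec_dn by assumption; unfold Defs.Jgen.
rewrite !Dgen_Pgen_comm by assumption; ring.
Qed.

(** By antisymmetry of Om, half the sum of Om J collapses to Om^{mu be} k_be P_mu. Without its D
    part, X is therefore the affine vector field f + Om k in the inertial coordinates. *)
Definition Xcoef (th : param) (mu : Greek) : field := fun p =>
  par_f (fst th) mu + sumG (fun be => par_Om (fst th) mu be * kvec_dn be p).

Lemma XgenE th F p : Xgen th F p =
  sumG (fun mu => Xcoef th mu p * Pgen mu F p) + sumL (fun i => Dgen i (par_A th i) F p).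
Proof.
unfold Defs.Xgen; f_equal.
assert (Ho : antisym (par_Om (fst th))) by exact (proj2_sig (snd (fst th))).
assert (E : sumG (fun al => sumG (fun be => par_Om (fst th) al be * Jgen al be F p)) =
  2 * sumG (fun al => sumG (fun be => par_Om (fst th) al be * kvec_dn be p) * Pgen al F p)).
{ transitivity (sumG (fun al => sumG (fun be => par_Om (fst th) al be * kvec_dn be p) * Pgen al F p)
   - sumG (fun al => sumG (fun be => par_Om (fst th) be al * kvec_dn be p) * Pgen al F p)).
  - unfold Defs.Jgen, sumG, sumL; ring.
  - rewrite (sumG_ext (fun al => sumG (fun be => par_Om (fst th) be al * kvec_dn be p) * Pgen al F p)
     (fun al => -1 * (sumG (fun be => par_Om (fst th) al be * kvec_dn be p) * Pgen al F p))).
    + rewrite sumG_mult_l; ring.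
    + intro al.
      rewrite (sumG_ext (fun be => par_Om (fst th) be al * kvec_dn be p)
        (fun be => -1 * (par_Om (fst th) al be * kvec_dn be p))).
      * rewrite sumG_mult_l; ring.
      * intro be; rewrite (Ho be al); ring. }
rewrite E; unfold Xcoef, sumG, sumL; field.
Qed.

Lemma frame_diff_Xcoef th mu : frame_diff (Xcoef th mu).
Proof.
apply frame_diff_plus; [apply frame_diff_const|].
apply (frame_diff_sumG (fun be p => par_Om (fst th) mu be * kvec_dn be p)); intro be.
apply frame_diff_mult; [apply frame_diff_const|apply frame_diff_kvec_dn].
Qed.

Lemma der_Xcoef X th mu p : derivation X -> inM p ->
  X (Xcoef th mu) p = sumG (fun be => par_Om (fst th) mu be * X (kvec_dn be) p).
Proof.
intros HX Hp; unfold Xcoef.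
assert (D : forall be, frame_diff (fun p => par_Om (fst th) mu be * kvec_dn be p))
  by (intro; apply frame_diff_mult; [apply frame_diff_const|apply frame_diff_kvec_dn]).
rewrite (der_plus X HX (fun _ => par_f (fst th) mu)
  (fun p => sumG (fun be => par_Om (fst th) mu be * kvec_dn be p))); auto using frame_diff_const.
2: now apply (frame_diff_sumG (fun be p => par_Om (fst th) mu be * kvec_dn be p)).
rewrite (der_const X HX) by assumption.
rewrite (der_sumG X HX (fun be p => par_Om (fst th) mu be * kvec_dn be p)) by assumption.
rewrite Rplus_0_l; apply sumG_ext; intro be; apply (der_scal X HX); auto using frame_diff_kvec_dn.
Qed.

Lemma C0path_par_A th i t : continuous (par_A th i) t.
Proof. exact (proj2_sig (snd th) i t). Qed.

Lemma der_Xgen X th F p : derivation X -> Ck 2 F -> inM p ->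
  X (Xgen th F) p =
  sumG (fun mu => X (Xcoef th mu) p * Pgen mu F p + Xcoef th mu p * X (Pgen mu F) p)
  + sumL (fun i => X (Dgen i (par_A th i) F) p).
Proof.
intros HX HF Hp.
assert (HP := fun mu => frame_diff_Pgen mu F HF).
assert (HD := fun i => frame_diff_Dgen i (par_A th i) F (C0path_par_A th i) HF).
assert (HQ : forall mu, frame_diff (fun p => Xcoef th mu p * Pgen mu F p))
  by (intro; apply frame_diff_mult; auto using frame_diff_Xcoef).
rewrite (der_ext X HX _ (fun p => sumG (fun mu => Xcoef th mu p * Pgen mu F p)
   + sumL (fun i => Dgen i (par_A th i) F p)) p Hp) by (intros; apply XgenE).
rewrite (der_plus X HX (fun p => sumG (fun mu => Xcoef th mu p * Pgen mu F p))
  (fun p => sumL (fun i => Dgen i (par_A th i) F p))); auto.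
2: now apply (frame_diff_sumG (fun mu p => Xcoef th mu p * Pgen mu F p)).
2: now apply (frame_diff_sumL (fun i => Dgen i (par_A th i) F)).
rewrite (der_sumG X HX (fun mu p => Xcoef th mu p * Pgen mu F p)) by auto.
rewrite (der_sumL X HX (fun i => Dgen i (par_A th i) F)) by auto.
f_equal; apply sumG_ext; intro mu; apply (der_mult X HX); auto using frame_diff_Xcoef.
Qed.

(** A bracket of two generators has zero acceleration part; this removes the corresponding D
    terms. *)
Lemma Dgen_zero i F p : inM p -> Dgen i (fun _ => 0) F p = 0.
Proof.
intro Hp; rewrite DgenE by (auto; intro; apply continuous_const_R).
assert (E0 : frame_op (Facc i (fun _ => 0)) F p = 0).
{ apply is_frame_unique; [exact Hp|]; unfold is_frame; rewrite Rmult_0_r.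
  apply (is_derive_ext_R (fun _ => F p)); [|apply is_derive_const_R].
  intro s; f_equal; apply point_eq; intros; simpl; ring. }
assert (ES : forall t mu nu, Smat (single i (fun _ => 0)) (acc p) t mu nu = 0)
  by (intros; unfold Smat, single, sumL; ring).
assert (EB : forall mu, Bvec (single i (fun _ => 0)) mu p = 0).
{ intro mu; unfold Bvec, Ymat, Uvec.
  rewrite (RInt_ext_R _ (fun _ => 0)) by (intro; unfold sumG, sumL; rewrite !ES; ring).
  rewrite RInt_zero_R, (sumG_ext _ (fun _ => 0)); [unfold sumG, sumL; ring|].
  intro nu; rewrite (RInt_ext_R _ (fun _ => 0)) by (intro; apply ES).
  rewrite RInt_zero_R; ring. }
rewrite E0, (sumG_ext _ (fun _ => 0)); [unfold sumG, sumL; ring|].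
intro mu; rewrite EB; ring.
Qed.

(** D annihilates k and hence [Xcoef]. In the expansion [K] the terms with P P, P D and D D become
    symmetric in th and th' by the commutation lemmas, so the difference keeps only the first sum,
    where P differentiates k: the commutator of two affine vector fields. *)
Lemma Xgen_comm th th' : op_eq (comm (Xgen th) (Xgen th')) (Xgen (param_br th th')).
Proof.
intros F HF p Hp; unfold comm.
assert (K : forall th th', Xgen th (Xgen th' F) p =
  sumG (fun mu => sumG (fun nu => Xcoef th nu p *
     sumG (fun be => par_Om (fst th') mu be * eta be nu)) * Pgen mu F p)
  + sumG (fun mu => sumG (fun nu => Xcoef th nu p * Xcoef th' mu p * Pgen nu (Pgen mu F) p))
  + sumL (fun i => sumG (fun mu => Xcoef th mu p * Pgen mu (Dgen i (par_A th' i) F) p))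
  + sumL (fun i => sumG (fun mu => Xcoef th' mu p * Pgen mu (Dgen i (par_A th i) F) p))
  + sumL (fun i => sumL (fun j => Dgen i (par_A th i) (Dgen j (par_A th' j) F) p))).
{ clear th th'; intros th th'; rewrite XgenE.
  rewrite (sumG_ext _ (fun nu => Xcoef th nu p * (
    sumG (fun mu => sumG (fun be => par_Om (fst th') mu be * eta be nu) * Pgen mu F p
      + Xcoef th' mu p * Pgen nu (Pgen mu F) p)
    + sumL (fun i => Pgen nu (Dgen i (par_A th' i) F) p)))).
  2: { intro nu; f_equal; rewrite (der_Xgen (Pgen nu)) by (auto; now apply derivation_Pgen).
    f_equal; apply sumG_ext; intro mu.
    rewrite der_Xcoef by (auto; now apply derivation_Pgen).
    f_equal; f_equal; apply sumG_ext; intro be; now rewrite Pgen_kvec_dn. }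
  rewrite (sumL_ext _ (fun i => sumG (fun mu => Xcoef th' mu p * Pgen mu (Dgen i (par_A th i) F) p)
    + sumL (fun j => Dgen i (par_A th i) (Dgen j (par_A th' j) F) p))).
  2: { intro i; assert (HA := C0path_par_A th i).
    rewrite (der_Xgen (Dgen i _)) by (auto; now apply derivation_Dgen).
    f_equal; apply sumG_ext; intro mu.
    rewrite der_Xcoef by (auto; now apply derivation_Dgen).
    rewrite (sumG_ext _ (fun _ => 0)), Dgen_Pgen_comm; auto.
    - unfold sumG, sumL; ring.
    - intro be; rewrite Dgen_kvec_dn by assumption; ring. }
  unfold sumG, sumL; ring. }
rewrite !K, (XgenE (param_br th th')).
rewrite (sumL_ext (fun i => Dgen i (par_A (param_br th th') i) F p) (fun _ => 0)).
2: { intro i; exact (Dgen_zero i F p Hp). }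
rewrite (sumG_ext (fun mu => sumG (fun nu => Xcoef th nu p * Xcoef th' mu p * _))
  (fun mu => sumG (fun nu => Xcoef th nu p * Xcoef th' mu p * Pgen mu (Pgen nu F) p))).
2: { intro mu; apply sumG_ext; intro nu; now rewrite (Pgen_comm nu mu). }
rewrite (sumG_exchange (fun mu nu => Xcoef th nu p * Xcoef th' mu p * Pgen mu (Pgen nu F) p)).
rewrite (sumG_ext (fun nu => sumG (fun mu => Xcoef th nu p * Xcoef th' mu p * _))
  (fun mu => sumG (fun nu => Xcoef th' nu p * Xcoef th mu p * Pgen nu (Pgen mu F) p))).
2: { intro mu; apply sumG_ext; intro nu; ring. }
rewrite (sumL_ext (fun i => sumL (fun j => Dgen i (par_A th' i) _ p)) 
  (fun i => sumL (fun j => Dgen j (par_A th j) (Dgen i (par_A th' i) F) p))).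
2: { intro i; apply sumL_ext; intro j; apply Dgen_comm; auto; apply C0path_par_A. }
rewrite (sumG_ext (fun mu => Xcoef (param_br th th') mu p * _) (fun mu =>
   (sumG (fun nu => Xcoef th nu p * sumG (fun be => par_Om (fst th') mu be * eta be nu))
   - sumG (fun nu => Xcoef th' nu p * sumG (fun be => par_Om (fst th) mu be * eta be nu)))
     * Pgen mu F p)).
2: { intro mu; f_equal; unfold Xcoef.
  assert (E1 : par_f (fst (param_br th th')) mu = - poincare_br_f (fst th) (fst th') mu) by reflexivity.
  assert (E2 : forall be, par_Om (fst (param_br th th')) mu be = - poincare_br_Om (fst th) (fst th') mu be)
    by reflexivity.
  unfold sumG, sumL; rewrite E1, !E2.
  unfold poincare_br_f, poincare_br_Om, tens_mul, tens_act, sumG, sumL; cbn [eta deltaL].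
  generalize (par_Om (fst th)), (par_Om (fst th')), (par_f (fst th)), (par_f (fst th')); intros; ring. }
unfold sumG, sumL; ring.
Qed.

(** * The generator on the coordinate functions, and its faithfulness *)

Lemma Pgen_coord_xi mu j p : Pgen mu (coord_xi j) p = dn (acc p) (tau p) mu (Sp j).
Proof.
rewrite PgenE; unfold sumG, sumL; rewrite !(proj1 (coord_xi_frame j)).
destruct j; simpl; ring.
Qed.

Lemma Pgen_coord_acc mu j t p : Pgen mu (coord_acc j t) p = 0.
Proof.
rewrite PgenE; unfold sumG, sumL; rewrite !(proj1 (coord_acc_frame j t)); simpl; ring.
Qed.

Lemma XgenE_frame th F p : inM p -> Xgen th F p =
  sumG (fun mu => (Xcoef th mu p + Bvec (par_A th) mu p) * Pgen mu F p)
  + sumL (fun i => frame_op (Facc i (par_A th i)) F p).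
Proof.
intro Hp; rewrite XgenE.
rewrite (sumL_ext _ _ (fun i => DgenE i _ F p (C0path_par_A th i) Hp)).
assert (E : forall mu, Bvec (par_A th) mu p = sumL (fun i => Bvec (single i (par_A th i)) mu p)).
{ intro mu; unfold Bvec.
  rewrite <- (Uvec_single (par_A th)) by first [exact (C0path_par_A th)|apply Hp].
  rewrite (sumG_ext _ (fun nu => sumL (fun i => Ymat (single i (par_A th i)) (acc p) (tau p) mu nu)
     * kvec nu p)).
  - unfold sumG, sumL; ring.
  - intro nu; rewrite (Ymat_single (par_A th)); auto; [exact (C0path_par_A th)|apply Hp]. }
rewrite (sumG_ext (fun mu => (Xcoef th mu p + Bvec (par_A th) mu p) * Pgen mu F p)
  (fun mu => (Xcoef th mu p + sumL (fun i => Bvec (single i (par_A th i)) mu p))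
   * Pgen mu F p)) by (intro; now rewrite E).
unfold sumG, sumL; ring.
Qed.

Lemma Xgen_coord_xi th j p : inM p -> Xgen th (coord_xi j) p =
  sumG (fun mu => (Xcoef th mu p + Bvec (par_A th) mu p) * dn (acc p) (tau p) mu (Sp j)).
Proof.
intro Hp; rewrite XgenE_frame by exact Hp.
rewrite (sumL_ext _ (fun _ => 0)).
- rewrite (sumG_ext _ _ (fun mu => f_equal _ (Pgen_coord_xi mu j p))); unfold sumL; ring.
- intro i; now rewrite (proj1 (coord_xi_frame j)).
Qed.

Lemma Xgen_coord_acc th j t p : inM p -> Xgen th (coord_acc j t) p = par_A th j t.
Proof.
intro Hp; rewrite XgenE_frame by exact Hp.
rewrite (sumG_ext _ _ (fun mu => f_equal _ (Pgen_coord_acc mu j t p))).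
unfold sumL; rewrite !(proj1 (coord_acc_frame j t)); unfold sumG, sumL.
destruct j; simpl; ring.
Qed.

Definition const_path (c : R) : path := fun i _ => deltaL x1 i * c.

Lemma C0path_const c : C0path (const_path c).
Proof. intros i t; apply continuous_const_R. Qed.

Lemma const_path_0 i t : const_path 0 i t = 0.
Proof. apply Rmult_0_r. Qed.

Lemma Lam_const_path_0 t mu nu : Lam (const_path 0) t mu nu = deltaG mu nu.
Proof.
apply (eq_of_is_derive (fun t => Lam (const_path 0) t mu nu) (fun _ => deltaG mu nu) (fun _ => 0)).
- apply Lam_0, C0path_const.
- intro s; eapply is_derive_eq; [apply is_derive_Lam, C0path_const|].
  rewrite (sumG_ext _ (fun _ => 0)); [unfold sumG, sumL; ring|].
  intro be; destruct be, nu; simpl; rewrite ?const_path_0; ring.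
- intro; apply is_derive_const_R.
Qed.

(** The functions xi^j and a_j(t) are tested; tau is not of class C^2 in this frame, its derivative
    1 / lapse being in general not differentiable. The a_j(t) give A, and at zero acceleration,
    where Lambda = 1, the xi^j give everything else except f^4. *)
Lemma Xgen_faithful th th' : op_eq (Xgen th) (Xgen th') -> th = th'.
Proof.
intro H.
assert (M0 : forall c x t, (forall i, c * x i = 0) -> inM (mkPoint x t (const_path c))).
{ intros c x t Hx; split; [apply C0path_const|].
  unfold lapse, sumL, const_path; simpl; specialize (Hx x1); nra. }
assert (EA : snd th = snd th').
{ apply (@subV_eq paths C0path).
  apply functional_extensionality; intro j; apply functional_extensionality; intro t.
  assert (Hp : inM (mkPoint (fun _ => 0) 0 (const_path 0))) by (apply M0; intro; ring).
  pose proof (H (coord_acc j t) (proj2 (coord_acc_frame j t) 2%nat) _ Hp) as E.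
  now rewrite !Xgen_coord_acc in E by exact Hp. }
set (f mu := par_f (fst th) mu - par_f (fst th') mu).
set (O mu nu := par_Om (fst th) mu nu - par_Om (fst th') mu nu).
assert (HO : forall mu nu, O mu nu = - O nu mu).
{ intros mu nu; unfold O.
  assert (U : antisym (par_Om (fst th))) by exact (proj2_sig (snd (fst th))).
  assert (U' : antisym (par_Om (fst th'))) by exact (proj2_sig (snd (fst th'))).
  rewrite (U mu), (U' mu); ring. }
assert (K : forall j p, inM p -> sumG (fun mu => (f mu + sumG (fun be => O mu be * kvec_dn be p))
    * dn (acc p) (tau p) mu (Sp j)) = 0).
{ intros j p Hp.
  pose proof (H (coord_xi j) (proj2 (coord_xi_frame j) 2%nat) p Hp) as E.
  rewrite !Xgen_coord_xi in E by exact Hp.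
  assert (EB : par_A th = par_A th') by (unfold par_A; now rewrite EA).
  rewrite EB in E; apply Rminus_diag_eq in E; rewrite <- E.
  unfold Xcoef, f, O, sumG, sumL; ring. }
assert (dn0 : forall t mu nu, dn (const_path 0) t mu nu = deltaG mu nu).
{ intros t mu nu; rewrite Lam_dn_upE, Lam_const_path_0.
  destruct mu as [[]|], nu as [[]|]; unfold sg; simpl; ring. }
assert (k0 : forall x t be, kvec_dn be (mkPoint x t (const_path 0)) =
  match be with Sp i => x i | Tm => - t end).
{ intros x t be; unfold Defs.kvec_dn, Defs.kvec; cbn [xi tau acc].
  assert (Z : forall al, RInt (fun t' => Lam (const_path 0) t' al Tm) 0 t = deltaG al Tm * t).
  { intro al; rewrite (RInt_ext_R _ (fun _ => deltaG al Tm)) by (intro; apply Lam_const_path_0).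
    rewrite (RInt_const (V := R_CompleteNormedModule)); change ((t - 0) * deltaG al Tm = deltaG al Tm * t); ring. }
  unfold sumG, sumL; rewrite !Z, !Lam_const_path_0; destruct be as [[]|]; simpl; ring. }
assert (K0 : forall j x t, f (Sp j) + sumL (fun i => O (Sp j) (Sp i) * x i) - O (Sp j) Tm * t = 0).
{ intros j x t.
  assert (Hp : inM (mkPoint x t (const_path 0))) by (apply M0; intro; ring).
  pose proof (K j _ Hp) as E; cbn [xi tau acc] in E; unfold sumG, sumL in E.
  rewrite !dn0, !k0 in E; unfold sumL.
  destruct j; simpl in E; ring_simplify in E; lra. }
assert (f0 : forall j, f (Sp j) = 0).
{ intro j; pose proof (K0 j (fun _ => 0) 0) as E; unfold sumL in E; lra. }
assert (O1 : forall i j, O (Sp j) (Sp i) = 0).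
{ intros i j; pose proof (K0 j (deltaL i) 0) as E; rewrite f0 in E; unfold sumL in E.
  destruct i; simpl in E; lra. }
assert (O2 : forall j, O (Sp j) Tm = 0).
{ intro j; pose proof (K0 j (fun _ => 0) 1) as E; rewrite f0 in E; unfold sumL in E; lra. }
assert (O3 : forall mu nu, O mu nu = 0).
{ intros [i|] [j|]; auto.
  - rewrite HO, O2; ring.
  - pose proof (HO Tm Tm); lra. }
assert (f4 : f Tm = 0).
(* For an accelerated origin P_4 acquires a component along xi^1: its coefficient has derivative - 1
   at t = 0, which makes f^4 visible without using tau. *)
{ set (a := const_path 1).
  assert (E : forall t, f Tm * dn a t Tm (Sp x1) = 0).
  { intro t; assert (Hp : inM (mkPoint (fun _ => 0) t a)) by (apply M0; intro; ring).
    pose proof (K x1 _ Hp) as E; cbn [xi tau acc] in E; unfold sumG, sumL in E.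
    rewrite !O3, !f0 in E; lra. }
  assert (Ha : C0path a) by apply C0path_const.
  pose proof (is_derive_scal_R _ (f Tm) _ _ (is_derive_dn a 0 Tm (Sp x1) Ha)) as D.
  assert (D0 : is_derive (fun t => f Tm * dn a t Tm (Sp x1)) 0 0).
  { apply (is_derive_ext_R (fun _ => 0)); [intro; now rewrite E|apply is_derive_const_R]. }
  pose proof (eq_trans (eq_sym (is_derive_unique _ _ _ D0)) (is_derive_unique _ _ _ D)) as U.
  unfold sumG, sumL in U; rewrite !dn_0 in U by exact Ha.
  unfold a, const_path in U; simpl in U; lra. }
assert (EP : fst th = fst th').
{ apply poincare_eq.
  - intros [j|]; [pose proof (f0 j) as E|pose proof f4 as E]; unfold f in E; lra.
  - intros mu nu; pose proof (O3 mu nu) as E; unfold O in E; lra. }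
destruct th, th'; simpl in *; now subst.
Qed.

(** * Infinitesimal transformations at a fixed acceleration *)

(* The components of the generator X along the normalized frame. *)
Definition zeta (th : param) (rho : Greek) : field := fun p =>
  sumG (fun mu => (Xcoef th mu p + Bvec (par_A th) mu p) * dn (acc p) (tau p) mu rho).

Lemma Xgen_coord_tau th p : inM p -> Xgen th coord_tau p = zeta th Tm p / lapse p.
Proof.
intro Hp; assert (N := wt_pos (Fcoord Tm) p Hp); simpl wt in N.
assert (E : forall E, frame_op E coord_tau p = match E with Fcoord Tm => / lapse p | _ => 0 end).
{ intro E; apply is_frame_unique; [exact Hp|]; unfold is_frame, coord_tau.
  destruct E as [[i|]|i phi]; simpl; auto_derive; auto; field; lra. }
rewrite XgenE_frame by assumption.
rewrite (sumL_ext _ (fun _ => 0)) by (intro; now rewrite E).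
rewrite (sumG_ext _ (fun mu => (Xcoef th mu p + Bvec (par_A th) mu p) * (dn (acc p) (tau p) mu Tm / lapse p))).
- unfold zeta, sumG, sumL; field; lra.
- intro mu; f_equal; rewrite PgenE; unfold sumG, sumL; rewrite !E; field; lra.
Qed.

(* The gradient of the coefficients of X, in mixed components. *)
Definition grad (th : param) (a : path) (t : R) (mu si : Greek) : R :=
  par_Om (fst th) mu si * sg si - Ymat (par_A th) a t mu si.

Lemma grad_antisym th a t mu nu : C0path a ->
  sg nu * grad th a t mu nu = - (sg mu * grad th a t nu mu).
Proof.
intro Ha; unfold grad.
pose proof (Ymat_antisym (par_A th) a t mu nu (C0path_par_A th) Ha) as E.
assert (Ho : par_Om (fst th) mu nu = - par_Om (fst th) nu mu) by exact (proj2_sig (snd (fst th)) mu nu).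
transitivity (par_Om (fst th) mu nu * (sg nu * sg nu) - sg nu * Ymat (par_A th) a t mu nu); [ring|].
rewrite E, Ho, sg_sqr.
transitivity (- (par_Om (fst th) nu mu * (sg mu * sg mu)) + sg mu * Ymat (par_A th) a t nu mu); [|ring].
rewrite sg_sqr; ring.
Qed.

Lemma kvec_dnE be p : kvec_dn be p = sg be * kvec be p.
Proof. unfold Defs.kvec_dn, sumG, sumL, sg; destruct be as [[]|]; simpl; ring. Qed.

Lemma XcoefE th mu p : Xcoef th mu p + Bvec (par_A th) mu p =
  par_f (fst th) mu + Uvec (par_A th) (acc p) (tau p) mu
  + sumG (fun si => grad th (acc p) (tau p) mu si * kvec si p).
Proof.
unfold Xcoef, Bvec, grad, sumG, sumL; rewrite !kvec_dnE; ring.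
Qed.

(* [grad] in the moving frame. *)
Definition fgrad (th : param) (a : path) (t : R) (rho nu : Greek) : R :=
  sumG (fun mu => dn a t mu rho * sumG (fun si => grad th a t mu si * Lam a t si nu)).

Lemma fgrad_antisym th a t rho nu : C0path a ->
  sg rho * fgrad th a t rho nu = - (sg nu * fgrad th a t nu rho).
Proof.
intro Ha; unfold fgrad.
assert (E : forall rho nu, sg rho * sumG (fun mu => dn a t mu rho * sumG (fun si => grad th a t mu si * Lam a t si nu))
  = sumG (fun mu => sumG (fun si => Lam a t mu rho * Lam a t si nu * (sg mu * grad th a t mu si)))).
{ clear rho nu; intros rho nu; rewrite <- sumG_mult_l; apply sumG_ext; intro mu.
  rewrite Lam_dn_upE, <- !sumG_mult_l; apply sumG_ext; intro si.
  transitivity (sg rho * sg rho * (Lam a t mu rho * Lam a t si nu * (sg mu * grad th a t mu si))); [ring|].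
  rewrite sg_sqr; ring. }
rewrite !E, (sumG_exchange (fun mu si => Lam a t mu nu * Lam a t si rho * (sg mu * grad th a t mu si))).
transitivity (-1 * sumG (fun mu => sumG (fun si => Lam a t si nu * Lam a t mu rho * (sg si * grad th a t si mu))));
  [|ring].
rewrite <- sumG_mult_l; apply sumG_ext; intro mu.
rewrite <- sumG_mult_l; apply sumG_ext; intro si.
pose proof (grad_antisym th a t mu si Ha) as G.
assert (G' : sg mu * grad th a t mu si = - (sg si * grad th a t si mu)).
{ transitivity (sg mu * (sg si * sg si) * grad th a t mu si); [rewrite sg_sqr; ring|].
  transitivity (sg mu * sg si * (sg si * grad th a t mu si)); [ring|]; rewrite G.
  transitivity (- (sg si * (sg mu * sg mu) * grad th a t si mu)); [ring|]; rewrite sg_sqr; ring. }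
rewrite G'; ring.
Qed.

(** The antisymmetric gradient and, in the time direction only, the source xi . A and the connection
    term W zeta. With [fgrad_antisym] this is the Killing equation in the normalized frame. *)
Definition frame_zeta (th : param) (rho nu : Greek) (p : point) : R :=
  fgrad th (acc p) (tau p) rho nu
  - deltaG Tm nu * (deltaG rho Tm * sumL (fun i => par_A th i (tau p) * xi p i)
      + sumG (fun be => Wmat (acc p) (tau p) rho be * zeta th be p)) / lapse p.

Lemma is_frame_zeta th rho nu p : inM p ->
  is_frame (Fcoord nu) (zeta th rho) p (frame_zeta th rho nu p).
Proof.
intro Hp; assert (N := wt_pos (Fcoord Tm) p Hp); simpl wt in N.
assert (DX := fun mu => frame_diff_Xcoef th mu (Fcoord nu) p I Hp).
assert (EX : forall mu, frame_op (Fcoord nu) (Xcoef th mu) p =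
  sumG (fun be => par_Om (fst th) mu be * sg be * Lam (acc p) (tau p) be nu)).
{ intro mu; rewrite (der_Xcoef (frame_op (Fcoord nu)) th mu p (derivation_frame_op (Fcoord nu) I) Hp).
  apply sumG_ext; intro be; rewrite Rmult_assoc; f_equal.
  rewrite (der_kvec_dn _ be p (derivation_frame_op (Fcoord nu) I) Hp).
  rewrite (sumG_ext _ (fun al => eta be al * Lam (acc p) (tau p) al nu)).
  - unfold sumG, sumL, sg; destruct be as [[]|]; simpl; ring.
  - intro al; f_equal; apply is_frame_unique; [exact Hp|].
    exact (is_frame_k (Fcoord nu) al p I Hp). }
eapply is_frame_eq.
- apply (is_frame_sumG (Fcoord nu) (fun mu p => (Xcoef th mu p + Bvec (par_A th) mu p) * dn (acc p) (tau p) mu rho)); intro mu.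
  apply is_frame_mult.
  + apply is_frame_plus; [apply DX|].
    apply (is_frame_B (Fcoord nu) (par_A th) mu p I (C0path_par_A th) Hp).
  + apply (is_frame_dn (Fcoord nu) mu rho p I Hp).
- rewrite (sumG_ext _ (fun mu =>
    dn (acc p) (tau p) mu rho * sumG (fun si => grad th (acc p) (tau p) mu si * Lam (acc p) (tau p) si nu)
    - deltaG Tm nu / lapse p * (dn (acc p) (tau p) mu rho * Lam (acc p) (tau p) mu Tm
        * sumL (fun i => par_A th i (tau p) * xi p i)
    + (Xcoef th mu p + Bvec (par_A th) mu p) *
       sumG (fun be => Wmat (acc p) (tau p) rho be * dn (acc p) (tau p) mu be)))).
  + unfold frame_zeta, fgrad; rewrite <- (Lorentz_l (acc p) (tau p) rho Tm (proj1 Hp)).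
    unfold zeta, sumG, sumL; field; lra.
  + intro mu; rewrite EX; unfold frame_B, frame_dn, grad.
    destruct nu as [j|]; unfold sumG, sumL; cbn [deltaG]; field; lra.
Qed.

Section Fixed_acceleration.
Context (a : path) (Ha : C0path a).

Lemma econt_lapse : econt (slice_lapse a).
Proof.
apply (econt_plus (fun _ => 1) (fun q => sumL (fun i => fst q i * a i (snd q)))); [apply econt_const|].
apply (econt_sumL (fun i q => fst q i * a i (snd q))); intro i.
apply econt_mult; [apply econt_space|apply econt_time, Ha].
Qed.

Lemma econt_path Q : tcont Q -> econt (fun q => Q a (snd q)).
Proof. intro HQ; apply econt_time, HQ, Ha. Qed.

Lemma econt_fgrad th rho nu : econt (fun q => fgrad th a (snd q) rho nu).
Proof.
apply (econt_sumG (fun mu q => dn a (snd q) mu rho * sumG (fun si => grad th a (snd q) mu si * Lam a (snd q) si nu))); intro mu.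
apply econt_mult; [exact (econt_path _ (tcont_dn mu rho))|].
apply (econt_sumG (fun si q => grad th a (snd q) mu si * Lam a (snd q) si nu)); intro si.
apply econt_mult; [|exact (econt_path _ (tcont_Lam si nu))].
apply econt_minus; [apply econt_const|].
exact (econt_path _ (tcont_Ymat (par_A th) mu si (C0path_par_A th))).
Qed.

Lemma econt_zeta th rho : econt (fun q => zeta th rho (at_acc a q)).
Proof.
apply (econt_sumG (fun mu q => (Xcoef th mu (at_acc a q) + Bvec (par_A th) mu (at_acc a q)) * dn a (snd q) mu rho)); intro mu.
apply econt_mult; [|exact (econt_path _ (tcont_dn mu rho))].
intro q; apply (continuous_ext (fun q => par_f (fst th) mu + Uvec (par_A th) a (snd q) mu
  + sumG (fun si => grad th a (snd q) mu si * (sumL (fun j => Lam a (snd q) si (Sp j) * fst q j) + zvec a (snd q) si)))).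
{ intro q'; symmetry; exact (XcoefE th mu (at_acc a q')). }
revert q; apply econt_plus.
- apply econt_plus; [apply econt_const|].
  exact (econt_path _ (tcont_Uvec (par_A th) mu (C0path_par_A th))).
- apply (econt_sumG (fun si q => grad th a (snd q) mu si * (sumL (fun j => Lam a (snd q) si (Sp j) * fst q j) + zvec a (snd q) si))); intro si.
  apply econt_mult.
  + apply econt_minus; [apply econt_const|].
    exact (econt_path _ (tcont_Ymat (par_A th) mu si (C0path_par_A th))).
  + apply econt_plus; [|exact (econt_path _ (tcont_zvec si))].
    apply (econt_sumL (fun j q => Lam a (snd q) si (Sp j) * fst q j)); intro j.
    apply econt_mult; [exact (econt_path _ (tcont_Lam si (Sp j)))|apply econt_space].
Qed.

Lemma inM_event_near q : inM (at_acc a q) -> locally q (fun q' => inM (at_acc a q')).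
Proof.
intros [_ H].
apply (filter_imp (fun q' => 0 < slice_lapse a q')); [intros q' Hq; now split|].
apply econt_lapse; exact (open_gt 0 _ H).
Qed.

Lemma partial_zeta (F : event -> R) th rho mu q :
  (forall q, inM (at_acc a q) -> F q = zeta th rho (at_acc a q)) -> inM (at_acc a q) ->
  is_derive (fun s => lift F (move (at_acc a q) (dir (Fcoord mu)) s)) 0
    (wt (Fcoord mu) (at_acc a q) * frame_zeta th rho mu (at_acc a q)).
Proof.
intros HF Hq; apply (is_derive_ext_loc_R (fun s => zeta th rho (move (at_acc a q) (dir (Fcoord mu)) s))).
- generalize (inM_near _ _ Hq (frame_ok_C0 (Fcoord mu) I)); apply filter_imp; intros s Hs.
  set (p := move (at_acc a q) (dir (Fcoord mu)) s) in *.
  assert (E : at_acc a (xi p, tau p) = p).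
  { apply point_eq; intros; unfold p; destruct mu; simpl; ring. }
  unfold lift; symmetry; rewrite HF; rewrite E; auto.
- now apply is_frame_zeta.
Qed.

Lemma C1_slice_zeta (F : event -> R) th rho :
  (forall q, inM (at_acc a q) -> F q = zeta th rho (at_acc a q)) -> C1_slice a F.
Proof.
intros HF q Hq mu; split; [eexists; now apply (partial_zeta F th rho)|].
(* The weight cancels the division by the lapse, so this expression for the plain partial derivative
   is continuous on the whole event space. *)
apply (continuous_ext_loc_R (fun q => wt (Fcoord mu) (at_acc a q) * fgrad th a (snd q) rho mu
  - deltaG Tm mu * (deltaG rho Tm * sumL (fun i => par_A th i (snd q) * fst q i)
      + sumG (fun be => Wmat a (snd q) rho be * zeta th be (at_acc a q))))).
- generalize (inM_event_near q Hq); apply filter_imp; intros q' Hq'.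
  transitivity (wt (Fcoord mu) (at_acc a q') * frame_zeta th rho mu (at_acc a q')).
  + assert (N := wt_pos (Fcoord Tm) _ Hq'); simpl wt in N.
    set (w := deltaG rho Tm * sumL (fun i => par_A th i (snd q') * fst q' i)
      + sumG (fun be => Wmat a (snd q') rho be * zeta th be (at_acc a q'))).
    change (frame_zeta th rho mu (at_acc a q')) with
      (fgrad th a (snd q') rho mu - deltaG Tm mu * w / lapse (at_acc a q')).
    clearbody w; destruct mu as [i|]; cbn [wt deltaG]; field; lra.
  + symmetry; apply is_derive_unique; now apply partial_zeta.
- revert q Hq; cut (econt (fun q => wt (Fcoord mu) (at_acc a q) * fgrad th a (snd q) rho mu
  - deltaG Tm mu * (deltaG rho Tm * sumL (fun i => par_A th i (snd q) * fst q i)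
      + sumG (fun be => Wmat a (snd q) rho be * zeta th be (at_acc a q))))); [intros H q _; apply H|].
  apply econt_minus; apply econt_mult.
  + destruct mu; [exact (econt_const 1)|exact econt_lapse].
  + apply econt_fgrad.
  + apply econt_const.
  + apply econt_plus; [apply econt_mult; [apply econt_const|]|].
    * apply (econt_sumL (fun i q => par_A th i (snd q) * fst q i)); intro i.
      apply econt_mult; [apply econt_time, C0path_par_A|apply econt_space].
    * apply (econt_sumG (fun be q => Wmat a (snd q) rho be * zeta th be (at_acc a q))); intro be.
      apply econt_mult; [|apply econt_zeta].
      apply (econt_time (fun t => Wmat a t rho be)); intro t.
      destruct rho, be; simpl; first [apply Ha|apply continuous_const_R].
Qed.

Lemma Xgen_FW (th : param) Z T A :
  (forall q : event, inM (at_acc a q) ->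
         (forall i, Z i q = Xgen th (coord_xi i) (at_acc a q)) /\
         T q = Xgen th coord_tau (at_acc a q) /\
         (forall j t, A j t = Xgen th (coord_acc j t) (at_acc a q))) ->
  FW_infinitesimal a Z T A.
Proof.
intro H.
assert (M0 : inM (at_acc a (fun _ => 0, 0))).
{ apply inM_at_acc; [exact Ha|]; rewrite lapse_origin; lra. }
assert (EA : A = par_A th).
{ apply functional_extensionality; intro j; apply functional_extensionality; intro t.
  destruct (H _ M0) as [_ [_ E]]; rewrite E; now apply Xgen_coord_acc. }
assert (EZ : forall i q, inM (at_acc a q) -> Z i q = zeta th (Sp i) (at_acc a q)).
{ intros i q Hq; destruct (H q Hq) as [E _]; rewrite E; now apply Xgen_coord_xi. }
assert (EV : forall q, inM (at_acc a q) -> slice_lapse a q * T q = zeta th Tm (at_acc a q)).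
{ intros q Hq; destruct (H q Hq) as [_ [E _]]; rewrite E, Xgen_coord_tau by exact Hq.
  assert (N := proj2 Hq); unfold slice_lapse; field; lra. }
split; [|split; [|split]].
- rewrite EA; exact (C0path_par_A th).
- intro i; apply (C1_slice_zeta _ th (Sp i)), EZ.
- exact (C1_slice_zeta _ th Tm EV).
- intros q Hq.
  apply interval_variation_killing; [apply Hq|].
  assert (N := proj2 Hq); change (0 < slice_lapse a q) in N.
  assert (PZ : forall i mu, partial a mu (Z i) q = wt (Fcoord mu) (at_acc a q) * frame_zeta th (Sp i) mu (at_acc a q)).
  { intros i mu; apply is_derive_unique; apply partial_zeta; auto. }
  assert (PV : forall mu, partial a mu (fun q => slice_lapse a q * T q) q
      = wt (Fcoord mu) (at_acc a q) * frame_zeta th Tm mu (at_acc a q)).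
  { intros mu; apply is_derive_unique; apply (partial_zeta (fun q => slice_lapse a q * T q)); auto. }
  assert (AS := fun rho nu => fgrad_antisym th a (snd q) rho nu Ha).
  split; [|split].
  + intros i j; rewrite !PZ; unfold frame_zeta; cbn [wt deltaG].
    pose proof (AS (Sp i) (Sp j)) as E; unfold sg in E; simpl acc; simpl tau.
    destruct i, j; simpl eta in E; lra.
  + intro i; rewrite PZ, PV, EV by exact Hq.
    pose proof (AS (Sp i) Tm) as E.
    assert (E' : fgrad th a (snd q) (Sp i) Tm = fgrad th a (snd q) Tm (Sp i))
      by (unfold sg in E; destruct i; simpl eta in E; lra).
    unfold frame_zeta; cbn [wt deltaG]; simpl acc; simpl tau; rewrite E'.
    change (lapse (at_acc a q)) with (slice_lapse a q).
    destruct i; unfold sumG, sumL; cbn [Wmat]; field; lra.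
  + rewrite PV.
    pose proof (AS Tm Tm) as E; unfold sg in E; simpl eta in E.
    assert (E' : fgrad th a (snd q) Tm Tm = 0) by lra.
    unfold frame_zeta; cbn [wt deltaG]; simpl acc; simpl tau; simpl xi; rewrite E', EA.
    unfold sumG, sumL; rewrite !EZ by exact Hq; cbn [Wmat].
    change (lapse (at_acc a q)) with (slice_lapse a q); field; lra.
Qed.

(** The affine coefficients of the Killing solution obey linear equations in time; transported by
    Lambda to the inertial frame they integrate explicitly, and their values at time 0 are the
    parameters f and Om. *)
Lemma FW_Xgen Z T A : FW_infinitesimal a Z T A ->
  exists th : param, forall q : event, inM (at_acc a q) ->
         (forall i, Z i q = Xgen th (coord_xi i) (at_acc a q)) /\
         T q = Xgen th coord_tau (at_acc a q) /\
         (forall j t, A j t = Xgen th (coord_acc j t) (at_acc a q)).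
Proof.
intros [HA [CZ [CV HI]]].
set (V q := slice_lapse a q * T q).
assert (HK : forall q, 0 < slice_lapse a q -> killing a Z V A q).
{ intros q Hq; apply interval_variation_killing; [exact Hq|].
  apply HI, inM_at_acc; auto. }
destruct (killing_solution a Ha Z V A CZ CV HK) as [b [V0 [om [v [Hs [Has [Hb [HV0 [Hom Hv]]]]]]]]].
(* [K] and [z0] are the gradient and the value on the origin worldline of the field (Z, V) in the
   normalized frame; the equations for [om], [v], [b] and [V0] become K' = K W - W K - W_A and z0' =
   K_4 - W z0. *)
pose (K t rho si := match rho, si with
  | Sp i, Sp j => om i j t | Tm, Sp j => v j t | Sp i, Tm => v i t | Tm, Tm => 0 end).
pose (z0 t rho := match rho with Sp i => b i t | Tm => V0 t end).
assert (DK : forall t rho si, is_derive (fun t => K t rho si) t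
  (sumG (fun be => K t rho be * Wmat a t be si) - sumG (fun be => Wmat a t rho be * K t be si)
   - Wmat A t rho si)).
{ intros t [i|] [j|].
  - eapply is_derive_eq; [exact (Hom i j t)|]; unfold sumG, sumL; simpl; ring.
  - eapply is_derive_eq; [exact (Hv i t)|]; unfold sumG, sumL; simpl.
    rewrite (Has x1 i), (Has x2 i), (Has x3 i); ring.
  - eapply is_derive_eq; [exact (Hv j t)|]; unfold sumG, sumL; simpl; ring.
  - eapply is_derive_eq; [exact (is_derive_const_R 0 t)|]; unfold sumG, sumL; simpl; ring. }
assert (Dz0 : forall t rho, is_derive (fun t => z0 t rho) t
  (K t rho Tm - sumG (fun be => Wmat a t rho be * z0 t be))).
{ intros t [i|].
  - eapply is_derive_eq; [exact (Hb i t)|]; unfold sumG, sumL; simpl; ring.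
  - eapply is_derive_eq; [exact (HV0 t)|]; unfold sumG, sumL; simpl; ring. }
(* Conjugation by Lambda absorbs the commutator with W, leaving Oh' = - S_A; the solution K(0) - Y_A
   is [grad] for the parameters sought. *)
pose (Oh t mu nu := sumG (fun k => Lam a t mu k * sumG (fun l => K t k l * dn a t nu l))).
assert (DO : forall t mu nu, is_derive (fun t => Oh t mu nu) t (- Smat A a t mu nu)).
{ intros t mu nu; unfold Oh; eapply is_derive_eq.
  - apply (is_derive_sumG (fun k t => Lam a t mu k * sumG (fun l => K t k l * dn a t nu l))); intro k.
    apply is_derive_mult_R; [apply is_derive_Lam, Ha|].
    apply (is_derive_sumG (fun l t => K t k l * dn a t nu l)); intro l.
    apply is_derive_mult_R; [apply DK|apply is_derive_dn, Ha].
  - rewrite Smat_W.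
    assert (G : forall (L D : Greek -> R) (K W W' : Greek -> Greek -> R),
      sumG (fun mu0 => sumG (fun be => L be * W be mu0) * sumG (fun l => K mu0 l * D l)
        + L mu0 * sumG (fun mu1 => (sumG (fun be => K mu0 be * W be mu1)
              - sumG (fun be => W mu0 be * K be mu1) - W' mu0 mu1) * D mu1
            + K mu0 mu1 * - sumG (fun be => W mu1 be * D be)))
      = - sumG (fun k => L k * sumG (fun l => W' k l * D l))).
    { intros; unfold sumG, sumL; ring. }
    exact (G (fun k => Lam a t mu k) (fun l => dn a t nu l) (K t) (Wmat a t) (Wmat A t)). }
assert (EO : forall t mu nu, Oh t mu nu = K 0 mu nu - Ymat A a t mu nu).
{ intros t mu nu; apply (eq_of_is_derive (fun t => Oh t mu nu)
    (fun t => K 0 mu nu - Ymat A a t mu nu) (fun t => - Smat A a t mu nu)).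
  - unfold Oh, Ymat; rewrite RInt_point_R, Rminus_0_r.
    unfold sumG, sumL; rewrite !Lam_0, !dn_0 by exact Ha.
    destruct mu as [[]|], nu as [[]|]; simpl; ring.
  - intro s; apply DO.
  - intro s; eapply is_derive_eq; [apply is_derive_minus_R;
      [apply is_derive_const_R|apply is_derive_Ymat; auto]|]; simpl; ring. }
(* The inertial components of the field on the origin worldline. Their derivative is Oh Lambda_4 =
   Oh z', and integration by parts brings in U_A. *)
pose (c0 t mu := sumG (fun rho => Lam a t mu rho * z0 t rho)).
assert (Ec0 : forall t mu, c0 t mu =
  sumG (fun si => Oh t mu si * zvec a t si) + Uvec A a t mu + z0 0 mu).
{ intros t mu; apply (eq_of_is_derive (fun t => c0 t mu)
    (fun t => sumG (fun si => Oh t mu si * zvec a t si) + Uvec A a t mu + z0 0 mu)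
    (fun t => sumG (fun rho => Lam a t mu rho * K t rho Tm))).
  - unfold c0, zvec, Uvec, sumG, sumL; rewrite !RInt_point_R, !Lam_0 by exact Ha.
    destruct mu as [[]|]; simpl; ring.
  - intro s; unfold c0; eapply is_derive_eq.
    + apply (is_derive_sumG (fun rho t => Lam a t mu rho * z0 t rho)); intro rho.
      apply is_derive_mult_R; [apply is_derive_Lam, Ha|apply Dz0].
    + unfold sumG, sumL; ring.
  - intro s; eapply is_derive_eq.
    + apply is_derive_plus_R; [apply is_derive_plus_R|apply is_derive_const_R].
      * apply (is_derive_sumG (fun si t => Oh t mu si * zvec a t si)); intro si.
        apply is_derive_mult_R; [apply DO|apply is_derive_zvec, Ha].
      * apply is_derive_Uvec; auto.
    + transitivity (sumG (fun k => Lam a s mu k * sumG (fun l => K s k l *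
        sumG (fun si => dn a s si l * Lam a s si Tm)))).
      * transitivity (sumG (fun si => Oh s mu si * Lam a s si Tm)); [unfold sumG, sumL; ring|].
        unfold Oh, sumG, sumL; ring.
      * apply sumG_ext; intro k; f_equal.
        rewrite (sumG_ext _ (fun l => K s k l * deltaG l Tm)); [apply sumG_delta_r|].
        intro l; now rewrite Lorentz_l. }
(* K(0) carries mixed indices; [sg nu] raises the second one, which turns the symmetric space-time
   block into an antisymmetric one. *)
assert (HO : antisym (fun mu nu => K 0 mu nu * sg nu)).
{ intros [i|] [j|]; unfold K, sg; simpl.
  - rewrite (Has i j); destruct i, j; simpl; ring.
  - destruct i; simpl; ring.
  - destruct j; simpl; ring.
  - ring. }
pose (th := (((fun mu => z0 0 mu, exist antisym _ HO) : poincare_space),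
   (exist C0path A HA : C0paths)) : param).
exists th.
assert (EZ : forall q, inM (at_acc a q) -> forall rho, zeta th rho (at_acc a q) =
   z0 (snd q) rho + sumL (fun j => K (snd q) rho (Sp j) * fst q j)).
{ intros [x t] Hq rho; unfold zeta.
  rewrite (sumG_ext _ (fun mu => (sumG (fun k => Lam a t mu k * (z0 t k
     + sumL (fun j => K t k (Sp j) * x j)))) * dn a t mu rho)).
  - transitivity (sumG (fun k => sumG (fun mu => dn a t mu rho * Lam a t mu k) *
     (z0 t k + sumL (fun j => K t k (Sp j) * x j)))).
    + unfold sumG, sumL; ring.
    + rewrite (sumG_ext _ (fun k => deltaG rho k * (z0 t k + sumL (fun j => K t k (Sp j) * x j)))).
      * apply sumG_delta_l.
      * intro k; now rewrite Lorentz_l.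
  - intro mu; simpl acc; simpl tau; f_equal; rewrite XcoefE; simpl acc; simpl tau.
    assert (Eg : forall si, grad th a t mu si = Oh t mu si).
    { intro si; rewrite EO; unfold grad.
      change (K 0 mu si * sg si * sg si - Ymat A a t mu si = K 0 mu si - Ymat A a t mu si).
      rewrite Rmult_assoc, sg_sqr; ring. }
    change (par_f (fst th) mu) with (z0 0 mu); change (par_A th) with A.
    rewrite (sumG_ext _ (fun si => Oh t mu si * (sumL (fun j => Lam a t si (Sp j) * x j) + zvec a t si)))
      by (intro; now rewrite Eg).
    transitivity (c0 t mu + sumL (fun j => sumG (fun si => Oh t mu si * Lam a t si (Sp j)) * x j)).
    + rewrite Ec0; unfold sumG, sumL; ring.
    + assert (EL : forall j, sumG (fun si => Oh t mu si * Lam a t si (Sp j)) =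
        sumG (fun k => Lam a t mu k * K t k (Sp j))).
      { intro j; transitivity (sumG (fun k => Lam a t mu k * sumG (fun l => K t k l *
          sumG (fun si => dn a t si l * Lam a t si (Sp j))))).
        - unfold Oh, sumG, sumL; ring.
        - apply sumG_ext; intro k; f_equal.
          rewrite (sumG_ext _ (fun l => K t k l * deltaG l (Sp j))); [apply sumG_delta_r|].
          intro l; now rewrite Lorentz_l. }
      unfold c0, sumL; rewrite !EL; unfold sumG, sumL; ring. }
intros [x t] Hq; assert (N := proj2 Hq); change (0 < slice_lapse a (x, t)) in N.
destruct (Hs x t N) as [S1 S2]; split; [|split].
- intro i; rewrite Xgen_coord_xi by exact Hq.
  change (Z i (x, t) = zeta th (Sp i) (at_acc a (x, t))); rewrite EZ by exact Hq; apply S1.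
- rewrite Xgen_coord_tau, EZ by exact Hq.
  unfold V in S2; change (lapse (at_acc a (x, t))) with (slice_lapse a (x, t)).
  apply (Rmult_eq_reg_l (slice_lapse a (x, t))); [|lra].
  rewrite S2; unfold sumL; simpl; field; lra.
- intros j s; now rewrite Xgen_coord_acc by exact Hq.
Qed.

End Fixed_acceleration.

End Tetrad.

Theorem mainTheorem2 (Lam : tetrad) (HLam : is_Lambda Lam) :
  (forall (a : path), C0path a ->
     forall (Z : Lat -> event -> R) (T : event -> R) (A : path),
       FW_infinitesimal a Z T A <->
       exists th : param, forall q : event, inM (at_acc a q) ->
         (forall i, Z i q = Xgen Lam th (coord_xi i) (at_acc a q)) /\
         T q = Xgen Lam th coord_tau (at_acc a q) /\
         (forall j t, A j t = Xgen Lam th (coord_acc j t) (at_acc a q))) /\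
  (forall mu nu, op_eq (comm (Pgen Lam mu) (Pgen Lam nu)) op_zero) /\
  (forall al be mu,
     op_eq (comm (Jgen Lam al be) (Pgen Lam mu))
           (fun F p => eta mu al * Pgen Lam be F p - eta mu be * Pgen Lam al F p)) /\
  (forall al be mu nu,
     op_eq (comm (Jgen Lam al be) (Jgen Lam mu nu))
           (fun F p => eta mu al * Jgen Lam be nu F p - eta mu be * Jgen Lam al nu F p
                     - eta nu al * Jgen Lam be mu F p + eta nu be * Jgen Lam al mu F p)) /\
  (forall i (phi : R -> R) mu, (forall t, continuous phi t) ->
     op_eq (comm (Dgen Lam i phi) (Pgen Lam mu)) op_zero) /\
  (forall i (phi : R -> R) al be, (forall t, continuous phi t) ->
     op_eq (comm (Dgen Lam i phi) (Jgen Lam al be)) op_zero) /\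
  (forall i (phi : R -> R) j (psi : R -> R), (forall t, continuous phi t) -> (forall t, continuous psi t) ->
     op_eq (comm (Dgen Lam i phi) (Dgen Lam j psi)) op_zero) /\
  (exists (br : param -> param -> param) (Hbr : is_lie_bracket br)
          (pi : mkLie Hbr -> poincare),
     (forall th th', op_eq (Xgen Lam th) (Xgen Lam th') -> th = th') /\
     (forall th th', op_eq (comm (Xgen Lam th) (Xgen Lam th')) (Xgen Lam (br th th'))) /\
     is_abelian_extension pi /\
     (forall th : param, pi th = zero <-> fst th = zero)).
Proof.
repeat match goal with |- _ /\ _ => split end.
- intros a Ha Z T A; split; [now apply FW_Xgen|].
  intros [th H]; now apply (Xgen_FW Lam HLam a Ha th).
- intros mu nu F HF p Hp; unfold comm, op_zero.
  rewrite (Pgen_comm Lam HLam mu nu) by assumption; ring.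
- exact (Jgen_Pgen_comm Lam HLam).
- exact (Jgen_comm Lam HLam).
- intros i phi mu Hphi F HF p Hp; unfold comm, op_zero.
  rewrite (Dgen_Pgen_comm Lam HLam) by assumption; ring.
- exact (Dgen_Jgen_comm Lam HLam).
- intros i phi j psi Hphi Hpsi F HF p Hp; unfold comm, op_zero.
  rewrite (Dgen_comm Lam HLam i phi j psi) by assumption; ring.
- exists param_br, param_br_is_lie, param_proj.
  repeat match goal with |- _ /\ _ => split end.
  + exact (Xgen_faithful Lam HLam).
  + exact (Xgen_comm Lam HLam).
  + exact param_br_extension.
  + exact param_proj_zero.
Qed.
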